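(* Let $k$ be a commutative ring and let $(\mathcal{A},\otimes,I)$ be a $k$-linear monoidal category whose underlying category is abelian with enough projectives ($\otimes$ is not assumed to be exact). Let $\epsilon:P^\bullet\to I$ be a projective resolution such that for every $n$ the map $\epsilon^{\otimes n}:(P^\bullet)^{\otimes n}\to I^{\otimes n}\cong I$ is a resolution (not necessarily projective). Then there is an $A_\infty$-coalgebra structure on $P^\bullet$ with homotopy counit $\epsilon$, lifting the trivial coalgebra structure on $I$.
   Context: Projective resolutions are complexes concentrated in non-positive cohomological degrees. For a complex $X$, $(\Sigma X)_i=X_{i+1}$ with differential $-d$; $\eta:X\to\Sigma X$ is the identity viewed as a degree $-1$ map. The Koszul sign rule is used. $C^-(\mathcal{A})$ is the monoidal category of right bounded complexes over $\mathcal{A}$, enriched in complexes of $k$-modules; $X^{\otimes 0}=I$. **$A_\infty$-coalgebras.** For $C\in C^-(\mathcal{A})$, an $A_\infty$-coalgebra structure on $C$ is a family $\xi=(\xi_n)_{n\ge0}$ of degree $1$ elements $\xi_n\in\mathrm{Hom}_{\mathcal{A}}(\Sigma^{-1}C,(\Sigma^{-1}C)^{\otimes n})$ with $\xi_0=0$ satisfying $Q^1(\xi)+\xi\bullet\xi=0$, where $Q^1=[d,-]$ is the differential of the Hom-complexes and $\phi\bullet\psi=\sum_{a,b}(\mathrm{Id}^{\otimes a}\otimes\phi\otimes\mathrm{Id}^{\otimes b})\circ\psi$. Equivalently, with $b_0=0$, $b_1=d+\xi_1$ and $b_n=\xi_n$ for $n\ge2$, one has $\sum_{a+c+b=n}(\mathrm{id}^{\otimes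 a}\otimes b_c\otimes\mathrm{id}^{\otimes b})\circ b_{a+1+b}=0$ for all $n$. Write $\xi_2=(\eta^{-1}\otimes\eta^{-1})\circ\Delta\circ\eta$ with $\Delta:C\to C\otimes C$ of degree $0$. A homotopy counit is a closed degree $0$ map $\epsilon:C\to I$ such that $(\epsilon\otimes\mathrm{id})\circ\Delta$ and $(\mathrm{id}\otimes\epsilon)\circ\Delta$ are homotopic to $\mathrm{id}_C$ (closedness and homotopies refer to the differential $b_1$ of $C$). **Lifting.** The trivial coalgebra structure on $I$ is given by the canonical isomorphism $I\cong I\otimes I$. That the structure on $P^\bullet$ lifts it means that $(\epsilon\otimes\epsilon)\circ\Delta:P^\bullet\to I\otimes I$ equals $\epsilon$ composed with the canonical isomorphism $I\cong I\otimes I$. *)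

(* Defs.v *)
From HB Require Import structures.
From mathcomp Require Import all_boot all_order all_algebra.
From mathcomp Require Import zify.

Set Implicit Arguments.
Unset Strict Implicit.
Unset Printing Implicit Defensive.

Import Order.TTheory GRing.Theory Num.Theory.
Local Open Scope ring_scope.

Record linCat (k : comPzRingType) := LinCat {
  Ob :> Type;
  Hom : Ob -> Ob -> lmodType k;
  idm : forall x, Hom x x;
  mcomp : forall x y z, Hom y z -> Hom x y -> Hom x z;
  mcomp1m : forall x y (f : Hom x y), mcomp (idm y) f = f;
  mcompm1 : forall x y (f : Hom x y), mcomp f (idm x) = f;
  mcompA : forall x y z t (h : Hom z t) (g : Hom y z) (f : Hom x y),
    mcomp h (mcomp g f) = mcomp (mcomp h g) f;
  mcomp_linearr : forall x y z (g : Hom y z), linear (@mcomp x y z g);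
  mcomp_linearl : forall x y z (f : Hom x y),
    linear (fun g : Hom y z => mcomp g f)
}.

Arguments idm {k l} x.
Arguments mcomp {k l x y z} g f.

Notation "g ∘ f" := (mcomp g f) (at level 40, left associativity).

Section LinCatTheory.
Variables (k : comPzRingType) (A : linCat k).

Definition is_zero (x : A) : Prop :=
  (forall y (f : Hom x y), f = 0) /\ (forall y (f : Hom y x), f = 0).

Definition mono (x y : A) (f : Hom x y) : Prop :=
  forall z (g h : Hom z x), f ∘ g = f ∘ h -> g = h.

Definition epi (x y : A) (f : Hom x y) : Prop :=
  forall z (g h : Hom y z), g ∘ f = h ∘ f -> g = h.

Definition is_kernel (K x y : A) (f : Hom x y) (i : Hom K x) : Prop :=
  f ∘ i = 0 /\
  forall z (g : Hom z x), f ∘ g = 0 -> exists! h : Hom z K, i ∘ h = g.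

Definition is_cokernel (x y Q : A) (f : Hom x y) (p : Hom y Q) : Prop :=
  p ∘ f = 0 /\
  forall z (g : Hom y z), g ∘ f = 0 -> exists! h : Hom Q z, h ∘ p = g.

Definition projective (p : A) : Prop :=
  forall x y (e : Hom x y) (f : Hom p y), epi e ->
  exists g : Hom p x, e ∘ g = f.

Definition enough_projectives : Prop :=
  forall x : A, exists (p : A) (e : Hom p x), projective p /\ epi e.

(* The image of f is the kernel of g. *)
Definition exact (x y z : A) (f : Hom x y) (g : Hom y z) : Prop :=
  exists (K : A) (i : Hom K y) (e : Hom x K),
    [/\ is_kernel g i, epi e & i ∘ e = f].

(* The identity of F i if i = j, and 0 otherwise. *)
Definition cid (T : eqType) (F : T -> A) (i j : T) : Hom (F i) (F j) :=
  match i =P j with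
  | ReflectT e => eq_rect i (fun j => Hom (F i) (F j)) (idm (F i)) j e
  | ReflectF _ => 0
  end.

End LinCatTheory.

(* Abelian structure with chosen finite biproducts; the empty biproduct is a
   zero object. *)
Record abelianStr (k : comPzRingType) (A : linCat k) := AbelianStr {
  biprod : forall J : finType, (J -> A) -> A;
  binj : forall (J : finType) (F : J -> A) (j : J), Hom (F j) (biprod F);
  bproj : forall (J : finType) (F : J -> A) (j : J), Hom (biprod F) (F j);
  bproj_inj : forall (J : finType) (F : J -> A) (i j : J),
    bproj F j ∘ binj F i = cid F i j;
  bsum_inj_proj : forall (J : finType) (F : J -> A),
    \sum_(j : J) (binj F j ∘ bproj F j) = idm (biprod F);
  has_kernel : forall (x y : A) (f : Hom x y),
    exists (K : A) (i : Hom K x), is_kernel f i;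
  has_cokernel : forall (x y : A) (f : Hom x y),
    exists (Q : A) (p : Hom y Q), is_cokernel f p;
  mono_normal : forall (x y : A) (f : Hom x y), mono f ->
    exists (z : A) (g : Hom y z), is_kernel g f;
  epi_normal : forall (x y : A) (f : Hom x y), epi f ->
    exists (z : A) (g : Hom z x), is_cokernel g f
}.

Record monoidalStr (k : comPzRingType) (A : linCat k) := MonoidalStr {
  tob : A -> A -> A;
  thom : forall x x' y y' : A,
    Hom x x' -> Hom y y' -> Hom (tob x y) (tob x' y');
  tunit : A;
  thom1 : forall x y, thom (idm x) (idm y) = idm (tob x y);
  thom_comp : forall (x x' x'' y y' y'' : A)
    (f' : Hom x' x'') (f : Hom x x') (g' : Hom y' y'') (g : Hom y y'),
    thom (f' ∘ f) (g' ∘ g) = thom f' g' ∘ thom f g;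
  thom_linearr : forall (x x' y y' : A) (f : Hom x x'),
    linear (@thom x x' y y' f);
  thom_linearl : forall (x x' y y' : A) (g : Hom y y'),
    linear (fun f : Hom x x' => thom f g);
  assoc : forall x y z, Hom (tob (tob x y) z) (tob x (tob y z));
  associ : forall x y z, Hom (tob x (tob y z)) (tob (tob x y) z);
  lunit : forall x, Hom (tob tunit x) x;
  luniti : forall x, Hom x (tob tunit x);
  runit : forall x, Hom (tob x tunit) x;
  runiti : forall x, Hom x (tob x tunit);
  assocK : forall x y z, associ x y z ∘ assoc x y z = idm _;
  associK : forall x y z, assoc x y z ∘ associ x y z = idm _;
  lunitK : forall x, luniti x ∘ lunit x = idm _;
  lunitiK : forall x, lunit x ∘ luniti x = idm _;
  runitK : forall x, runiti x ∘ runit x = idm _;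
  runitiK : forall x, runit x ∘ runiti x = idm _;
  assoc_nat : forall (x x' y y' z z' : A)
    (f : Hom x x') (g : Hom y y') (h : Hom z z'),
    assoc x' y' z' ∘ thom (thom f g) h = thom f (thom g h) ∘ assoc x y z;
  lunit_nat : forall (x x' : A) (f : Hom x x'),
    lunit x' ∘ thom (idm tunit) f = f ∘ lunit x;
  runit_nat : forall (x x' : A) (f : Hom x x'),
    runit x' ∘ thom f (idm tunit) = f ∘ runit x;
  pentagon : forall x y z t,
    assoc x y (tob z t) ∘ assoc (tob x y) z t =
    thom (idm x) (assoc y z t) ∘ assoc x (tob y z) t
      ∘ thom (assoc x y z) (idm t);
  triangle : forall x y,
    thom (idm x) (lunit y) ∘ assoc x tunit y = thom (runit x) (idm y)
}.

Record abMonCat (k : comPzRingType) := AbMonCat {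
  amc_cat :> linCat k;
  amc_abelian : abelianStr amc_cat;
  amc_monoidal : monoidalStr amc_cat
}.

Section AbMonCatOps.
Variables (k : comPzRingType) (A : abMonCat k).

Definition bigoplus (J : finType) (F : J -> A) : A :=
  biprod (amc_abelian A) F.
Definition inj (J : finType) (F : J -> A) (j : J) : Hom (F j) (bigoplus F) :=
  binj (amc_abelian A) F j.
Definition proj (J : finType) (F : J -> A) (j : J) : Hom (bigoplus F) (F j) :=
  bproj (amc_abelian A) F j.

Definition ten (x y : A) : A := tob (amc_monoidal A) x y.
Definition unit_ob : A := tunit (amc_monoidal A).
Definition tenm (x x' y y' : A) (f : Hom x x') (g : Hom y y') :
  Hom (ten x y) (ten x' y') := thom (amc_monoidal A) f g.
Definition asc (x y z : A) : Hom (ten (ten x y) z) (ten x (ten y z)) :=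
  assoc (amc_monoidal A) x y z.
Definition asci (x y z : A) : Hom (ten x (ten y z)) (ten (ten x y) z) :=
  associ (amc_monoidal A) x y z.
Definition lam (x : A) : Hom (ten unit_ob x) x := lunit (amc_monoidal A) x.
Definition lami (x : A) : Hom x (ten unit_ob x) := luniti (amc_monoidal A) x.
Definition rho (x : A) : Hom (ten x unit_ob) x := runit (amc_monoidal A) x.
Definition rhoi (x : A) : Hom x (ten x unit_ob) := runiti (amc_monoidal A) x.

End AbMonCatOps.

Arguments unit_ob {k} A.
Notation "x ⊗ y" := (ten x y) (at level 38, right associativity).
Notation "f ⊗ₘ g" := (tenm f g) (at level 38, right associativity).

Section LinearLemmas.
Variables (k : comPzRingType) (A : abMonCat k).
Implicit Types x y z : A.

Lemma comp0r x y z (g : Hom y z) : g ∘ (0 : Hom x y) = 0.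
Proof.
by have := mcomp_linearr g (-1) (0 : Hom x y) 0;
  rewrite scaler0 addr0 scaleN1r addNr.
Qed.

Lemma comp0l x y z (f : Hom x y) : (0 : Hom y z) ∘ f = 0.
Proof.
by have := mcomp_linearl f (-1) (0 : Hom y z) 0;
  rewrite scaler0 addr0 scaleN1r addNr.
Qed.

Lemma compZr x y z a (g : Hom y z) (f : Hom x y) :
  g ∘ (a *: f) = a *: (g ∘ f).
Proof. by have := mcomp_linearr g a f 0; rewrite comp0r !addr0. Qed.

Lemma compZl x y z a (g : Hom y z) (f : Hom x y) :
  (a *: g) ∘ f = a *: (g ∘ f).
Proof. by have := mcomp_linearl f a g 0; rewrite comp0l !addr0. Qed.

Lemma compDr x y z (g : Hom y z) (f f' : Hom x y) :
  g ∘ (f + f') = g ∘ f + g ∘ f'.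
Proof. by have := mcomp_linearr g 1 f f'; rewrite !scale1r. Qed.

Lemma compDl x y z (g g' : Hom y z) (f : Hom x y) :
  (g + g') ∘ f = g ∘ f + g' ∘ f.
Proof. by have := mcomp_linearl f 1 g g'; rewrite !scale1r. Qed.

Lemma comp_sumr x y z (J : Type) (r : seq J) (P : pred J)
    (g : Hom y z) (f : J -> Hom x y) :
  g ∘ (\sum_(j <- r | P j) f j) = \sum_(j <- r | P j) (g ∘ f j).
Proof.
apply: (big_morph (fun f => g ∘ f)) => [f1 f2|]; [exact: compDr|exact: comp0r].
Qed.

Lemma comp_suml x y z (J : Type) (r : seq J) (P : pred J)
    (f : Hom x y) (g : J -> Hom y z) :
  (\sum_(j <- r | P j) g j) ∘ f = \sum_(j <- r | P j) (g j ∘ f).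
Proof.
apply: (big_morph (fun g => g ∘ f)) => [g1 g2|]; [exact: compDl|exact: comp0l].
Qed.

Lemma tenm0r x x' y y' (f : Hom x x') : f ⊗ₘ (0 : Hom y y') = 0.
Proof.
by have := thom_linearr (amc_monoidal A) f (-1) (0 : Hom y y') 0;
  rewrite scaler0 addr0 scaleN1r addNr.
Qed.

Lemma tenm0l x x' y y' (g : Hom y y') : (0 : Hom x x') ⊗ₘ g = 0.
Proof.
by have := thom_linearl (amc_monoidal A) g (-1) (0 : Hom x x') 0;
  rewrite scaler0 addr0 scaleN1r addNr.
Qed.

Lemma tenm_comp x x' x'' y y' y''
    (f' : Hom x' x'') (f : Hom x x') (g' : Hom y' y'') (g : Hom y y') :
  (f' ⊗ₘ g') ∘ (f ⊗ₘ g) = (f' ∘ f) ⊗ₘ (g' ∘ g).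
Proof. by rewrite /tenm thom_comp. Qed.

Lemma cid_refl (T : eqType) (F : T -> A) i : cid F i i = idm (F i).
Proof. by rewrite /cid; case: eqP => // e; rewrite (eq_axiomK e). Qed.

Lemma cid_neq (T : eqType) (F : T -> A) i j : i != j -> cid F i j = 0.
Proof. by rewrite /cid; case: eqP. Qed.

Lemma proj_inj (J : finType) (F : J -> A) i j :
  proj F j ∘ inj F i = cid F i j.
Proof. exact: bproj_inj. Qed.

Lemma is_zero_idm x : idm x = 0 -> is_zero x.
Proof.
move=> x0; split=> y f; first by rewrite -[f]mcompm1 x0 comp0r.
by rewrite -[f]mcomp1m x0 comp0l.
Qed.

Lemma bigoplus0 (J : finType) (F : J -> A) : #|J| = 0%N -> is_zero (bigoplus F).
Proof.
move=> J0; apply: is_zero_idm; rewrite -bsum_inj_proj big1// => j _.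
by have := fintype0 j J0.
Qed.

End LinearLemmas.

(* The bound top need not be sharp: the objects in degrees at most top may be
   zero. It only serves to make the sums defining a tensor product finite, and
   another choice changes the tensor product by zero summands. *)
Record grob (k : comPzRingType) (A : abMonCat k) := GrOb {
  gr :> int -> A;
  top : int;
  gr_zero : forall i, top < i -> is_zero (gr i)
}.

(* A map of any degree is the family of all its components; a map of degree p
   is one which satisfies [homogeneous p]. *)
Definition gmap (k : comPzRingType) (A : abMonCat k) (X Y : grob A) :=
  forall i j, Hom (X i) (Y j).

Section GradedMaps.
Variables (k : comPzRingType) (A : abMonCat k).
Implicit Types X Y Z : grob A.

Definition homogeneous (p : int) X Y (f : gmap X Y) : Prop :=
  forall i j, j != i + p -> f i j = 0.

Definition gid X : gmap X X := fun i j => cid X i j.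

Definition gzero X Y : gmap X Y := fun i j => 0.

Definition gadd X Y (f g : gmap X Y) : gmap X Y := fun i j => f i j + g i j.

Definition gopp X Y (f : gmap X Y) : gmap X Y := fun i j => - f i j.

(* The composite of g and a map f of degree p. *)
Definition gcomp X Y Z (p : int) (g : gmap Y Z) (f : gmap X Y) : gmap X Z :=
  fun i j => g (i + p) j ∘ f i (i + p).

Definition ksign (p : int) : k := (-1) ^+ `|p|%N.

Definition tdim X Y (m : int) : nat := absz (Num.max 0 (top X + top Y - m + 1)).

(* Indices of the pairs (i, j) with i + j = m, i <= top X and j <= top Y. *)
Definition tidx X Y (m : int) : finType := 'I_(tdim X Y m).

Definition ldeg X Y m (u : tidx X Y m) : int := top X - (u : nat)%:Z.
Definition rdeg X Y m (u : tidx X Y m) : int := m - ldeg u.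

Definition tensg_ob X Y (m : int) : A :=
  bigoplus (fun u : tidx X Y m => X (ldeg u) ⊗ Y (rdeg u)).

Definition tinj X Y m (u : tidx X Y m) :
  Hom (X (ldeg u) ⊗ Y (rdeg u)) (tensg_ob X Y m) :=
  inj (fun u : tidx X Y m => X (ldeg u) ⊗ Y (rdeg u)) u.

Definition tproj X Y m (u : tidx X Y m) :
  Hom (tensg_ob X Y m) (X (ldeg u) ⊗ Y (rdeg u)) :=
  proj (fun u : tidx X Y m => X (ldeg u) ⊗ Y (rdeg u)) u.

Lemma tensg_zero X Y m : top X + top Y < m -> is_zero (tensg_ob X Y m).
Proof.
move=> lt_m; apply: bigoplus0; rewrite card_ord /tdim.
by rewrite max_l //; lia.
Qed.

Definition tensg X Y : grob A := GrOb (@tensg_zero X Y).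

(* The tensor product of f with a map g of degree q, with the Koszul sign
   (f ⊗ g)(x ⊗ y) = (-1)^(q |x|) f x ⊗ g y. *)
Definition gtens X X' Y Y' (q : int) (f : gmap X X') (g : gmap Y Y') :
    gmap (tensg X Y) (tensg X' Y') :=
  fun m m' => \sum_(u : tidx X Y m) \sum_(v : tidx X' Y' m')
    (tinj v ∘ (ksign (q * ldeg u) *:
      (f (ldeg u) (ldeg v) ⊗ₘ g (rdeg u) (rdeg v))) ∘ tproj u).

End GradedMaps.

Arguments gid {k A} X.
Notation "g ∘[ p ] f" := (gcomp p g f)
  (at level 40, left associativity, p at level 99).
Notation "f ⊗[ q ] g" := (gtens q f g)
  (at level 38, right associativity, q at level 99).

Section TensorLemmas.
Variables (k : comPzRingType) (A : abMonCat k).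
Implicit Types X Y Z : grob A.

Lemma ldeg_ex X Y m i : i <= top X -> m - i <= top Y ->
  exists u : tidx X Y m, ldeg u = i.
Proof.
move=> leX leY; have lt_u : (`|top X - i| < tdim X Y m)%N by rewrite /tdim; lia.
by exists (Ordinal lt_u); rewrite /ldeg /=; lia.
Qed.

Lemma ldeg_inj X Y m : injective (@ldeg k A X Y m).
Proof. by move=> u v; rewrite /ldeg => e; apply: val_inj => /=; lia. Qed.

Lemma tproj_inj X Y m (v w : tidx X Y m) :
  tproj w ∘ tinj v = cid (fun u : tidx X Y m => X (ldeg u) ⊗ Y (rdeg u)) v w.
Proof. exact: proj_inj. Qed.

Lemma gid_homogeneous X : homogeneous 0 (gid X).
Proof. by move=> i j; rewrite addr0 eq_sym; apply: cid_neq. Qed.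

Lemma gtens_homogeneous X X' Y Y' p q (f : gmap X X') (g : gmap Y Y') :
  homogeneous p f -> homogeneous q g -> homogeneous (p + q) (f ⊗[q] g).
Proof.
move=> fp gq m m' ne_m; rewrite /gtens big1// => u _; rewrite big1// => v _.
have [e|ne] := eqVneq (ldeg v) (ldeg u + p).
  rewrite (gq (rdeg u)); last by apply/eqP; move/eqP: ne_m; rewrite /rdeg; lia.
  by rewrite tenm0r scaler0 comp0r comp0l.
by rewrite fp// tenm0l scaler0 comp0r comp0l.
Qed.

Lemma ksignD p q : ksign k (p + q) = ksign k p * ksign k q.
Proof.
rewrite /ksign -exprD -signr_odd -[RHS]signr_odd; congr (_ ^+ nat_of_bool _).
by lia.
Qed.

Lemma gtens_comp X X' X'' Y Y' Y'' p' q q'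
    (f : gmap X' X'') (g : gmap Y' Y'') (f' : gmap X X') (g' : gmap Y Y') :
  homogeneous p' f' -> homogeneous q' g' -> forall m n,
  ((f ⊗[q] g) ∘[p' + q'] (f' ⊗[q'] g')) m n =
  ksign k (q * p') *: ((f ∘[p'] f') ⊗[q + q'] (g ∘[q'] g')) m n.
Proof.
move=> f'p g'q m n; rewrite /gcomp /gtens comp_sumr scaler_sumr.
apply: eq_bigr => u _; rewrite comp_suml scaler_sumr.
pose m' := m + (p' + q').
under eq_bigr => v _ do rewrite comp_suml.
rewrite exchange_big; apply: eq_bigr => w _ /=.
have step (v v' : tidx X' Y' m') :
    tinj w ∘ (ksign k (q * ldeg v) *:
      (f (ldeg v) (ldeg w) ⊗ₘ g (rdeg v) (rdeg w))) ∘ tproj v ∘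
    (tinj v' ∘ (ksign k (q' * ldeg u) *:
      (f' (ldeg u) (ldeg v') ⊗ₘ g' (rdeg u) (rdeg v'))) ∘ tproj u) =
    if v' == v then
      (ksign k (q * ldeg v) * ksign k (q' * ldeg u)) *: (tinj w ∘
      ((f (ldeg v) (ldeg w) ∘ f' (ldeg u) (ldeg v)) ⊗ₘ
       (g (rdeg v) (rdeg w) ∘ g' (rdeg u) (rdeg v))) ∘ tproj u)
    else 0.
  rewrite -!mcompA [tproj v ∘ _]mcompA tproj_inj; case: eqVneq => [->|ne].
    rewrite cid_refl mcomp1m -tenm_comp !(compZl, compZr) scalerA.
    by rewrite !mcompA mulrC.
  by rewrite (cid_neq _ ne) comp0l !comp0r.
rewrite (eq_bigr (fun v : tidx X' Y' m' =>
  (ksign k (q * ldeg v) * ksign k (q' * ldeg u)) *: (tinj w ∘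
      ((f (ldeg v) (ldeg w) ∘ f' (ldeg u) (ldeg v)) ⊗ₘ
       (g (rdeg v) (rdeg w) ∘ g' (rdeg u) (rdeg v))) ∘ tproj u))); last first.
  move=> v _; rewrite comp_sumr (bigD1 v) //= step eqxx big1 ?addr0// => v' ne.
  by rewrite step (negPf ne).
have rE : m' - (ldeg u + p') = rdeg u + q' by rewrite /m' /rdeg; lia.
have other (v : tidx X' Y' m') : ldeg v != ldeg u + p' ->
    (ksign k (q * ldeg v) * ksign k (q' * ldeg u)) *: (tinj w ∘
      ((f (ldeg v) (ldeg w) ∘ f' (ldeg u) (ldeg v)) ⊗ₘ
       (g (rdeg v) (rdeg w) ∘ g' (rdeg u) (rdeg v))) ∘ tproj u) = 0.
  by move=> ne; rewrite (f'p _ _ ne) comp0r tenm0l comp0r comp0l scaler0.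
have [leX|gtX] := leP (ldeg u + p') (top X'); last first.
  rewrite big1 => [|v _]; last first.
    by apply: other; apply/eqP => e; move: gtX; rewrite -e /ldeg; lia.
  have [_ z] := gr_zero gtX; rewrite (z _ (f' (ldeg u) (ldeg u + p'))).
  by rewrite comp0r tenm0l scaler0 comp0r comp0l scaler0.
have [leY|gtY] := leP (rdeg u + q') (top Y'); last first.
  rewrite big1 => [|v _].
    have [_ z] := gr_zero gtY; rewrite (z _ (g' (rdeg u) (rdeg u + q'))).
    by rewrite comp0r tenm0r scaler0 comp0r comp0l scaler0.
  by apply: other; apply/eqP => e; move: gtY; rewrite -rE -e /ldeg;
    have := ltn_ord v; rewrite /tdim; lia.
have [|v vE] := @ldeg_ex X' Y' m' _ leX; first by rewrite rE.
rewrite (bigD1 v) //= big1 ?addr0 => [|v' ne]; last first.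
  apply: other; rewrite -vE; apply: contra ne => /eqP e.
  by rewrite (ldeg_inj e).
have rvE : rdeg v = rdeg u + q' by rewrite -rE -vE.
rewrite rvE vE compZr compZl scalerA -!ksignD; congr (ksign k _ *: _).
by rewrite mulrDr mulrDl [_ + q * p']addrC -addrA.
Qed.

End TensorLemmas.

Record complex (k : comPzRingType) (A : abMonCat k) := Complex {
  cgr :> grob A;
  diff : gmap cgr cgr;
  diff_homogeneous : homogeneous 1 diff;
  diff_diff : forall i j, (diff ∘[1] diff) i j = 0
}.

Section Complexes.
Variables (k : comPzRingType) (A : abMonCat k).
Implicit Types (X Y Z C : complex A).

Definition zero_ob : A := bigoplus (fun _ : 'I_0 => unit_ob A).

Definition unit_gr (i : int) : A :=
  match i with Posz 0 => unit_ob A | _ => zero_ob end.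

Lemma unit_gr_zero i : 0 < i -> is_zero (unit_gr i).
Proof. by case: i => [[|n]|n] //= _; apply: bigoplus0; rewrite card_ord. Qed.

Definition unit_grob : grob A := GrOb unit_gr_zero.

Lemma gzero_homogeneous p (X Y : grob A) : homogeneous p (gzero X Y).
Proof. by []. Qed.

Lemma gcomp0 (X Y Z : grob A) p (g : gmap Y Z) i j :
  (g ∘[p] gzero X Y) i j = 0.
Proof. exact: comp0r. Qed.

Definition unit_cplx : complex A :=
  Complex (@gzero_homogeneous 1 unit_grob unit_grob)
    (@gcomp0 unit_grob unit_grob unit_grob 1 (gzero unit_grob unit_grob)).

Definition tens_diff X Y : gmap (tensg X Y) (tensg X Y) :=
  gadd (diff X ⊗[0] gid Y) (gid X ⊗[1] diff Y).

Lemma tens_diff_homogeneous X Y : homogeneous 1 (tens_diff X Y).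
Proof.
move=> i j ne; rewrite /tens_diff /gadd.
rewrite (gtens_homogeneous (diff_homogeneous X) (gid_homogeneous Y)) ?addr0//.
by rewrite (gtens_homogeneous (gid_homogeneous X) (diff_homogeneous Y)) ?addr0.
Qed.

Lemma gid_compl (X Y : grob A) p (f : gmap X Y) : homogeneous p f ->
  forall i j, (gid Y ∘[p] f) i j = f i j.
Proof.
move=> fp i j; rewrite /gcomp /gid; case: (eqVneq (i + p) j) => [<-|ne].
  by rewrite cid_refl mcomp1m.
by rewrite (cid_neq _ ne) comp0l fp// eq_sym.
Qed.

Lemma gid_compr (X Y : grob A) (f : gmap X Y) i j :
  (f ∘[0] gid X) i j = f i j.
Proof. by rewrite /gcomp addr0 /gid cid_refl mcompm1. Qed.

Lemma gtens_eq (X X' Y Y' : grob A) q (f f' : gmap X X') (g g' : gmap Y Y') :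
  (forall i j, f i j = f' i j) -> (forall i j, g i j = g' i j) ->
  forall i j, (f ⊗[q] g) i j = (f' ⊗[q] g') i j.
Proof.
by move=> ef eg i j; apply: eq_bigr => u _; apply: eq_bigr => v _; rewrite ef eg.
Qed.

Lemma gtens_0l (X X' Y Y' : grob A) q (f : gmap X X') (g : gmap Y Y') :
  (forall i j, f i j = 0) -> forall i j, (f ⊗[q] g) i j = 0.
Proof.
move=> f0 i j; rewrite /gtens big1// => u _; rewrite big1// => v _.
by rewrite f0 tenm0l scaler0 comp0r comp0l.
Qed.

Lemma gtens_0r (X X' Y Y' : grob A) q (f : gmap X X') (g : gmap Y Y') :
  (forall i j, g i j = 0) -> forall i j, (f ⊗[q] g) i j = 0.
Proof.
move=> g0 i j; rewrite /gtens big1// => u _; rewrite big1// => v _.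
by rewrite g0 tenm0r scaler0 comp0r comp0l.
Qed.

Lemma tens_diff_diff X Y i j : (tens_diff X Y ∘[1] tens_diff X Y) i j = 0.
Proof.
have dX := diff_homogeneous X; have dY := diff_homogeneous Y.
have oX := gid_homogeneous X; have oY := gid_homogeneous Y.
have := gtens_comp 0 (diff X) (gid Y) dX oY i j.
have := gtens_comp 1 (gid X) (diff Y) dX oY i j.
have := gtens_comp 0 (diff X) (gid Y) oX dY i j.
have := gtens_comp 1 (gid X) (diff Y) oX dY i j.
rewrite !addr0 !add0r !mul0r !mulr0 mulr1 => e1 e2 e3 e4.
have -> : (tens_diff X Y ∘[1] tens_diff X Y) i j =
    ((diff X ⊗[0] gid Y) ∘[1] (diff X ⊗[0] gid Y)) i j +
    ((diff X ⊗[0] gid Y) ∘[1] (gid X ⊗[1] diff Y)) i j +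
    (((gid X ⊗[1] diff Y) ∘[1] (diff X ⊗[0] gid Y)) i j +
     ((gid X ⊗[1] diff Y) ∘[1] (gid X ⊗[1] diff Y)) i j).
  by rewrite {1}/gcomp /tens_diff /gadd compDl !compDr.
rewrite e1 e2 e3 e4 (gtens_0l _ _ (diff_diff X)) (gtens_0r _ _ (diff_diff Y)).
rewrite !scaler0 add0r addr0.
rewrite (gtens_eq 1 (gid_compr (diff X)) (gid_compl dY)).
rewrite (gtens_eq 1 (gid_compl dX) (gid_compr (diff Y))).
by rewrite /ksign /= expr0 expr1 scale1r scaleN1r subrr.
Qed.

Definition tensc X Y : complex A :=
  Complex (@tens_diff_homogeneous X Y) (@tens_diff_diff X Y).

Definition gassoc X Y Z : gmap (tensc (tensc X Y) Z) (tensc X (tensc Y Z)) :=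
  fun m n =>
  \sum_(u : tidx (tensc X Y) Z m) \sum_(u' : tidx X Y (ldeg u))
  \sum_(v : tidx X (tensc Y Z) n) \sum_(v' : tidx Y Z (rdeg v))
    (tinj v ∘ (idm (X (ldeg v)) ⊗ₘ tinj v')
     ∘ (cid X (ldeg u') (ldeg v) ⊗ₘ
        (cid Y (rdeg u') (ldeg v') ⊗ₘ cid Z (rdeg u) (rdeg v')))
     ∘ asc (X (ldeg u')) (Y (rdeg u')) (Z (rdeg u))
     ∘ (tproj u' ⊗ₘ idm (Z (rdeg u))) ∘ tproj u).

Definition gassoci X Y Z : gmap (tensc X (tensc Y Z)) (tensc (tensc X Y) Z) :=
  fun n m =>
  \sum_(v : tidx X (tensc Y Z) n) \sum_(v' : tidx Y Z (rdeg v))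
  \sum_(u : tidx (tensc X Y) Z m) \sum_(u' : tidx X Y (ldeg u))
    (tinj u ∘ (tinj u' ⊗ₘ idm (Z (rdeg u)))
     ∘ ((cid X (ldeg v) (ldeg u') ⊗ₘ cid Y (ldeg v') (rdeg u'))
        ⊗ₘ cid Z (rdeg v') (rdeg u))
     ∘ asci (X (ldeg v)) (Y (ldeg v')) (Z (rdeg v'))
     ∘ (idm (X (ldeg v)) ⊗ₘ tproj v') ∘ tproj v).

Definition glam X : gmap (tensc unit_cplx X) X := fun m n =>
  \sum_(u : tidx unit_cplx X m)
    (lam (X n) ∘ (cid unit_gr (ldeg u) 0 ⊗ₘ cid X (rdeg u) n) ∘ tproj u).

Definition glami X : gmap X (tensc unit_cplx X) := fun n m =>
  \sum_(u : tidx unit_cplx X m)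
    (tinj u ∘ (cid unit_gr 0 (ldeg u) ⊗ₘ cid X n (rdeg u)) ∘ lami (X n)).

Definition grho X : gmap (tensc X unit_cplx) X := fun m n =>
  \sum_(u : tidx X unit_cplx m)
    (rho (X n) ∘ (cid X (ldeg u) n ⊗ₘ cid unit_gr (rdeg u) 0) ∘ tproj u).

Definition grhoi X : gmap X (tensc X unit_cplx) := fun n m =>
  \sum_(u : tidx X unit_cplx m)
    (tinj u ∘ (cid X n (ldeg u) ⊗ₘ cid unit_gr 0 (rdeg u)) ∘ rhoi (X n)).

Fixpoint tpowS X (n : nat) : complex A :=
  if n is n'.+1 then tensc X (tpowS X n') else X.

(* X^0 = I, X^1 = X and X^(n+2) = X ⊗ X^(n+1) *)
Definition tpow X (n : nat) : complex A :=
  if n is n'.+1 then tpowS X n' else unit_cplx.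

Fixpoint gpowS X Y (f : gmap X Y) (n : nat) : gmap (tpowS X n) (tpowS Y n) :=
  if n is n'.+1 then f ⊗[0] gpowS f n' else f.

(* Tensor powers of a map of degree 0. *)
Definition gpow X Y (f : gmap X Y) (n : nat) : gmap (tpow X n) (tpow Y n) :=
  if n is n'.+1 then gpowS f n' else gid unit_cplx.

Fixpoint unit_isoS (n : nat) : gmap (tpowS unit_cplx n) unit_cplx :=
  if n is n'.+1
  then glam unit_cplx ∘[0] (gid unit_cplx ⊗[0] unit_isoS n')
  else gid unit_cplx.

(* The canonical isomorphism from the nth tensor power of I to I. *)
Definition unit_iso (n : nat) : gmap (tpow unit_cplx n) unit_cplx :=
  if n is n'.+1 then unit_isoS n' else gid unit_cplx.

Definition tcat1 X (b : nat) :
    gmap (tensc X (tpow X b)) (tpow X (1 + b)%N) :=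
  match b return gmap (tensc X (tpow X b)) (tpow X (1 + b)%N) with
  | 0%N => grho X
  | b'.+1 => gid (tensc X (tpowS X b'))
  end.

Definition tcat_step X (a b : nat)
    (f : gmap (tensc (tpowS X a) (tpow X b)) (tpow X (a.+1 + b)%N)) :
    gmap (tensc (tensc X (tpowS X a)) (tpow X b))
         (tensc X (tpow X (a.+1 + b)%N)) :=
  (gid X ⊗[0] f) ∘[0] gassoc X (tpowS X a) (tpow X b).

Fixpoint tcatS X (a b : nat) :
    gmap (tensc (tpowS X a) (tpow X b)) (tpow X (a.+1 + b)%N) :=
  match a return gmap (tensc (tpowS X a) (tpow X b)) (tpow X (a.+1 + b)%N) with
  | 0%N => tcat1 X b
  | a'.+1 => tcat_step (tcatS X a' b)
  end.

(* The canonical isomorphism X^a ⊗ X^b -> X^(a+b) and its inverse. *)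
Definition tcat X (a b : nat) :
    gmap (tensc (tpow X a) (tpow X b)) (tpow X (a + b)%N) :=
  match a return gmap (tensc (tpow X a) (tpow X b)) (tpow X (a + b)%N) with
  | 0%N => glam (tpow X b)
  | a'.+1 => tcatS X a' b
  end.

Definition tsplit1 X (b : nat) :
    gmap (tpow X (1 + b)%N) (tensc X (tpow X b)) :=
  match b return gmap (tpow X (1 + b)%N) (tensc X (tpow X b)) with
  | 0%N => grhoi X
  | b'.+1 => gid (tensc X (tpowS X b'))
  end.

Definition tsplit_step X (a b : nat)
    (f : gmap (tpow X (a.+1 + b)%N) (tensc (tpowS X a) (tpow X b))) :
    gmap (tensc X (tpow X (a.+1 + b)%N))
         (tensc (tensc X (tpowS X a)) (tpow X b)) :=
  gassoci X (tpowS X a) (tpow X b) ∘[0] (gid X ⊗[0] f).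

Fixpoint tsplitS X (a b : nat) :
    gmap (tpow X (a.+1 + b)%N) (tensc (tpowS X a) (tpow X b)) :=
  match a return gmap (tpow X (a.+1 + b)%N) (tensc (tpowS X a) (tpow X b)) with
  | 0%N => tsplit1 X b
  | a'.+1 => tsplit_step (tsplitS X a' b)
  end.

Definition tsplit X (a b : nat) :
    gmap (tpow X (a + b)%N) (tensc (tpow X a) (tpow X b)) :=
  match a return gmap (tpow X (a + b)%N) (tensc (tpow X a) (tpow X b)) with
  | 0%N => glami (tpow X b)
  | a'.+1 => tsplitS X a' b
  end.

(* The identity of X^m if m = n, and 0 otherwise. *)
Definition tcast X (m n : nat) : gmap (tpow X m) (tpow X n) :=
  fun i j => cid (fun x : nat * int => tpow X x.1 x.2) (m, i) (n, j).

(* Id^a ⊗ phi ⊗ Id^b for phi : X -> X^c of degree 1. *)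
Definition insert X (a c b : nat) (phi : gmap X (tpow X c)) :
    gmap (tpow X (a + (1 + b))%N) (tpow X (a + (c + b))%N) :=
  tcat X a (c + b)%N
  ∘[1] ((gid (tpow X a) ⊗[0] tcat X c b)
  ∘[1] ((gid (tpow X a) ⊗[1] (phi ⊗[0] gid (tpow X b)))
  ∘[0] ((gid (tpow X a) ⊗[0] tsplit X 1 b)
  ∘[0] tsplit X a (1 + b)%N))).

(* The differential [d, f] = d f - (-1)^p f d of a map f of degree p. *)
Definition hom_diff (X Y : grob A) (dX : gmap X X) (dY : gmap Y Y) (p : int)
    (f : gmap X Y) : gmap X Y :=
  fun i j => (dY ∘[p] f) i j - ksign k p *: (f ∘[1] dX) i j.

Definition closed (X Y : grob A) (dX : gmap X X) (dY : gmap Y Y) (p : int)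
    (f : gmap X Y) : Prop :=
  forall i j, hom_diff dX dY p f i j = 0.

Definition homotopic (X Y : grob A) (dX : gmap X X) (dY : gmap Y Y)
    (f g : gmap X Y) : Prop :=
  exists h : gmap X Y, homogeneous (-1) h /\
    forall i j, f i j - g i j = hom_diff dX dY (-1) h i j.

Definition is_resolution X (e : gmap X unit_cplx) : Prop :=
  (forall i, 0 < i -> is_zero (X i)) /\
  [/\ homogeneous 0 e,
      closed (diff X) (diff unit_cplx) 0 e,
      epi (e 0 0),
      exact (diff X (-1) 0) (e 0 0) &
      forall i, i < 0 -> exact (diff X (i - 1) i) (diff X i (i + 1))].

Definition is_projective_resolution X (e : gmap X unit_cplx) : Prop :=
  is_resolution e /\ forall i, projective (X i).

Definition desusp_gr X (i : int) : A := X (i - 1).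

Lemma desusp_gr_zero X i : top X + 1 < i -> is_zero (desusp_gr X i).
Proof. by move=> lt_i; apply: gr_zero; lia. Qed.

Definition desuspg X : grob A := GrOb (@desusp_gr_zero X).

Definition desusp_diff X : gmap (desuspg X) (desuspg X) :=
  fun i j => - diff X (i - 1) (j - 1).

Lemma desusp_diff_homogeneous X : homogeneous 1 (desusp_diff X).
Proof.
move=> i j ne; rewrite /desusp_diff (diff_homogeneous X) ?oppr0//.
by apply: contra ne => /eqP e; apply/eqP; lia.
Qed.

Lemma desusp_diff_diff X i j : (desusp_diff X ∘[1] desusp_diff X) i j = 0.
Proof.
have dd n : n = i - 1 + 1 -> diff X n (j - 1) ∘ diff X (i - 1) n = 0.
  by move=> ->; apply: diff_diff.
rewrite /gcomp /desusp_diff -!scaleN1r compZl compZr scalerA mulrN1 opprK scale1r.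
by apply: dd; lia.
Qed.

Definition desusp X : complex A :=
  Complex (@desusp_diff_homogeneous X) (@desusp_diff_diff X).

Definition eta X : gmap (desusp X) X := fun i j => cid X (i - 1) j.
Definition etai X : gmap X (desusp X) := fun i j => cid X i (j - 1).

(* The component phi • psi in Hom(X, X^n), for phi and psi of degree 1. *)
Definition bullet X (phi psi : forall n, gmap X (tpow X n)) (n : nat) :
    gmap X (tpow X n) :=
  fun i j =>
  \sum_(a < n.+1) \sum_(c < n.+1) \sum_(b < n.+1 | (a + c + b == n)%N)
    (tcast X (a + (c + b))%N n
     ∘[2] (insert a b (phi c) ∘[1] psi (a + (1 + b))%N)) i j.

Definition Ainf_coalgebra C
    (xi : forall n, gmap (desusp C) (tpow (desusp C) n)) : Prop :=
  [/\ forall n, homogeneous 1 (xi n),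
      forall i j, xi 0%N i j = 0 &
      forall n i j,
        hom_diff (diff (desusp C)) (diff (tpow (desusp C) n)) 1 (xi n) i j
        + bullet xi xi n i j = 0].

(* The differential b_1 = d + xi_1 of the desuspension, transported to C; the
   sign is the one relating the differentials of C and its desuspension. *)
Definition b1 C (xi : forall n, gmap (desusp C) (tpow (desusp C) n)) :
    gmap C C :=
  gopp (eta C ∘[2] (gadd (diff (desusp C)) (xi 1%N) ∘[1] etai C)).

Definition is_comult C (xi : forall n, gmap (desusp C) (tpow (desusp C) n))
    (Delta : gmap C (tensc C C)) : Prop :=
  homogeneous 0 Delta /\
  forall i j,
    xi 2%N i j = ((etai C ⊗[1] etai C) ∘[-1] (Delta ∘[-1] eta C)) i j.

Definition homotopy_counit C
    (xi : forall n, gmap (desusp C) (tpow (desusp C) n))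
    (Delta : gmap C (tensc C C)) (e : gmap C unit_cplx) : Prop :=
  [/\ homogeneous 0 e,
      closed (b1 xi) (diff unit_cplx) 0 e,
      homotopic (b1 xi) (b1 xi)
        (glam C ∘[0] ((e ⊗[0] gid C) ∘[0] Delta)) (gid C) &
      homotopic (b1 xi) (b1 xi)
        (grho C ∘[0] ((gid C ⊗[0] e) ∘[0] Delta)) (gid C)].

Definition lifts_unit C (Delta : gmap C (tensc C C)) (e : gmap C unit_cplx) :
    Prop :=
  forall i j, ((e ⊗[0] e) ∘[0] Delta) i j = (glami unit_cplx ∘[0] e) i j.

End Complexes.

Arguments unit_cplx {k} A.

(* Main.v *)
(* Let W be the desuspension of P. An A-infinity structure with xi_1 = 0 is a
   derivation D of degree 1 of the tensor algebra of W with linear part d and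
   D^2 = 0. By the Leibniz rule D^2 is again a derivation, so it is enough that
   it vanishes on W. The components of D are built one after the other. The
   first one is the diagonal Delta, a lift of the identity of I along the
   resolution P ⊗ P. If the components W -> W^j of D^2 vanish for j < n, then the
   one for j = n is a cocycle of degree 2, by comparison of D D^2 with D^2 D, and
   the next component of D has to bound it. It amounts to a map P -> P^n of degree
   3 - n. As P is projective and P^n is a resolution of I, it is a boundary for
   n > 3, and also for n = 3, where it is the coassociator of Delta, because its
   composite with the augmentation of P^3 is zero. The homotopies for the counit
   exist for the same reason; this uses that the left and right unit constraints
   coincide at I. *)

From HB Require Import structures.
From mathcomp Require Import all_boot all_order all_algebra.
From mathcomp Require Import boolp zify.
Require Import Defs.

Set Implicit Arguments.
Unset Strict Implicit.
Unset Printing Implicit Defensive.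

Import Order.TTheory GRing.Theory Num.Theory.
Local Open Scope ring_scope.

(** * Monoidal coherence *)

(** On W every component of D has degree 1, so all signs come from the Koszul rule. The degree 3 - n
    is 2 for D^2, plus 1 for the desuspension of the source, minus n for the n factors of the
    target. P lives in degrees at most 0, so such a map lands in degrees at most 3 - n; only for n =
    3 does it meet degree 0, where a lift along the differential needs the augmentation to vanish.
    The tensor algebra itself is never formed: only the components W^m -> W^n of D enter, and since
    D never lowers the power, their composites are finite sums. W^a ⊗ W^b and W^(a+b) are different
    objects, and sizes such as a + b agree with n by a proof and not by conversion. Concatenation
    and D are therefore families with all indices free, which are zero where sizes do not match. The
    A-infinity equations are stated through insertions; these sum up to derivations, and the Leibniz
    rule then takes the place of identities for the pre-Lie product. *)

Section MonoidalCoherence.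
Variables (k : comPzRingType) (A : abMonCat k).
Implicit Types x y z t : A.

Lemma tenm1 x y : idm x ⊗ₘ idm y = idm (x ⊗ y).
Proof. exact: thom1. Qed.

Lemma tenmZl x x' y y' a (f : Hom x x') (g : Hom y y') :
  (a *: f) ⊗ₘ g = a *: (f ⊗ₘ g).
Proof.
have := thom_linearl (amc_monoidal A) g a f 0.
by rewrite addr0 -/(tenm _ _) => ->; rewrite -/(tenm 0 g) tenm0l addr0.
Qed.

Lemma tenmZr x x' y y' a (f : Hom x x') (g : Hom y y') :
  f ⊗ₘ (a *: g) = a *: (f ⊗ₘ g).
Proof.
have := thom_linearr (amc_monoidal A) f a g 0.
by rewrite addr0 -/(tenm _ _) => ->; rewrite -/(tenm f 0) tenm0r addr0.
Qed.

Lemma tenmDl x x' y y' (f f' : Hom x x') (g : Hom y y') :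
  (f + f') ⊗ₘ g = f ⊗ₘ g + f' ⊗ₘ g.
Proof.
by have := thom_linearl (amc_monoidal A) g 1 f f'; rewrite !scale1r.
Qed.

Lemma tenmDr x x' y y' (f : Hom x x') (g g' : Hom y y') :
  f ⊗ₘ (g + g') = f ⊗ₘ g + f ⊗ₘ g'.
Proof.
by have := thom_linearr (amc_monoidal A) f 1 g g'; rewrite !scale1r.
Qed.

Lemma tenm_suml x x' y y' (J : Type) (r : seq J) (P : pred J)
    (f : J -> Hom x x') (g : Hom y y') :
  (\sum_(j <- r | P j) f j) ⊗ₘ g = \sum_(j <- r | P j) (f j ⊗ₘ g).
Proof.
by apply: (big_morph (fun f => f ⊗ₘ g)) => [f1 f2|]; [exact: tenmDl|exact: tenm0l].
Qed.

Lemma tenm_sumr x x' y y' (J : Type) (r : seq J) (P : pred J)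
    (f : Hom x x') (g : J -> Hom y y') :
  f ⊗ₘ (\sum_(j <- r | P j) g j) = \sum_(j <- r | P j) (f ⊗ₘ g j).
Proof.
by apply: (big_morph (fun g => f ⊗ₘ g)) => [f1 f2|]; [exact: tenmDr|exact: tenm0r].
Qed.

Lemma asc_nat x x' y y' z z' (f : Hom x x') (g : Hom y y') (h : Hom z z') :
  asc x' y' z' ∘ ((f ⊗ₘ g) ⊗ₘ h) = (f ⊗ₘ (g ⊗ₘ h)) ∘ asc x y z.
Proof. exact: assoc_nat. Qed.

Lemma asciK x y z : asc x y z ∘ asci x y z = idm _.
Proof. exact: associK. Qed.

Lemma ascK x y z : asci x y z ∘ asc x y z = idm _.
Proof. exact: assocK. Qed.

Lemma asc_pentagon x y z t :
  asc x y (z ⊗ t) ∘ asc (x ⊗ y) z t =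
  (idm x ⊗ₘ asc y z t) ∘ asc x (y ⊗ z) t ∘ (asc x y z ⊗ₘ idm t).
Proof. exact: pentagon. Qed.

Lemma asc_triangle x y :
  (idm x ⊗ₘ lam y) ∘ asc x (unit_ob A) y = rho x ⊗ₘ idm y.
Proof. exact: triangle. Qed.

Lemma lam_nat x x' (f : Hom x x') :
  lam x' ∘ (idm (unit_ob A) ⊗ₘ f) = f ∘ lam x.
Proof. exact: lunit_nat. Qed.

Lemma rho_nat x x' (f : Hom x x') :
  rho x' ∘ (f ⊗ₘ idm (unit_ob A)) = f ∘ rho x.
Proof. exact: runit_nat. Qed.

Lemma lamK x : lami x ∘ lam x = idm _. Proof. exact: lunitK. Qed.
Lemma lamiK x : lam x ∘ lami x = idm _. Proof. exact: lunitiK. Qed.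
Lemma rhoK x : rhoi x ∘ rho x = idm _. Proof. exact: runitK. Qed.
Lemma rhoiK x : rho x ∘ rhoi x = idm _. Proof. exact: runitiK. Qed.

Lemma tenm_unit_injr x y (f g : Hom x y) :
  f ⊗ₘ idm (unit_ob A) = g ⊗ₘ idm (unit_ob A) -> f = g.
Proof.
move=> /(congr1 (fun h => rho y ∘ h ∘ rhoi x)).
by rewrite !rho_nat -!mcompA rhoiK !mcompm1.
Qed.

Lemma tenm_unit_injl x y (f g : Hom x y) :
  idm (unit_ob A) ⊗ₘ f = idm (unit_ob A) ⊗ₘ g -> f = g.
Proof.
move=> /(congr1 (fun h => lam y ∘ h ∘ lami x)).
by rewrite !lam_nat -!mcompA lamiK !mcompm1.
Qed.

Lemma asc_monic x y z t (f g : Hom t ((x ⊗ y) ⊗ z)) :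
  asc x y z ∘ f = asc x y z ∘ g -> f = g.
Proof.
by move=> /(congr1 (fun h => asci x y z ∘ h)); rewrite !mcompA ascK !mcomp1m.
Qed.

Lemma asc_epic x y z t (f g : Hom (x ⊗ (y ⊗ z)) t) :
  f ∘ asc x y z = g ∘ asc x y z -> f = g.
Proof.
by move=> /(congr1 (fun h => h ∘ asci x y z)); rewrite -!mcompA asciK !mcompm1.
Qed.

(* Kelly: tensored with the unit, this is the pentagon for x, y, I, I composed
   with the triangle. *)
Lemma rho_tens x y : (idm x ⊗ₘ rho y) ∘ asc x y (unit_ob A) = rho (x ⊗ y).
Proof.
apply: tenm_unit_injr; apply: asc_monic.
have := congr1 (fun h => (idm x ⊗ₘ (idm y ⊗ₘ lam (unit_ob A))) ∘ h)
  (asc_pentagon x y (unit_ob A) (unit_ob A)).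
rewrite !mcompA -asc_nat tenm1 -[in LHS]mcompA asc_triangle => ->.
rewrite tenm_comp asc_triangle mcomp1m -asc_nat -[RHS]mcompA tenm_comp.
by rewrite mcomp1m.
Qed.

(** Tensored with the unit, the claim becomes that [rho] at I ⊗ I is [rho I ⊗ id]; this is
    naturality of [rho] at the isomorphism [rho I]. *)
Lemma rho_unit : rho (unit_ob A) = lam (unit_ob A).
Proof.
apply: tenm_unit_injl; apply: asc_epic; rewrite rho_tens asc_triangle.
have := rho_nat (rho (unit_ob A)).
move=> /(congr1 (fun h => rhoi (unit_ob A) ∘ h)).
by rewrite !mcompA rhoK !mcomp1m.
Qed.

Lemma idm_zero x : is_zero x -> idm x = 0.
Proof. by case=> z _; apply: z. Qed.

Lemma is_zero_tenl x y : is_zero x -> is_zero (x ⊗ y).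
Proof.
by move=> /idm_zero zx; apply: is_zero_idm; rewrite -tenm1 zx tenm0l.
Qed.

Lemma is_zero_tenr x y : is_zero y -> is_zero (x ⊗ y).
Proof.
by move=> /idm_zero zx; apply: is_zero_idm; rewrite -tenm1 zx tenm0r.
Qed.

Lemma is_zero_from x y (f g : Hom x y) : is_zero x -> f = g.
Proof. by case=> z _; rewrite (z _ f) (z _ g). Qed.

Lemma cid_cid (T : eqType) (F : T -> A) i j l : i = j ->
  cid F j l ∘ cid F i j = cid F i l.
Proof. by move=> <-; rewrite cid_refl mcompm1. Qed.

Lemma tenm_swap x x' y y' (f : Hom x x') (g : Hom y y') :
  (idm x' ⊗ₘ g) ∘ (f ⊗ₘ idm y) = (f ⊗ₘ idm y') ∘ (idm x ⊗ₘ g).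
Proof. by rewrite !tenm_comp !mcomp1m !mcompm1. Qed.

Lemma tenm_compA x x' x'' y y' y'' z (f' : Hom x' x'') (f : Hom x x')
    (g' : Hom y' y'') (g : Hom y y') (h : Hom z (x ⊗ y)) :
  (f' ⊗ₘ g') ∘ ((f ⊗ₘ g) ∘ h) = ((f' ∘ f) ⊗ₘ (g' ∘ g)) ∘ h.
Proof. by rewrite mcompA tenm_comp. Qed.

End MonoidalCoherence.

(** * Bihomogeneous summands of a graded tensor product *)

Section TensorInclusions.
Variables (k : comPzRingType) (A : abMonCat k).
Implicit Types X Y Z : grob A.

(* The inclusion of the summand of bidegree (i, j); it is 0 unless i + j = m. *)
Definition tin X Y i j m : Hom (X i ⊗ Y j) (tensg X Y m) :=
  \sum_(u : tidx X Y m) (tinj u ∘ (cid X i (ldeg u) ⊗ₘ cid Y j (rdeg u))).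

Lemma tin_neq X Y i j m : i + j != m -> tin X Y i j m = 0.
Proof.
move=> ne; rewrite /tin big1// => u _.
have [e|ne'] := eqVneq i (ldeg u); last by rewrite (cid_neq _ ne') tenm0l comp0r.
rewrite (@cid_neq _ _ _ _ j) ?tenm0r ?comp0r//.
by apply: contra ne => /eqP ->; rewrite e /rdeg addrC subrK.
Qed.

Lemma tproj_tin X Y i j m (u : tidx X Y m) :
  tproj u ∘ tin X Y i j m = cid X i (ldeg u) ⊗ₘ cid Y j (rdeg u).
Proof.
rewrite /tin comp_sumr (bigD1 u) //= big1 ?addr0 => [|v ne].
  by rewrite mcompA tproj_inj cid_refl mcomp1m.
by rewrite mcompA tproj_inj (cid_neq _ ne) comp0l.
Qed.

Lemma tinjE X Y m (u : tidx X Y m) : tinj u = tin X Y (ldeg u) (rdeg u) m.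
Proof.
rewrite /tin (bigD1 u) //= big1 ?addr0 => [|v ne].
  by rewrite !cid_refl tenm1 mcompm1.
rewrite (@cid_neq _ _ _ _ (ldeg u)) ?tenm0l ?comp0r//.
by apply: contra ne => /eqP e; apply/eqP; apply: ldeg_inj.
Qed.

Lemma tin_cidr X Y i j m m' : i + j = m ->
  cid (tensg X Y) m m' ∘ tin X Y i j m = tin X Y i j m'.
Proof.
move=> e; have [<-|ne] := eqVneq m m'; first by rewrite cid_refl mcomp1m.
by rewrite cid_neq// comp0l tin_neq// e.
Qed.

(** The index set stops at the bounds [top], and beyond them the summand is zero. Hence identities
    can be checked on all bidegrees without tracking the index set. *)
Lemma tin_case X Y i j m : i + j = m ->
  (exists u : tidx X Y m, i = ldeg u /\ j = rdeg u) \/ is_zero (X i ⊗ Y j).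
Proof.
move=> e; have [leX|gtX] := leP i (top X); last first.
  by right; apply: is_zero_tenl; apply: gr_zero.
have [leY|gtY] := leP j (top Y); last first.
  by right; apply: is_zero_tenr; apply: gr_zero.
left; have [|u ue] := @ldeg_ex _ _ X Y m i leX; first by rewrite -e addrC addKr.
by exists u; rewrite /rdeg ue; split; rewrite // -e addrC addKr.
Qed.

Lemma tens_id_sum X Y m :
  \sum_(u : tidx X Y m) (tinj u ∘ tproj u) = idm (tensg X Y m).
Proof. exact: bsum_inj_proj. Qed.

Lemma tin_epi X Y m z (f g : Hom (tensg X Y m) z) :
  (forall i j, i + j = m -> f ∘ tin X Y i j m = g ∘ tin X Y i j m) -> f = g.
Proof.
move=> e; rewrite -[f]mcompm1 -[g]mcompm1 -tens_id_sum !comp_sumr.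
apply: eq_bigr => u _; rewrite !mcompA tinjE e// /rdeg; lia.
Qed.

(** The decomposition of the identity into idempotents is an equation, so it survives tensoring with
    a fixed object by additivity alone. *)
Lemma tin_epi_l X Y m y z (f g : Hom (tensg X Y m ⊗ y) z) :
  (forall i j, i + j = m ->
     f ∘ (tin X Y i j m ⊗ₘ idm y) = g ∘ (tin X Y i j m ⊗ₘ idm y)) -> f = g.
Proof.
move=> e; rewrite -[f]mcompm1 -[g]mcompm1 -tenm1 -tens_id_sum tenm_suml.
rewrite !comp_sumr; apply: eq_bigr => u _.
rewrite -[idm y]mcompm1 -tenm_comp !mcompA tinjE e// /rdeg; lia.
Qed.

Lemma tin_epi_r X Y m y z (f g : Hom (y ⊗ tensg X Y m) z) :
  (forall i j, i + j = m ->
     f ∘ (idm y ⊗ₘ tin X Y i j m) = g ∘ (idm y ⊗ₘ tin X Y i j m)) -> f = g.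
Proof.
move=> e; rewrite -[f]mcompm1 -[g]mcompm1 -tenm1 -tens_id_sum tenm_sumr.
rewrite !comp_sumr; apply: eq_bigr => u _.
rewrite -[idm y]mcompm1 -tenm_comp !mcompA tinjE e// /rdeg; lia.
Qed.

Lemma tin_epi_ll X Y m y z t (f g : Hom ((tensg X Y m ⊗ y) ⊗ z) t) :
  (forall i j, i + j = m ->
     f ∘ ((tin X Y i j m ⊗ₘ idm y) ⊗ₘ idm z) =
     g ∘ ((tin X Y i j m ⊗ₘ idm y) ⊗ₘ idm z)) -> f = g.
Proof.
move=> e; rewrite -[f]mcompm1 -[g]mcompm1 -!tenm1 -tens_id_sum !tenm_suml.
rewrite !comp_sumr; apply: eq_bigr => u _.
rewrite -[idm y]mcompm1 -tenm_comp -[idm z]mcompm1 -tenm_comp !mcompA tinjE.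
by rewrite e// /rdeg; lia.
Qed.

Lemma gtens_tin X X' Y Y' p q (f : gmap X X') (g : gmap Y Y') i j m n :
  homogeneous p f -> homogeneous q g -> i + j = m ->
  (f ⊗[q] g) m n ∘ tin X Y i j m =
  ksign k (q * i) *: (tin X' Y' (i + p) (j + q) n
                      ∘ (f i (i + p) ⊗ₘ g j (j + q))).
Proof.
move=> fp gq e; have [[u [-> ->]]|z] := tin_case X Y e; last exact: is_zero_from.
(* The degrees [a + r] and [b] may agree only by a proof; [cid] is the transport between the two
   objects, and 0 if they differ. *)
have cidE (r : int) (Z Z' : grob A) (h : gmap Z Z') a b : homogeneous r h ->
    h a b = cid Z' (a + r) b ∘ h a (a + r).
  move=> hr; have [<-|ne] := eqVneq (a + r) b; first by rewrite cid_refl mcomp1m.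
  by rewrite (cid_neq _ ne) comp0l hr// eq_sym.
rewrite -tinjE /gtens comp_suml (bigD1 u) //= [X in _ + X]big1 ?addr0.
  rewrite comp_suml /tin comp_suml scaler_sumr; apply: eq_bigr => v _.
  rewrite -!mcompA tproj_inj cid_refl mcompm1 compZr tenm_comp; congr (_ *: (_ ∘ _)).
  by congr (_ ⊗ₘ _); apply: cidE.
move=> v ne; rewrite comp_suml big1// => w _.
by rewrite -mcompA tproj_inj cid_neq ?comp0r// eq_sym.
Qed.

End TensorInclusions.

(** * Graded maps *)

Section GmapModule.
Variables (k : comPzRingType) (A : abMonCat k) (X Y : grob A).

Lemma gmapP (f g : gmap X Y) : (forall i j, f i j = g i j) -> f = g.
Proof.
move=> e; apply: functional_extensionality_dep => i.
by apply: functional_extensionality_dep => j.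
Qed.

HB.instance Definition _ := gen_eqMixin (gmap X Y).
HB.instance Definition _ := gen_choiceMixin (gmap X Y).

Fact gaddA : associative (@gadd k A X Y).
Proof. by move=> f g h; apply: gmapP => i j; apply: addrA. Qed.
Fact gaddC : commutative (@gadd k A X Y).
Proof. by move=> f g; apply: gmapP => i j; apply: addrC. Qed.
Fact gadd0 : left_id (gzero X Y) (@gadd k A X Y).
Proof. by move=> f; apply: gmapP => i j; apply: add0r. Qed.
Fact gaddN : left_inverse (gzero X Y) (@gopp k A X Y) (@gadd k A X Y).
Proof. by move=> f; apply: gmapP => i j; apply: addNr. Qed.

HB.instance Definition _ :=
  GRing.isZmodule.Build (gmap X Y) gaddA gaddC gadd0 gaddN.

Definition gscale (a : k) (f : gmap X Y) : gmap X Y := fun i j => a *: f i j.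

Fact gscaleA a b f : gscale a (gscale b f) = gscale (a * b) f.
Proof. by apply: gmapP => i j; apply: scalerA. Qed.
Fact gscale1 : left_id 1 gscale.
Proof. by move=> f; apply: gmapP => i j; apply: scale1r. Qed.
Fact gscaleDr : right_distributive gscale +%R.
Proof. by move=> a f g; apply: gmapP => i j; apply: scalerDr. Qed.
Fact gscaleDl f : {morph gscale^~ f : a b / a + b}.
Proof. by move=> a b; apply: gmapP => i j; apply: scalerDl. Qed.

HB.instance Definition _ := GRing.Zmodule_isLmodule.Build k (gmap X Y)
  gscaleA gscale1 gscaleDr gscaleDl.

Lemma gmapD (f g : gmap X Y) i j : (f + g) i j = f i j + g i j.
Proof. by []. Qed.
Lemma gmapN (f : gmap X Y) i j : (- f) i j = - f i j.
Proof. by []. Qed.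
Lemma gmapZ a (f : gmap X Y) i j : (a *: f) i j = a *: f i j.
Proof. by []. Qed.
Lemma gmap_sum (J : Type) (r : seq J) (P : pred J) (f : J -> gmap X Y) i j :
  (\sum_(l <- r | P l) f l) i j = \sum_(l <- r | P l) f l i j.
Proof. by apply: (big_morph (fun f : gmap X Y => f i j)). Qed.

End GmapModule.

Section GradedCalculus.
Variables (k : comPzRingType) (A : abMonCat k).
Implicit Types X Y Z : grob A.

Lemma hom0 p X Y : homogeneous p (0 : gmap X Y).
Proof. by []. Qed.

Lemma homD p X Y (f g : gmap X Y) :
  homogeneous p f -> homogeneous p g -> homogeneous p (f + g).
Proof. by move=> fp gp i j ne; rewrite gmapD fp// gp// addr0. Qed.

Lemma homZ p X Y a (f : gmap X Y) : homogeneous p f -> homogeneous p (a *: f).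
Proof. by move=> fp i j ne; rewrite gmapZ fp// scaler0. Qed.

Lemma homN p X Y (f : gmap X Y) : homogeneous p f -> homogeneous p (- f).
Proof. by move=> fp i j ne; rewrite gmapN fp// oppr0. Qed.

Lemma hom_sum p X Y (J : Type) (r : seq J) (P : pred J) (f : J -> gmap X Y) :
  (forall j, P j -> homogeneous p (f j)) ->
  homogeneous p (\sum_(j <- r | P j) f j).
Proof. by move=> fp; elim/big_ind: _ => //; apply: homD. Qed.

(** The composite reads only the components of [f] of degree p, so its own degree is decided by
    [g]. *)
Lemma hom_comp p q r X Y Z (g : gmap Y Z) (f : gmap X Y) :
  r = p + q -> homogeneous q g -> homogeneous r (g ∘[p] f).
Proof.
by move=> -> gq i j ne; rewrite /gcomp gq ?comp0l// -addrA.
Qed.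

Lemma hom_tens p q r X X' Y Y' (f : gmap X X') (g : gmap Y Y') :
  r = p + q -> homogeneous p f -> homogeneous q g -> homogeneous r (f ⊗[q] g).
Proof. by move=> ->; apply: gtens_homogeneous. Qed.

(** Here and below degrees are tied by equations instead of being computed, so that forms such as 2
    and 1 + 1 can be exchanged. *)
Lemma gcompA p q r X Y Z T (h : gmap Z T) (g : gmap Y Z) (f : gmap X Y) :
  r = p + q -> (h ∘[q] g) ∘[p] f = h ∘[r] (g ∘[p] f).
Proof.
by move=> ->; apply: gmapP => i j; rewrite /gcomp addrA mcompA.
Qed.

Lemma gid_l p X Y (f : gmap X Y) : homogeneous p f -> gid Y ∘[p] f = f.
Proof. by move=> fp; apply: gmapP => i j; apply: gid_compl. Qed.

Lemma gid_r X Y (f : gmap X Y) : f ∘[0] gid X = f.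
Proof. by apply: gmapP => i j; apply: gid_compr. Qed.

Lemma gcompDl p X Y Z (g g' : gmap Y Z) (f : gmap X Y) :
  (g + g') ∘[p] f = g ∘[p] f + g' ∘[p] f.
Proof. by apply: gmapP => i j; apply: compDl. Qed.

Lemma gcompDr p X Y Z (g : gmap Y Z) (f f' : gmap X Y) :
  g ∘[p] (f + f') = g ∘[p] f + g ∘[p] f'.
Proof. by apply: gmapP => i j; apply: compDr. Qed.

Lemma gcompZl p X Y Z a (g : gmap Y Z) (f : gmap X Y) :
  (a *: g) ∘[p] f = a *: (g ∘[p] f).
Proof. by apply: gmapP => i j; apply: compZl. Qed.

Lemma gcompZr p X Y Z a (g : gmap Y Z) (f : gmap X Y) :
  g ∘[p] (a *: f) = a *: (g ∘[p] f).
Proof. by apply: gmapP => i j; apply: compZr. Qed.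

Lemma gcomp0l p X Y Z (f : gmap X Y) : (0 : gmap Y Z) ∘[p] f = 0.
Proof. by apply: gmapP => i j; apply: comp0l. Qed.

Lemma gcomp0r p X Y Z (g : gmap Y Z) : g ∘[p] (0 : gmap X Y) = 0.
Proof. by apply: gmapP => i j; apply: comp0r. Qed.

Lemma gcompNl p X Y Z (g : gmap Y Z) (f : gmap X Y) :
  (- g) ∘[p] f = - (g ∘[p] f).
Proof. by rewrite -scaleN1r gcompZl scaleN1r. Qed.

Lemma gcompNr p X Y Z (g : gmap Y Z) (f : gmap X Y) :
  g ∘[p] (- f) = - (g ∘[p] f).
Proof. by rewrite -scaleN1r gcompZr scaleN1r. Qed.

Lemma gcomp_suml p X Y Z (J : Type) (r : seq J) (P : pred J)
    (f : gmap X Y) (g : J -> gmap Y Z) :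
  (\sum_(j <- r | P j) g j) ∘[p] f = \sum_(j <- r | P j) (g j ∘[p] f).
Proof.
by apply: (big_morph (fun g => g ∘[p] f)) => [g1 g2|]; [exact: gcompDl|exact: gcomp0l].
Qed.

Lemma gcomp_sumr p X Y Z (J : Type) (r : seq J) (P : pred J)
    (g : gmap Y Z) (f : J -> gmap X Y) :
  g ∘[p] (\sum_(j <- r | P j) f j) = \sum_(j <- r | P j) (g ∘[p] f j).
Proof.
by apply: (big_morph (fun f => g ∘[p] f)) => [g1 g2|]; [exact: gcompDr|exact: gcomp0r].
Qed.

Lemma gtensZl q X X' Y Y' a (f : gmap X X') (g : gmap Y Y') :
  (a *: f) ⊗[q] g = a *: (f ⊗[q] g).
Proof.
apply: gmapP => i j; rewrite gmapZ /gtens scaler_sumr; apply: eq_bigr => u _.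
rewrite scaler_sumr; apply: eq_bigr => v _.
by rewrite gmapZ tenmZl scalerA mulrC -scalerA compZr compZl.
Qed.

Lemma gtensZr q X X' Y Y' a (f : gmap X X') (g : gmap Y Y') :
  f ⊗[q] (a *: g) = a *: (f ⊗[q] g).
Proof.
apply: gmapP => i j; rewrite gmapZ /gtens scaler_sumr; apply: eq_bigr => u _.
rewrite scaler_sumr; apply: eq_bigr => v _.
by rewrite gmapZ tenmZr scalerA mulrC -scalerA compZr compZl.
Qed.

Lemma gtensDl q X X' Y Y' (f f' : gmap X X') (g : gmap Y Y') :
  (f + f') ⊗[q] g = f ⊗[q] g + f' ⊗[q] g.
Proof.
apply: gmapP => i j; rewrite gmapD /gtens -big_split; apply: eq_bigr => u _.
rewrite -big_split; apply: eq_bigr => v _.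
by rewrite gmapD tenmDl scalerDr compDr compDl.
Qed.

Lemma gtensDr q X X' Y Y' (f : gmap X X') (g g' : gmap Y Y') :
  f ⊗[q] (g + g') = f ⊗[q] g + f ⊗[q] g'.
Proof.
apply: gmapP => i j; rewrite gmapD /gtens -big_split; apply: eq_bigr => u _.
rewrite -big_split; apply: eq_bigr => v _.
by rewrite gmapD tenmDr scalerDr compDr compDl.
Qed.

Lemma gtens0l q X X' Y Y' (g : gmap Y Y') : (0 : gmap X X') ⊗[q] g = 0.
Proof. by rewrite -(scale0r (0 : gmap X X')) gtensZl scale0r. Qed.

Lemma gtens0r q X X' Y Y' (f : gmap X X') : f ⊗[q] (0 : gmap Y Y') = 0.
Proof. by rewrite -(scale0r (0 : gmap Y Y')) gtensZr scale0r. Qed.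

Lemma gtensNl q X X' Y Y' (f : gmap X X') (g : gmap Y Y') :
  (- f) ⊗[q] g = - (f ⊗[q] g).
Proof. by rewrite -scaleN1r gtensZl scaleN1r. Qed.

Lemma gtens_suml q X X' Y Y' (J : Type) (r : seq J) (P : pred J)
    (f : J -> gmap X X') (g : gmap Y Y') :
  (\sum_(j <- r | P j) f j) ⊗[q] g = \sum_(j <- r | P j) (f j ⊗[q] g).
Proof.
by apply: (big_morph (fun f => f ⊗[q] g)) => [f1 f2|]; [exact: gtensDl|exact: gtens0l].
Qed.

Lemma gtens_sumr q X X' Y Y' (J : Type) (r : seq J) (P : pred J)
    (f : gmap X X') (g : J -> gmap Y Y') :
  f ⊗[q] (\sum_(j <- r | P j) g j) = \sum_(j <- r | P j) (f ⊗[q] g j).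
Proof.
by apply: (big_morph (fun g => f ⊗[q] g)) => [f1 f2|]; [exact: gtensDr|exact: gtens0r].
Qed.

Lemma ksign0 : ksign k 0 = 1. Proof. by []. Qed.
Lemma ksign1 : ksign k 1 = -1. Proof. by rewrite /ksign expr1. Qed.
Lemma ksignN p : ksign k (- p) = ksign k p.
Proof. by rewrite /ksign abszN. Qed.
Lemma ksignK p : ksign k p * ksign k p = 1.
Proof. by rewrite /ksign -expr2 sqrr_sign. Qed.

Lemma gtens_id X Y : gid X ⊗[0] gid Y = gid (tensg X Y).
Proof.
apply: gmapP => m n; apply: tin_epi => i j e.
rewrite (gtens_tin n (gid_homogeneous X) (gid_homogeneous Y) e) mul0r ksign0.
by rewrite scale1r !addr0 /gid !cid_refl tenm1 mcompm1 tin_cidr.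
Qed.

Lemma tens_comp p' q' q r s X X' X'' Y Y' Y''
    (f : gmap X' X'') (g : gmap Y' Y'') (f' : gmap X X') (g' : gmap Y Y') :
  r = p' + q' -> s = q + q' -> homogeneous p' f' -> homogeneous q' g' ->
  (f ⊗[q] g) ∘[r] (f' ⊗[q'] g') =
  ksign k (q * p') *: ((f ∘[p'] f') ⊗[s] (g ∘[q'] g')).
Proof. by move=> -> -> fp gq; apply: gmapP => i j; apply: gtens_comp. Qed.

Lemma tens_comp0 q' q s X X' X'' Y Y' Y''
    (f : gmap X' X'') (g : gmap Y' Y'') (f' : gmap X X') (g' : gmap Y Y') :
  s = q + q' -> homogeneous 0 f' -> homogeneous q' g' ->
  (f ⊗[q] g) ∘[q'] (f' ⊗[q'] g') = (f ∘[0] f') ⊗[s] (g ∘[q'] g').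
Proof.
by move=> es fp gq; rewrite (tens_comp f g _ es fp gq) ?add0r// mulr0 scale1r.
Qed.

End GradedCalculus.

(** * Structure isomorphisms of graded tensor products *)

Section StructureMaps.
Variables (k : comPzRingType) (A : abMonCat k).
Implicit Types X Y Z T : complex A.

Lemma tin_tin X Y Z i j l n :
  \sum_(v : tidx X (tensc Y Z) n) \sum_(v' : tidx Y Z (rdeg v))
    (tinj v ∘ (idm (X (ldeg v)) ⊗ₘ tinj v') ∘
     (cid X i (ldeg v) ⊗ₘ (cid Y j (ldeg v') ⊗ₘ cid Z l (rdeg v')))) =
  tin X (tensc Y Z) i (j + l) n ∘ (idm (X i) ⊗ₘ tin Y Z j l (j + l)).
Proof.
rewrite {1}/tin comp_suml; apply: eq_bigr => v _.
rewrite -mcompA tenm_comp mcompm1 tin_cidr// /tin tenm_sumr comp_sumr.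
by apply: eq_bigr => v' _; rewrite -mcompA tenm_comp mcomp1m.
Qed.

Lemma tin_tin' X Y Z i j l n :
  \sum_(v : tidx (tensc X Y) Z n) \sum_(v' : tidx X Y (ldeg v))
    (tinj v ∘ (tinj v' ⊗ₘ idm (Z (rdeg v))) ∘
     ((cid X i (ldeg v') ⊗ₘ cid Y j (rdeg v')) ⊗ₘ cid Z l (rdeg v))) =
  tin (tensc X Y) Z (i + j) l n ∘ (tin X Y i j (i + j) ⊗ₘ idm (Z l)).
Proof.
rewrite {1}/tin comp_suml; apply: eq_bigr => v _.
rewrite -mcompA tenm_comp mcompm1 tin_cidr// /tin tenm_suml comp_sumr.
by apply: eq_bigr => v' _; rewrite -mcompA tenm_comp mcomp1m.
Qed.

(** Determines the graded associator on each summand of tridegree (i, j, l). The total degrees are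
    variables, so the rule applies in whatever form they occur; for n other than the total degree
    both sides vanish. *)
Lemma gassoc_tin X Y Z i j l s t m n : i + j = s -> j + l = t -> s + l = m ->
  gassoc X Y Z m n ∘ tin (tensc X Y) Z s l m ∘ (tin X Y i j s ⊗ₘ idm (Z l)) =
  tin X (tensc Y Z) i t n ∘ (idm (X i) ⊗ₘ tin Y Z j l t) ∘ asc (X i) (Y j) (Z l).
Proof.
move=> es <- em.
have [leX|gtX] := leP i (top X); last first.
  by apply/is_zero_from/is_zero_tenl/is_zero_tenl/gr_zero.
have [leY|gtY] := leP j (top Y); last first.
  by apply/is_zero_from/is_zero_tenl/is_zero_tenr/gr_zero.
have [leZ|gtZ] := leP l (top Z); last by apply/is_zero_from/is_zero_tenr/gr_zero.
have [||u us] := @ldeg_ex _ _ (tensc X Y) Z m s; [by rewrite -es lerD|by lia|].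
have ul : l = rdeg u by rewrite /rdeg us; lia.
destruct us; subst l.
have [||u' us'] := @ldeg_ex _ _ X Y (ldeg u) i; [by []|by lia|].
have ul' : j = rdeg u' by rewrite /rdeg us'; lia.
destruct us'; subst j; rewrite -!tinjE -tin_tin.
rewrite /gassoc !comp_suml (bigD1 u) //= [X in _ + X]big1 ?addr0; last first.
  move=> w ne; rewrite !comp_suml big1// => w' _; rewrite !comp_suml big1// => v _.
  rewrite !comp_suml big1// => v' _.
  rewrite -(mcompA _ (tproj w) (tinj u)) tproj_inj (@cid_neq _ _ _ _ u w) 1?eq_sym//.
  by rewrite comp0r comp0l.
rewrite !comp_suml (bigD1 u') //= [X in _ + X]big1 ?addr0; last first.
  move=> w ne; rewrite !comp_suml big1// => v _; rewrite !comp_suml big1// => v' _.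
  rewrite -(mcompA _ (tproj u) (tinj u)) tproj_inj cid_refl mcompm1.
  rewrite -mcompA tenm_comp tproj_inj (@cid_neq _ _ _ _ u' w) 1?eq_sym//.
  by rewrite tenm0l comp0r.
rewrite !comp_suml; apply: eq_bigr => v _; rewrite !comp_suml; apply: eq_bigr => v' _.
rewrite -(mcompA _ (tproj u) (tinj u)) tproj_inj cid_refl mcompm1.
by rewrite -mcompA tenm_comp tproj_inj cid_refl mcompm1 tenm1 mcompm1.
Qed.

Lemma gassoci_tin X Y Z i j l s t m n : i + j = s -> j + l = t -> i + t = m ->
  gassoci X Y Z m n ∘ tin X (tensc Y Z) i t m ∘ (idm (X i) ⊗ₘ tin Y Z j l t) =
  tin (tensc X Y) Z s l n ∘ (tin X Y i j s ⊗ₘ idm (Z l)) ∘ asci (X i) (Y j) (Z l).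
Proof.
move=> <- es em.
have [leX|gtX] := leP i (top X); last first.
  by apply/is_zero_from/is_zero_tenl/gr_zero.
have [leY|gtY] := leP j (top Y); last first.
  by apply/is_zero_from/is_zero_tenr/is_zero_tenl/gr_zero.
have [leZ|gtZ] := leP l (top Z); last first.
  by apply/is_zero_from/is_zero_tenr/is_zero_tenr/gr_zero.
have [||u us] := @ldeg_ex _ _ X (tensc Y Z) m i; [by []|rewrite -em addrC addKr -es lerD//|].
have ul : t = rdeg u by rewrite /rdeg us; lia.
destruct us; symmetry in ul; destruct ul.
have [||u' us'] := @ldeg_ex _ _ Y Z (rdeg u) j; [by []|by lia|].
have ul' : l = rdeg u' by rewrite {1}/rdeg us'; lia.
destruct us'; subst l; rewrite -!tinjE -tin_tin'.
rewrite /gassoci !comp_suml (bigD1 u) //= [X in _ + X]big1 ?addr0; last first.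
  move=> w ne; rewrite !comp_suml big1// => w' _; rewrite !comp_suml big1// => v _.
  rewrite !comp_suml big1// => v' _.
  rewrite -(mcompA _ (tproj w) (tinj u)) tproj_inj (@cid_neq _ _ _ _ u w) 1?eq_sym//.
  by rewrite comp0r comp0l.
rewrite !comp_suml (bigD1 u') //= [X in _ + X]big1 ?addr0; last first.
  move=> w ne; rewrite !comp_suml big1// => v _; rewrite !comp_suml big1// => v' _.
  rewrite -(mcompA _ (tproj u) (tinj u)) tproj_inj cid_refl mcompm1.
  rewrite -mcompA tenm_comp tproj_inj (@cid_neq _ _ _ _ u' w) 1?eq_sym//.
  by rewrite tenm0r comp0r.
rewrite !comp_suml; apply: eq_bigr => v _; rewrite !comp_suml; apply: eq_bigr => v' _.
rewrite -(mcompA _ (tproj u) (tinj u)) tproj_inj cid_refl mcompm1.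
by rewrite -mcompA tenm_comp tproj_inj cid_refl mcompm1 tenm1 mcompm1.
Qed.

Lemma glam_tin X j n : glam X j n ∘ tin (unit_cplx A) X 0 j j =
  cid X j n ∘ lam (X j).
Proof.
rewrite -lam_nat /glam comp_suml.
have [leX|gtX] := leP j (top X); last first.
  by apply/is_zero_from/is_zero_tenr/gr_zero.
have top0 : 0 <= top (unit_cplx A) by [].
have [|u u0] := @ldeg_ex _ _ (unit_cplx A) X j 0 top0; first by rewrite subr0.
rewrite (bigD1 u) //= big1 => [|v ne].
  rewrite addr0 -mcompA (@tproj_tin _ _ (unit_cplx A) X 0 j) -mcompA tenm_comp /rdeg u0 subr0.
  by rewrite !cid_refl !mcompm1.
rewrite -mcompA (@tproj_tin _ _ (unit_cplx A) X 0 j) -mcompA tenm_comp (@cid_neq _ _ _ _ (ldeg v)).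
  by rewrite comp0l tenm0l comp0r.
by apply: contra ne => /eqP e; apply/eqP/ldeg_inj; rewrite e u0.
Qed.

Lemma grho_tin X j n : grho X j n ∘ tin X (unit_cplx A) j 0 j =
  cid X j n ∘ rho (X j).
Proof.
rewrite -rho_nat /grho comp_suml.
have [leX|gtX] := leP j (top X); last first.
  by apply/is_zero_from/is_zero_tenl/gr_zero.
have top0 : j - j <= top (unit_cplx A) by rewrite subrr.
have [u u0] := @ldeg_ex _ _ X (unit_cplx A) j j leX top0.
rewrite (bigD1 u) //= big1 => [|v ne].
  rewrite addr0 -mcompA (@tproj_tin _ _ X (unit_cplx A) j 0) -mcompA tenm_comp /rdeg u0 subrr.
  by rewrite !cid_refl !mcompm1.
rewrite -mcompA (@tproj_tin _ _ X (unit_cplx A) j 0) -mcompA tenm_comp.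
rewrite (@cid_neq _ _ _ _ j (ldeg v)).
  by rewrite comp0r tenm0l comp0r.
by apply: contra ne => /eqP e; apply/eqP/ldeg_inj; rewrite -e u0.
Qed.

Lemma glamiE X n m : glami X n m = tin (unit_cplx A) X 0 n m ∘ lami (X n).
Proof. by rewrite /glami /tin comp_suml. Qed.

Lemma grhoiE X n m : grhoi X n m = tin X (unit_cplx A) n 0 m ∘ rhoi (X n).
Proof. by rewrite /grhoi /tin comp_suml. Qed.

Lemma unit_gr_neq0 i : i != 0 -> is_zero (unit_cplx A i).
Proof. by case: i => [[|n]|n] // _; apply: bigoplus0; rewrite card_ord. Qed.

End StructureMaps.

Arguments gassoc_tin {k A X Y Z i j l s t m} n.
Arguments gassoci_tin {k A X Y Z i j l s t m} n.

(** * Naturality and pentagon for the graded associator *)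

Section GradedCoherence.
Variables (k : comPzRingType) (A : abMonCat k).
Implicit Types X Y Z T : complex A.

Lemma gcomp_0E (X Y Z : grob A) (g : gmap Y Z) (f : gmap X Y) m n :
  (g ∘[0] f) m n = g m n ∘ f m m.
Proof. by rewrite /gcomp addr0. Qed.

Lemma gassoc_epi X Y Z (U : grob A) (f g : gmap (tensc (tensc X Y) Z) U) :
  (forall i j l s m n, i + j = s -> s + l = m ->
   f m n ∘ tin (tensc X Y) Z s l m ∘ (tin X Y i j s ⊗ₘ idm (Z l)) =
   g m n ∘ tin (tensc X Y) Z s l m ∘ (tin X Y i j s ⊗ₘ idm (Z l))) -> f = g.
Proof.
move=> e; apply: gmapP => m n; apply: tin_epi => s l es; apply: tin_epi_l => i j ei.
exact: e.
Qed.

Lemma hom_gassoc X Y Z : homogeneous 0 (gassoc X Y Z).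
Proof.
move=> m n ne; apply: tin_epi => s l es; apply: tin_epi_l => i j ei.
rewrite (gassoc_tin n ei erefl es) tin_neq ?comp0l//.
by apply: contra ne => /eqP <-; apply/eqP; lia.
Qed.

Lemma hom_gassoci X Y Z : homogeneous 0 (gassoci X Y Z).
Proof.
move=> m n ne; apply: tin_epi => s l es; apply: tin_epi_r => i j ei.
rewrite (gassoci_tin n erefl ei es) tin_neq ?comp0l//.
by apply: contra ne => /eqP <-; apply/eqP; lia.
Qed.

Lemma gassocK X Y Z : gassoc X Y Z ∘[0] gassoci X Y Z = gid (tensc X (tensc Y Z)).
Proof.
apply: gmapP => m n; apply: tin_epi => i t et; apply: tin_epi_r => j l ej.
have := congr1 (mcomp (gassoc X Y Z m n)) (gassoci_tin (X := X) m erefl ej et).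
rewrite gcomp_0E !mcompA => ->.
rewrite (@gassoc_tin _ _ X Y Z i j l (i + j) t m n)//; last by lia.
by rewrite -!mcompA asciK mcompm1 mcompA /gid tin_cidr.
Qed.

Lemma tens_tin_l p q r X X' Y Y' Z Z' (f : gmap X X') (g : gmap Y Y')
    (h : gmap Z Z') i j l a m n :
  homogeneous p f -> homogeneous q g -> homogeneous r h ->
  i + j = a -> a + l = m ->
  ((f ⊗[q] g) ⊗[r] h : gmap (tensc (tensc X Y) Z) (tensc (tensc X' Y') Z')) m n
    ∘ tin (tensc X Y) Z a l m ∘ (tin X Y i j a ⊗ₘ idm (Z l)) =
  ksign k (r * a + q * i) *:
   (tin (tensc X' Y') Z' (a + (p + q)) (l + r) n ∘
    (tin X' Y' (i + p) (j + q) (a + (p + q)) ⊗ₘ idm (Z' (l + r))) ∘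
    ((f i (i + p) ⊗ₘ g j (j + q)) ⊗ₘ h l (l + r))).
Proof.
move=> fp gq hr ei em; have fgp := gtens_homogeneous fp gq.
rewrite (@gtens_tin _ _ (tensc X Y) (tensc X' Y') Z Z' (p + q) r (f ⊗[q] g) h
  a l m n fgp hr em).
rewrite compZl -!mcompA !tenm_comp mcomp1m mcompm1.
rewrite (@gtens_tin _ _ X X' Y Y' p q f g i j a _ fp gq ei).
by rewrite tenmZl compZr scalerA -ksignD.
Qed.

Lemma tens_tin_r p q r X X' Y Y' Z Z' (f : gmap X X') (g : gmap Y Y')
    (h : gmap Z Z') i j l t m n :
  homogeneous p f -> homogeneous q g -> homogeneous r h ->
  j + l = t -> i + t = m ->
  (f ⊗[q + r] (g ⊗[r] h) : gmap (tensc X (tensc Y Z)) (tensc X' (tensc Y' Z'))) m n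
    ∘ tin X (tensc Y Z) i t m ∘ (idm (X i) ⊗ₘ tin Y Z j l t) =
  ksign k ((q + r) * i + r * j) *:
   (tin X' (tensc Y' Z') (i + p) (t + (q + r)) n ∘
    (idm (X' (i + p)) ⊗ₘ tin Y' Z' (j + q) (l + r) (t + (q + r))) ∘
    (f i (i + p) ⊗ₘ (g j (j + q) ⊗ₘ h l (l + r)))).
Proof.
move=> fp gq hr ej em; have ghp := gtens_homogeneous gq hr.
rewrite (@gtens_tin _ _ X X' (tensc Y Z) (tensc Y' Z') p (q + r) f (g ⊗[r] h)
  i t m n fp ghp em).
rewrite compZl -!mcompA !tenm_comp mcomp1m mcompm1.
rewrite (@gtens_tin _ _ Y Y' Z Z' q r g h j l t _ gq hr ej).
by rewrite tenmZr compZr scalerA -ksignD.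
Qed.

(** On tridegree (i, j, l) the two Koszul signs have the exponents r (i + j) + q i and (q + r) i + r
    j, which are equal. *)
Lemma gassoc_nat p q r s X X' Y Y' Z Z'
    (f : gmap X X') (g : gmap Y Y') (h : gmap Z Z') :
  s = p + q + r -> homogeneous p f -> homogeneous q g -> homogeneous r h ->
  gassoc X' Y' Z' ∘[s] ((f ⊗[q] g) ⊗[r] h) =
  (f ⊗[q + r] (g ⊗[r] h)) ∘[0] gassoc X Y Z.
Proof.
move=> -> fp gq hr; apply: gassoc_epi => i j l a m n ei em.
rewrite gcomp_0E /gcomp.
have := congr1 (mcomp (gassoc X' Y' Z' (m + (p + q + r)) n))
  (tens_tin_l (m + (p + q + r)) fp gq hr ei em).
rewrite !mcompA => ->.
have et : i + (j + l) = m by lia.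
have := congr1 (mcomp ((f ⊗[q + r] (g ⊗[r] h)) m n)) (gassoc_tin m ei erefl em).
rewrite !mcompA => ->.
rewrite (@tens_tin_r p q r X X' Y Y' Z Z' f g h i j l (j + l) m n)//.
rewrite compZr compZl; congr (_ *: _).
  by rewrite -ei; congr ksign; rewrite mulrDr mulrDl addrAC [r * i + _]addrC.
rewrite -[RHS]mcompA -asc_nat !mcompA; congr (_ ∘ _).
by apply: gassoc_tin; lia.
Qed.

Lemma tens_tin0 (X X' Y Y' : grob A) (f : gmap X X') (g : gmap Y Y') i j m n :
  homogeneous 0 f -> homogeneous 0 g -> i + j = m ->
  (f ⊗[0] g) m n ∘ tin X Y i j m = tin X' Y' i j n ∘ (f i i ⊗ₘ g j j).
Proof.
move=> f0 g0 em; rewrite (gtens_tin n f0 g0 em) mul0r ksign0 scale1r.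
by rewrite !addr0.
Qed.

Lemma gidE (X : grob A) i : gid X i i = idm (X i).
Proof. exact: cid_refl. Qed.

Lemma gassoc_tinA X Y Z i j l s t m n w (f : Hom w ((X i ⊗ Y j) ⊗ Z l)) :
  i + j = s -> j + l = t -> s + l = m ->
  gassoc X Y Z m n ∘ (tin (tensc X Y) Z s l m ∘ ((tin X Y i j s ⊗ₘ idm (Z l)) ∘ f)) =
  tin X (tensc Y Z) i t n ∘ ((idm (X i) ⊗ₘ tin Y Z j l t) ∘ (asc (X i) (Y j) (Z l) ∘ f)).
Proof. by move=> es et em; rewrite !mcompA (gassoc_tin n es et em). Qed.

Lemma tens_tin0A (X X' Y Y' : grob A) (f : gmap X X') (g : gmap Y Y') i j m n
    w (h : Hom w (X i ⊗ Y j)) :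
  homogeneous 0 f -> homogeneous 0 g -> i + j = m ->
  (f ⊗[0] g) m n ∘ (tin X Y i j m ∘ h) = tin X' Y' i j n ∘ ((f i i ⊗ₘ g j j) ∘ h).
Proof. by move=> f0 g0 em; rewrite !mcompA tens_tin0. Qed.

Lemma gassoc_pentagon X Y Z T :
  gassoc X Y (tensc Z T) ∘[0] gassoc (tensc X Y) Z T =
  (gid X ⊗[0] gassoc Y Z T) ∘[0] (gassoc X (tensc Y Z) T
    ∘[0] (gassoc X Y Z ⊗[0] gid T)).
Proof.
apply: gmapP => m n; apply: tin_epi => a r ea; apply: tin_epi_l => b l eb.
apply: tin_epi_ll => i j ei; rewrite !gcomp_0E -!mcompA.
have e1 : b + (l + r) = m by lia.
have e2 : j + (l + r) = j + l + r by lia.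
have e3 : i + (j + l + r) = m by lia.
have e4 : i + (j + l) = a by lia.
rewrite (@gassoc_tinA (tensc X Y) Z T _ _ _ _ _ _ _ _ _ eb erefl ea).
rewrite asc_nat tenm1 (mcompA (_ ⊗ₘ tin Z T l r _)) tenm_swap -mcompA.
rewrite (@gassoc_tinA X Y (tensc Z T) _ _ _ _ _ _ _ _ _ ei e2 e1).
rewrite (mcompA (asc _ _ _)) -tenm1 asc_nat.
rewrite -mcompA asc_pentagon.
rewrite (tens_tin0A (X := tensc (tensc X Y) Z) (X' := tensc X (tensc Y Z)) m
  _ (@hom_gassoc X Y Z) (gid_homogeneous T) ea).
rewrite tenm_compA gidE mcomp1m [in RHS]tenm_comp mcompm1.
rewrite [in RHS]tenm_comp mcompm1 (mcompA (gassoc X Y Z a a)).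
rewrite (gassoc_tin (X:=X) (Y:=Y) (Z:=Z) a ei erefl eb).
have -> x y z t (u : Hom z t) (v : Hom y z) (w : Hom x y) :
    (u ∘ v ∘ w) ⊗ₘ idm (T r) =
    (u ⊗ₘ idm (T r)) ∘ ((v ⊗ₘ idm (T r)) ∘ (w ⊗ₘ idm (T r))).
  by rewrite !tenm_comp !mcompm1 mcompA.
rewrite (@gassoc_tinA X (tensc Y Z) T _ _ _ _ _ _ _ _ _ e4 erefl ea).
rewrite (mcompA (asc _ _ _)) asc_nat.
rewrite (tens_tin0A (X := X) (X' := X) n _ (gid_homogeneous X) (@hom_gassoc Y Z T) e3).
rewrite -!mcompA !tenm_compA.
rewrite gidE !mcomp1m -!mcompA (mcompA (gassoc Y Z T _ _)).
by rewrite (gassoc_tin (X:=Y) _ erefl erefl erefl) -!mcompA.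
Qed.

End GradedCoherence.

(** * Unit constraints for complexes *)

Section UnitCoherence.
Variables (k : comPzRingType) (A : abMonCat k).
Implicit Types X Y Z T : complex A.
Local Notation I := (unit_cplx A).

Lemma unit_epi_l X (U : grob A) (f g : gmap (tensc I X) U) :
  (forall m n, f m n ∘ tin I X 0 m m = g m n ∘ tin I X 0 m m) -> f = g.
Proof.
move=> e; apply: gmapP => m n; apply: tin_epi => i j em.
have [i0|ne] := eqVneq i 0; last first.
  by apply/is_zero_from/is_zero_tenl/unit_gr_neq0.
by move: em; rewrite i0 add0r => ->.
Qed.

Lemma unit_epi_r X (U : grob A) (f g : gmap (tensc X I) U) :
  (forall m n, f m n ∘ tin X I m 0 m = g m n ∘ tin X I m 0 m) -> f = g.
Proof.
move=> e; apply: gmapP => m n; apply: tin_epi => i j em.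
have [i0|ne] := eqVneq j 0; last first.
  by apply/is_zero_from/is_zero_tenr/unit_gr_neq0.
by move: em; rewrite i0 addr0 => ->.
Qed.

Lemma hom_glam X : homogeneous 0 (glam X).
Proof.
move=> m n; rewrite addr0 => ne; apply: tin_epi => i j em.
have [i0|nz] := eqVneq i 0; last first.
  by apply/is_zero_from/is_zero_tenl/unit_gr_neq0.
move: em; rewrite i0 add0r => ->; rewrite glam_tin cid_neq ?comp0l//.
by rewrite eq_sym.
Qed.

Lemma hom_grho X : homogeneous 0 (grho X).
Proof.
move=> m n; rewrite addr0 => ne; apply: tin_epi => i j em.
have [i0|nz] := eqVneq j 0; last first.
  by apply/is_zero_from/is_zero_tenr/unit_gr_neq0.
move: em; rewrite i0 addr0 => ->; rewrite grho_tin cid_neq ?comp0l//.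
by rewrite eq_sym.
Qed.

Lemma hom_glami X : homogeneous 0 (glami X).
Proof.
move=> m n; rewrite addr0 => ne; rewrite glamiE tin_neq ?comp0l//.
by rewrite add0r eq_sym.
Qed.

Lemma hom_grhoi X : homogeneous 0 (grhoi X).
Proof.
move=> m n; rewrite addr0 => ne; rewrite grhoiE tin_neq ?comp0l//.
by rewrite addr0 eq_sym.
Qed.

Lemma glam_nat p X Y (f : gmap X Y) : homogeneous p f ->
  glam Y ∘[p] (gid I ⊗[p] f) = f ∘[0] glam X.
Proof.
move=> fp; apply: unit_epi_l => m n; rewrite gcomp_0E /gcomp -!mcompA.
rewrite (gtens_tin (X:=I) (X':=I) _ (gid_homogeneous I) fp (add0r m)).
rewrite mulr0 ksign0 scale1r !addr0 gidE (mcompA (glam Y _ _)) !glam_tin.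
rewrite -mcompA lam_nat cid_refl mcomp1m mcompA; congr (_ ∘ _).
have [<-|ne] := eqVneq (m + p) n; first by rewrite cid_refl mcomp1m.
by rewrite (cid_neq _ ne) comp0l fp// eq_sym.
Qed.

Lemma grho_nat p X Y (f : gmap X Y) : homogeneous p f ->
  grho Y ∘[p] (f ⊗[0] gid I) = f ∘[0] grho X.
Proof.
move=> fp; apply: unit_epi_r => m n; rewrite gcomp_0E /gcomp -!mcompA.
rewrite (gtens_tin (Y:=I) (Y':=I) _ fp (gid_homogeneous I) (addr0 m)).
rewrite mul0r ksign0 scale1r !addr0 gidE (mcompA (grho Y _ _)) !grho_tin.
rewrite -mcompA rho_nat cid_refl mcomp1m mcompA; congr (_ ∘ _).
have [<-|ne] := eqVneq (m + p) n; first by rewrite cid_refl mcomp1m.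
by rewrite (cid_neq _ ne) comp0l fp// eq_sym.
Qed.

Lemma glamiK X : glam X ∘[0] glami X = gid X.
Proof.
apply: gmapP => m n; rewrite gcomp_0E glamiE mcompA glam_tin -mcompA lamiK.
by rewrite mcompm1.
Qed.

Lemma glamK X : glami X ∘[0] glam X = gid (tensc I X).
Proof.
apply: unit_epi_l => m n; rewrite gcomp_0E -mcompA glam_tin cid_refl mcomp1m.
by rewrite glamiE -mcompA lamK mcompm1 /gid tin_cidr ?add0r.
Qed.

Lemma grhoiK X : grho X ∘[0] grhoi X = gid X.
Proof.
apply: gmapP => m n; rewrite gcomp_0E grhoiE mcompA grho_tin -mcompA rhoiK.
by rewrite mcompm1.
Qed.

Lemma grho_tens X Y :
  (gid X ⊗[0] grho Y) ∘[0] gassoc X Y I = grho (tensc X Y).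
Proof.
apply: gassoc_epi => i j l s m n es em.
have [l0|ne] := eqVneq l 0; last first.
  by apply/is_zero_from/is_zero_tenr/unit_gr_neq0.
subst l; move: em; rewrite addr0 => em; subst s; rewrite em.
rewrite gcomp_0E -!mcompA (mcompA (gassoc X Y I m m)).
rewrite (gassoc_tin (X:=X) (Y:=Y) (Z:=I) m em (addr0 j) (addr0 m)).
have e' : i + j = m by [].
rewrite !mcompA grho_tin -[RHS]mcompA rho_nat.
rewrite (tens_tin0 (Y:=tensc Y I) n (gid_homogeneous X) (@hom_grho Y) e').
rewrite gidE -!mcompA tenm_compA mcomp1m grho_tin !cid_refl !mcomp1m.
by rewrite rho_tens mcompA tin_cidr.
Qed.

Lemma gtriangle X Y :
  (gid X ⊗[0] glam Y) ∘[0] gassoc X I Y = grho X ⊗[0] gid Y.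
Proof.
apply: gassoc_epi => i j l s m n es em.
have [l0|ne] := eqVneq j 0; last first.
  by apply/is_zero_from/is_zero_tenl/is_zero_tenr/unit_gr_neq0.
subst j; move: es; rewrite addr0 => es; subst s.
rewrite gcomp_0E -!mcompA (mcompA (gassoc X I Y m m)).
rewrite (gassoc_tin (X:=X) (Y:=I) (Z:=Y) m (addr0 i) (add0r l) em).
rewrite !mcompA.
rewrite (tens_tin0 (Y:=tensc I Y) n (gid_homogeneous X) (@hom_glam Y) em).
rewrite (tens_tin0 (X:=tensc X I) n (@hom_grho X) (gid_homogeneous Y) em).
rewrite !gidE -!mcompA tenm_compA tenm_comp !mcomp1m.
rewrite glam_tin grho_tin !cid_refl !mcomp1m; congr (_ ∘ _).
exact: asc_triangle.
Qed.

Lemma grho_unit : grho I = glam I.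
Proof.
apply: unit_epi_r => m n; have [m0|ne] := eqVneq m 0; last first.
  by apply/is_zero_from/is_zero_tenl/unit_gr_neq0.
subst m; rewrite grho_tin glam_tin; congr (_ ∘ _); exact: rho_unit.
Qed.

End UnitCoherence.

(** * Composition rules in degrees 0, 1 and 2 *)

Section LowDegrees.
Variables (k : comPzRingType) (A : abMonCat k).
Implicit Types X Y Z T : grob A.

Lemma tens_comp00 X X' X'' Y Y' Y'' (f : gmap X' X'') (g : gmap Y' Y'')
    (f' : gmap X X') (g' : gmap Y Y') : homogeneous 0 f' -> homogeneous 0 g' ->
  (f ⊗[0] g) ∘[0] (f' ⊗[0] g') = (f ∘[0] f') ⊗[0] (g ∘[0] g').
Proof. by move=> hf hg; rewrite (@tens_comp0 _ _ 0 0 0). Qed.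

Lemma tens_comp_r0 X X' X'' Y Y' Y'' q (f : gmap X' X'') (g : gmap Y' Y'')
    (f' : gmap X X') (g' : gmap Y Y') : homogeneous 0 f' -> homogeneous 0 g' ->
  (f ⊗[q] g) ∘[0] (f' ⊗[0] g') = (f ∘[0] f') ⊗[q] (g ∘[0] g').
Proof. by move=> hf hg; rewrite (@tens_comp0 _ _ 0 q q)// addr0. Qed.

Lemma tens_comp_l0 X X' X'' Y Y' Y'' q (f : gmap X' X'') (g : gmap Y' Y'')
    (f' : gmap X X') (g' : gmap Y Y') : homogeneous 0 f' -> homogeneous q g' ->
  (f ⊗[0] g) ∘[q] (f' ⊗[q] g') = (f ∘[0] f') ⊗[q] (g ∘[q] g').
Proof. by move=> hf hg; rewrite (@tens_comp0 _ _ q 0 q)// add0r. Qed.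

Lemma tens_comp_p X X' X'' Y Y' Y'' p (f : gmap X' X'') (g : gmap Y' Y'')
    (f' : gmap X X') (g' : gmap Y Y') : homogeneous p f' -> homogeneous 0 g' ->
  (f ⊗[0] g) ∘[p] (f' ⊗[0] g') = (f ∘[p] f') ⊗[0] (g ∘[0] g').
Proof.
by move=> hf hg; rewrite (@tens_comp _ _ p 0 0 p 0)// ?addr0// mul0r scale1r.
Qed.

Lemma tens_comp_11 X X' X'' Y Y' Y'' (f : gmap X' X'') (g : gmap Y' Y'')
    (f' : gmap X X') (g' : gmap Y Y') : homogeneous 0 f' -> homogeneous 1 g' ->
  (f ⊗[1] g) ∘[1] (f' ⊗[1] g') = (f ∘[0] f') ⊗[2] (g ∘[1] g').
Proof. by move=> hf hg; rewrite (@tens_comp0 _ _ 1 1 2). Qed.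

(** Two maps of degree 1 pass each other. This sign makes the mixed terms in the square of a
    derivation cancel. *)
Lemma tens_comp_swap X X' X'' Y Y' Y'' (f : gmap X' X'') (g : gmap Y' Y'')
    (f' : gmap X X') (g' : gmap Y Y') : homogeneous 1 f' -> homogeneous 0 g' ->
  (f ⊗[1] g) ∘[1] (f' ⊗[0] g') = - ((f ∘[1] f') ⊗[1] (g ∘[0] g')).
Proof.
by move=> hf hg; rewrite (@tens_comp _ _ 1 0 1 1 1)// mulr1 ksign1 scaleN1r.
Qed.

Lemma hom_tens00 X X' Y Y' (f : gmap X X') (g : gmap Y Y') :
  homogeneous 0 f -> homogeneous 0 g -> homogeneous 0 (f ⊗[0] g).
Proof. exact: (@hom_tens _ _ 0 0 0). Qed.
Lemma hom_tens01 X X' Y Y' (f : gmap X X') (g : gmap Y Y') :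
  homogeneous 0 f -> homogeneous 1 g -> homogeneous 1 (f ⊗[1] g).
Proof. exact: (@hom_tens _ _ 0 1 1). Qed.
Lemma hom_tens10 X X' Y Y' (f : gmap X X') (g : gmap Y Y') :
  homogeneous 1 f -> homogeneous 0 g -> homogeneous 1 (f ⊗[0] g).
Proof. exact: (@hom_tens _ _ 1 0 1). Qed.
Lemma hom_tens20 X X' Y Y' (f : gmap X X') (g : gmap Y Y') :
  homogeneous 2 f -> homogeneous 0 g -> homogeneous 2 (f ⊗[0] g).
Proof. exact: (@hom_tens _ _ 2 0 2). Qed.
Lemma hom_comp00 X Y Z (f : gmap X Y) (g : gmap Y Z) :
  homogeneous 0 g -> homogeneous 0 (g ∘[0] f).
Proof. exact: (@hom_comp _ _ 0 0 0). Qed.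
Lemma hom_comp01 X Y Z (f : gmap X Y) (g : gmap Y Z) :
  homogeneous 0 g -> homogeneous 1 (g ∘[1] f).
Proof. exact: (@hom_comp _ _ 1 0 1). Qed.
Lemma hom_comp10 X Y Z (f : gmap X Y) (g : gmap Y Z) :
  homogeneous 1 g -> homogeneous 1 (g ∘[0] f).
Proof. exact: (@hom_comp _ _ 0 1 1). Qed.
Lemma hom_comp11 X Y Z (f : gmap X Y) (g : gmap Y Z) :
  homogeneous 1 g -> homogeneous 2 (g ∘[1] f).
Proof. exact: (@hom_comp _ _ 1 1 2). Qed.

Lemma comp00A X Y Z T (h : gmap Z T) (g : gmap Y Z) (f : gmap X Y) :
  h ∘[0] (g ∘[0] f) = h ∘[0] g ∘[0] f.
Proof. exact/esym/gcompA. Qed.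
Lemma comp01A X Y Z T (h : gmap Z T) (g : gmap Y Z) (f : gmap X Y) p :
  h ∘[p] (g ∘[p] f) = h ∘[0] g ∘[p] f.
Proof. by apply/esym/gcompA; rewrite addr0. Qed.
Lemma comp10A X Y Z T (h : gmap Z T) (g : gmap Y Z) (f : gmap X Y) p :
  h ∘[p] (g ∘[0] f) = h ∘[p] g ∘[0] f.
Proof. by apply/esym/gcompA; rewrite add0r. Qed.
Lemma comp11A X Y Z T (h : gmap Z T) (g : gmap Y Z) (f : gmap X Y) :
  h ∘[2] (g ∘[1] f) = h ∘[1] g ∘[1] f.
Proof. exact/esym/gcompA. Qed.

End LowDegrees.

Section LowDegreeAssociator.
Variables (k : comPzRingType) (A : abMonCat k).
Variables (X X' Y Y' Z Z' : complex A).
Variables (f : gmap X X') (g : gmap Y Y') (h : gmap Z Z').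

Lemma gassoc_nat0 : homogeneous 0 f -> homogeneous 0 g -> homogeneous 0 h ->
  gassoc X' Y' Z' ∘[0] ((f ⊗[0] g) ⊗[0] h) =
  (f ⊗[0] (g ⊗[0] h)) ∘[0] gassoc X Y Z.
Proof. exact: (@gassoc_nat _ _ 0 0 0 0). Qed.

Lemma gassoc_nat_l : homogeneous 1 f -> homogeneous 0 g -> homogeneous 0 h ->
  gassoc X' Y' Z' ∘[1] ((f ⊗[0] g) ⊗[0] h) =
  (f ⊗[0] (g ⊗[0] h)) ∘[0] gassoc X Y Z.
Proof. exact: (@gassoc_nat _ _ 1 0 0 1). Qed.

Lemma gassoc_nat_m : homogeneous 0 f -> homogeneous 1 g -> homogeneous 0 h ->
  gassoc X' Y' Z' ∘[1] ((f ⊗[1] g) ⊗[0] h) =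
  (f ⊗[1] (g ⊗[0] h)) ∘[0] gassoc X Y Z.
Proof. exact: (@gassoc_nat _ _ 0 1 0 1). Qed.

Lemma gassoc_nat_r : homogeneous 0 f -> homogeneous 0 g -> homogeneous 1 h ->
  gassoc X' Y' Z' ∘[1] ((f ⊗[0] g) ⊗[1] h) =
  (f ⊗[1] (g ⊗[1] h)) ∘[0] gassoc X Y Z.
Proof. exact: (@gassoc_nat _ _ 0 0 1 1). Qed.

End LowDegreeAssociator.

(** A hook for [hom], redefined as further homogeneous maps appear; through the hint below, side
    conditions on degrees are closed automatically. *)
Ltac hom_atom := fail.

Ltac hom := lazymatch goal with
  | |- homogeneous _ (gtens _ _ _) =>
    first [apply: hom_tens00; hom | apply: hom_tens01; hom | apply: hom_tens10; hom
          | apply: hom_tens20; hom | assumption]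
  | |- homogeneous _ (gcomp _ _ _) =>
    first [apply: hom_comp00; hom | apply: hom_comp01; hom | apply: hom_comp10; hom
          | apply: hom_comp11; hom | assumption]
  | |- homogeneous _ (GRing.scale _ _) => apply: homZ; hom
  | |- homogeneous _ (GRing.opp _) => apply: homN; hom
  | |- homogeneous _ (GRing.add _ _) => apply: homD; hom
  | |- homogeneous _ (gid _) => apply: gid_homogeneous
  | |- homogeneous _ (gassoc _ _ _) => apply: hom_gassoc
  | |- homogeneous _ (gassoci _ _ _) => apply: hom_gassoci
  | |- homogeneous _ (glam _) => apply: hom_glam
  | |- homogeneous _ (grho _) => apply: hom_grho
  | |- homogeneous _ (glami _) => apply: hom_glami
  | |- homogeneous _ (grhoi _) => apply: hom_grhoi
  | |- homogeneous _ (diff _) => apply: diff_homogeneous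
  | |- homogeneous _ (GRing.zero) => apply: hom0
  | |- _ => first [assumption | hom_atom]
  end.

#[export] Hint Extern 0 (homogeneous _ _) => solve [hom] : core.

Lemma gcompE (k : comPzRingType) (A : abMonCat k) (X Y Z : grob A) p
    (g : gmap Y Z) (f : gmap X Y) i j :
  (g ∘[p] f) i j = g (i + p) j ∘ f i (i + p).
Proof. by []. Qed.

#[global] Opaque gcomp gtens gassoc gassoci glam grho glami grhoi.

(** * Derivations of the tensor algebra *)

Section Derivations.
Variables (k : comPzRingType) (A : abMonCat k) (W : complex A).
Local Notation V := (tpowS W).

Lemma tcast_refl n : tcast W n n = gid (tpow W n).
Proof.
apply: gmapP => i j; rewrite /tcast /gid.
have [<-|ne] := eqVneq i j; first by rewrite !cid_refl.
by rewrite !cid_neq//; apply: contra ne => /eqP [->].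
Qed.

Lemma tcast_neq m n : m != n -> tcast W m n = 0.
Proof.
move=> ne; apply: gmapP => i j; rewrite /tcast cid_neq//.
by apply: contra ne => /eqP [->].
Qed.

Lemma hom_tcast m n : homogeneous 0 (tcast W m n).
Proof.
have [<-|ne] := eqVneq m n; last by rewrite tcast_neq.
by rewrite tcast_refl; apply: gid_homogeneous.
Qed.

Lemma tcastS m n : tcast W m.+2 n.+2 = gid W ⊗[0] tcast W m.+1 n.+1.
Proof.
have [<-|ne] := eqVneq m n; first by rewrite !tcast_refl gtens_id.
by rewrite !tcast_neq// gtens0r.
Qed.

(* The concatenation V a ⊗ V b -> V n, where V n is the power n + 1 of W;
   it is 0 unless n = a + b + 1. *)
Fixpoint cat (a b n : nat) {struct a} : gmap (tensc (V a) (V b)) (V n) :=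
  match a return gmap (tensc (V a) (V b)) (V n) with
  | 0%N => match n return gmap (tensc W (V b)) (V n) with
    | 0%N => 0
    | n'.+1 => gid W ⊗[0] tcast W b.+1 n'.+1
    end
  | a'.+1 => match n return gmap (tensc (tensc W (V a')) (V b)) (V n) with
    | 0%N => 0
    | n'.+1 => (gid W ⊗[0] cat a' b n') ∘[0] gassoc W (V a') (V b)
    end
  end.

Lemma cat0S b n : cat 0 b n.+1 = gid W ⊗[0] tcast W b.+1 n.+1. Proof. by []. Qed.
Lemma catSS a b n : cat a.+1 b n.+1 =
  (gid W ⊗[0] cat a b n) ∘[0] gassoc W (V a) (V b).
Proof. by []. Qed.

Lemma hom_cat a b n : homogeneous 0 (cat a b n).
Proof.
elim: a n => [|a IH] [|n] //.
  by rewrite cat0S; have h := hom_tcast b.+1 n.+1; apply: hom_tens00.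
by rewrite catSS; have h := IH n; apply: hom_comp00.
Qed.

Ltac hom_atom ::= lazymatch goal with
  | |- homogeneous _ (tcast _ ?m ?n) => exact: (hom_tcast m n)
  | |- homogeneous _ (cat ?a ?b ?n) => exact: (hom_cat a b n)
  end.

Lemma cat_neq a b n : n != (a + b).+1 -> cat a b n = 0.
Proof.
elim: a n => [|a IH] [|n] // ne.
  by rewrite cat0S tcast_neq ?gtens0r// eq_sym.
by rewrite catSS IH// gtens0r gcomp0l.
Qed.

Lemma tcast_cat a b m n : m = (a + b).+1 ->
  tcast W m.+1 n.+1 ∘[0] cat a b m = cat a b n.
Proof.
move=> em; have [<-|ne] := eqVneq m n.
  by rewrite tcast_refl (gid_l (@hom_cat a b m)).
by rewrite tcast_neq// gcomp0l cat_neq// -em eq_sym.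
Qed.

(** Induction on a: the step is the pentagon for W, V a, V b, V c, together with naturality of the
    associator. *)
Lemma catA a b c r :
  cat (a + b).+1 c r ∘[0] (cat a b (a + b).+1 ⊗[0] gid (V c)) =
  cat a (b + c).+1 r ∘[0] ((gid (V a) ⊗[0] cat b c (b + c).+1)
    ∘[0] gassoc (V a) (V b) (V c)).
Proof.
elim: a r => [|a IH] [|r]; rewrite ?gcomp0l //.
  rewrite !cat0S tcast_refl !gtens_id gid_r comp00A tens_comp00// gid_r.
  by rewrite (@tcast_cat b c (b + c).+1 r).
have split_tens (f : gmap (tensc W (tensc (V a) (V b))) (V (a + b).+2)) :
    (f ∘[0] gassoc W (V a) (V b)) ⊗[0] gid (V c) =
    (f ⊗[0] gid (V c)) ∘[0] (gassoc W (V a) (V b) ⊗[0] gid (V c)).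
  by rewrite tens_comp00// gid_r.
rewrite addSn !catSS split_tens -!comp00A (comp00A (gassoc W _ _)) gassoc_nat0//.
rewrite !comp00A tens_comp00// IH gid_r.
have -> : (gid W ⊗[0] (cat a (b + c).+1 r ∘[0] ((gid (V a) ⊗[0] cat b c (b + c).+1)
    ∘[0] gassoc (V a) (V b) (V c)))) = (gid W ⊗[0] cat a (b + c).+1 r) ∘[0]
    ((gid W ⊗[0] (gid (V a) ⊗[0] cat b c (b + c).+1)) ∘[0]
     (gid W ⊗[0] gassoc (V a) (V b) (V c))).
  by rewrite !tens_comp00// !gid_r.
rewrite -!comp00A -gassoc_pentagon !comp00A; congr (_ ∘[0] _).
by rewrite -!comp00A; congr (_ ∘[0] _); rewrite -gtens_id gassoc_nat0.
Qed.

End Derivations.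

#[global] Opaque tcast cat.

Ltac hom_atom ::= lazymatch goal with
  | |- homogeneous _ (tcast _ ?m ?n) => exact: (@hom_tcast _ _ _ m n)
  | |- homogeneous _ (cat _ ?a ?b ?n) => exact: (@hom_cat _ _ _ a b n)
  end.

Section Derivation.
Variables (k : comPzRingType) (A : abMonCat k) (W : complex A).
Local Notation V := (tpowS W).
Implicit Type b : forall n, gmap W (V n).

(* The component V m -> V n of the derivation of the tensor algebra of W which
   extends b; as cat c m n is 0 unless n = c + m + 1, truncation is harmless. *)
Fixpoint der b (m n : nat) {struct m} : gmap (V m) (V n) :=
  match m return gmap (V m) (V n) with
  | 0%N => b n
  | m'.+1 => cat W (n - m'.+1) m' n ∘[1] (b (n - m'.+1)%N ⊗[0] gid (V m')) +
    match n return gmap (tensc W (V m')) (V n) with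
    | 0%N => 0
    | n'.+1 => gid W ⊗[1] der b m' n'
    end
  end.

Lemma cat_0 a c : cat W a c 0 = 0. Proof. by case: a. Qed.

Lemma der0 b n : der b 0 n = b n. Proof. by []. Qed.
Lemma derS0 b m : der b m.+1 0 = 0.
Proof. by rewrite /= gcomp0l addr0. Qed.
Lemma derSS b m n : der b m.+1 n.+1 =
  cat W (n - m) m n.+1 ∘[1] (b (n - m)%N ⊗[0] gid (V m)) + gid W ⊗[1] der b m n.
Proof. by []. Qed.

#[local] Opaque der.

Lemma hom_der b m n : (forall c, homogeneous 1 (b c)) -> homogeneous 1 (der b m n).
Proof.
move=> hb; elim: m n => [|m IH] [|n]; rewrite ?der0 ?derS0 ?derSS//.
by have := hb (n - m)%N; have := IH n.
Qed.

Lemma der_lt b m n : (n < m)%N -> der b m n = 0.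
Proof.
elim: m n => [|m IH] [|n] //; rewrite ?derS0// derSS ltnS => lt_nm.
rewrite IH// gtens0r addr0 cat_neq ?gcomp0l//.
by apply/eqP; lia.
Qed.

Section Leibniz.
Variable b : forall n, gmap W (V n).
Hypothesis hb : forall c, homogeneous 1 (b c).

Ltac hom_atom ::= lazymatch goal with
  | |- homogeneous _ (tcast _ ?m ?n) => exact: (@hom_tcast _ _ _ m n)
  | |- homogeneous _ (cat _ ?a ?b ?n) => exact: (@hom_cat _ _ _ a b n)
  | |- homogeneous _ (der _ ?m ?n) => apply: (@hom_der _ m n); assumption
  | |- homogeneous _ (?b _) =>
    match goal with h : forall c, homogeneous 1 (b c) |- _ => exact: h end
  end.

(** This and the next three lemmas supply the induction step of the Leibniz rule on W ⊗ V a ⊗ V c: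
    [b] acts on the first factor, D acts on the rest, and the action on the rest splits into those
    on V a and on V c. *)
Lemma cat_extend_l q a c n :
  cat W q (a + c).+1 n ∘[1] (b q ⊗[0] gid (V (a + c).+1)) ∘[0]
    ((gid W ⊗[0] cat W a c (a + c).+1) ∘[0] gassoc W (V a) (V c)) =
  cat W (q + a).+1 c n ∘[1]
    ((cat W q a (q + a).+1 ∘[1] (b q ⊗[0] gid (V a))) ⊗[0] gid (V c)).
Proof.
transitivity (cat W (q + a).+1 c n ∘[1]
    ((cat W q a (q + a).+1 ⊗[0] gid (V c)) ∘[1] ((b q ⊗[0] gid (V a)) ⊗[0] gid (V c)))).
  rewrite (comp01A (cat W (q + a).+1 c n)) (@catA _ _ W q a c n).
  rewrite -[RHS]comp01A -[in RHS]comp01A gassoc_nat_l//.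
  rewrite -comp10A; congr (_ ∘[1] _). 
  rewrite !gtens_id.
  rewrite !comp10A; congr (_ ∘[0] _).
  by rewrite tens_comp_r0// tens_comp_p// !gid_r !gid_l.
by rewrite tens_comp_p// gid_r.
Qed.

Lemma cat_extend_r a c n :
  (gid W ⊗[1] der b (a + c).+1 n) ∘[0]
    ((gid W ⊗[0] cat W a c (a + c).+1) ∘[0] gassoc W (V a) (V c)) =
  (gid W ⊗[1] (der b (a + c).+1 n ∘[0] cat W a c (a + c).+1))
    ∘[0] gassoc W (V a) (V c).
Proof. by rewrite comp00A tens_comp_r0// gid_r. Qed.

Lemma cat_extend_derl a c m n :
  (gid W ⊗[1] (cat W m c n ∘[1] (der b a m ⊗[0] gid (V c))))
    ∘[0] gassoc W (V a) (V c) =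
  cat W m.+1 c n.+1 ∘[1] ((gid W ⊗[1] der b a m) ⊗[0] gid (V c)).
Proof.
rewrite catSS -[RHS]comp01A gassoc_nat_m//.
by rewrite comp10A; congr (_ ∘[0] _); rewrite tens_comp_l0// gid_r.
Qed.

Lemma cat_extend_derr a c m n :
  (gid W ⊗[1] (cat W a m n ∘[1] (gid (V a) ⊗[1] der b c m)))
    ∘[0] gassoc W (V a) (V c) =
  cat W a.+1 m n.+1 ∘[1] (gid (V a.+1) ⊗[1] der b c m).
Proof.
rewrite catSS -[RHS]comp01A -gtens_id gassoc_nat_r//.
by rewrite comp10A; congr (_ ∘[0] _); rewrite tens_comp_l0// gid_r.
Qed.

Lemma der_leibniz a c n :
  der b (a + c).+1 n ∘[0] cat W a c (a + c).+1 =
  cat W (n - c.+1) c n ∘[1] (der b a (n - c.+1) ⊗[0] gid (V c)) +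
  cat W a (n - a.+1) n ∘[1] (gid (V a) ⊗[1] der b c (n - a.+1)).
Proof.
elim: a n => [|a IH] [|n].
- by rewrite derS0 !cat_0 !gcomp0l addr0.
- change (0 + c)%N with c; rewrite !cat0S !tcast_refl gtens_id gid_r derSS.
  by rewrite !subSS subn0 tcast_refl gtens_id gid_l.
- by rewrite derS0 !cat_0 !gcomp0l addr0.
have [le_n|lt_n] := leqP (a + c).+1 n; last first.
  rewrite addSn der_lt; last by lia.
  rewrite gcomp0l (@der_lt _ a.+1); last by lia.
  rewrite gtens0l gcomp0r add0r.
  (* If the subtraction truncates to 0 and c = 0, the derivation need not vanish; the concatenation
     then does, by its size. *)
  have [lt_c|le_c] := ltnP (n.+1 - a.+2) c; first by rewrite der_lt// gtens0r gcomp0r.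
  by rewrite cat_neq ?gcomp0l//; apply/eqP; lia.
have [q nE] : exists q, n = (a + c).+1 + q by exists (n - (a + c).+1)%N; lia.
have -> : (n.+1 - c.+1 = (q + a).+1)%N by lia.
have -> : (n.+1 - a.+2 = q + c)%N by lia.
rewrite addSn derSS; have -> : (n - (a + c).+1 = q)%N by lia.
rewrite derSS; have -> : (q + a - a = q)%N by lia.
rewrite gtensDl gcompDr catSS gcompDl cat_extend_l -addrA; congr (_ + _).
rewrite cat_extend_r IH gtensDr gcompDl.
have -> : (n - c.+1 = q + a)%N by lia.
have -> : (n - a.+1 = q + c)%N by lia.
by rewrite cat_extend_derl cat_extend_derr.
Qed.

(* der2 b 0 n is the (n + 1)st A-infinity equation. *)
Definition der2 m n : gmap (V m) (V n) :=
  \sum_(0 <= j < n.+1) (der b j n ∘[1] der b m j).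

Lemma hom_der2 m n : homogeneous 2 (der2 m n).
Proof. by apply: hom_sum => j _; apply: hom_comp11. Qed.

Lemma der2_lt m n : (n < m)%N -> der2 m n = 0.
Proof.
move=> lt_nm; rewrite /der2 big_nat big1// => j /andP[_ lt_j].
by rewrite (@der_lt _ m) ?gcomp0r//; lia.
Qed.

(* In D ∘ D the mixed terms b ⊗ D and D ⊗ b cancel by the Koszul signs, so the
   square of a derivation of degree 1 is a derivation. *)
Lemma der2S m q : der2 m.+1 (m + q).+1 =
  cat W q m (m + q).+1 ∘[2] (der2 0 q ⊗[0] gid (V m)) +
  gid W ⊗[2] der2 m (m + q).
Proof.
set n := (m + q)%N.
(* The mixed term, with [b c] on the first factor and D on the rest. It occurs in [S2], where D acts
   on the rest before [b] acts, and with the opposite sign in [S1], where the order is reversed. *)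
pose U c := cat W c (n - c) n.+1 ∘[2] (b c ⊗[1] der b m (n - c)).
have U_sum : \sum_(0 <= c < q.+1) U c = \sum_(0 <= j < n.+1) U (n - j)%N.
  rewrite [RHS]big_nat_rev add0n /=.
  rewrite (@big_cat_nat _ _ _ q.+1 0 n.+1) //=; last by rewrite /n; lia.
  (* For c > q the map on the rest would have to lower the power, which D never does. *)
  rewrite [X in _ = _ + X]big_nat [X in _ = _ + X]big1 ?addr0 => [|c lt_c]; last first.
    rewrite /U (@der_lt _ m) ?gtens0r ?gcomp0r//; lia.
  by apply: eq_big_nat => c lt_c; congr U; rewrite /n; lia.
have S2 j : (j <= n)%N -> der b j.+1 n.+1 ∘[1] (gid W ⊗[1] der b m j) =
    U (n - j)%N + gid W ⊗[2] (der b j n ∘[1] der b m j).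
  move=> le_j; rewrite derSS gcompDl; congr (_ + _); last first.
    by rewrite tens_comp_11// gid_r.
  rewrite /U; have -> : (n - (n - j) = j)%N by lia.
  by rewrite -comp11A tens_comp_l0// gid_l// gid_r.
have S1 c : (c <= q)%N ->
    der b (c + m).+1 n.+1 ∘[1] (cat W c m (c + m).+1 ∘[1] (b c ⊗[0] gid (V m))) =
    cat W q m n.+1 ∘[2] ((der b c q ∘[1] b c) ⊗[0] gid (V m)) - U c.
  move=> le_c; rewrite comp01A der_leibniz gcompDl subSS.
  have -> : (n - m = q)%N by rewrite /n; lia.
  congr (_ + _).
    by rewrite -comp11A tens_comp_p// gid_r.
  by rewrite subSS -comp11A tens_comp_swap// gcompNr gid_l// gid_r.
rewrite {1}/der2 big_nat_recl// derS0 gcomp0r add0r.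
transitivity (\sum_(0 <= j < n.+1)
   (der b j.+1 n.+1 ∘[1] (cat W (j - m) m j.+1 ∘[1] (b (j - m)%N ⊗[0] gid (V m)))
   + (U (n - j)%N + gid W ⊗[2] (der b j n ∘[1] der b m j)))).
  apply: eq_big_nat => j /andP[_ lt_j]; rewrite derSS gcompDr S2//.
rewrite !big_split /= addrA; congr (_ + _); last by rewrite /der2 gtens_sumr.
rewrite -U_sum (@big_cat_nat _ _ _ m 0 n.+1) //=; last by rewrite /n; lia.
rewrite big_nat big1 => [|j lt_j]; last first.
  by rewrite cat_neq ?gcomp0l ?gcomp0r//; apply/eqP; lia.
have shift (F : nat -> gmap (V m.+1) (V n.+1)) :
    \sum_(m <= j < n.+1) F j = \sum_(0 <= c < q.+1) F (c + m)%N.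
  transitivity (\sum_(0 + m <= j < n.+1) F j); first by [].
  by rewrite big_addn; have -> : (n.+1 - m = q.+1)%N by rewrite /n; lia.
rewrite add0r shift.
transitivity (\sum_(0 <= c < q.+1)
   (cat W q m n.+1 ∘[2] ((der b c q ∘[1] b c) ⊗[0] gid (V m)) - U c) +
   \sum_(0 <= c < q.+1) U c).
  congr (_ + _); apply: eq_big_nat => c /andP[_ lt_c].
  by rewrite -S1// addnK.
rewrite big_split sumrN /= subrK /der2 gtens_suml gcomp_sumr.
by apply: eq_bigr => c _; rewrite der0.
Qed.

(** As D^2 is a derivation, its components which raise the power by less than N are built from those
    on W which do so. *)
Lemma der2_eq0 N m n : (forall j, (j < N)%N -> der2 0 j = 0) ->
  (n < m + N)%N -> der2 m n = 0.
Proof.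
move=> e0; elim: m n => [|m IH] n lt_n; first exact: e0.
have [lt_nm|le_mn] := ltnP n m.+1; first exact: der2_lt.
have [q nE] : exists q, n = (m + q).+1 by exists (n - m.+1)%N; lia.
rewrite nE der2S e0; last by lia.
by rewrite gtens0l gcomp0r IH ?gtens0r ?addr0//; lia.
Qed.

(* Compares the components W -> V N of D ∘ D^2 and D^2 ∘ D. *)
Lemma der2_closed N : (forall j, (j < N)%N -> der2 0 j = 0) ->
  der b N N ∘[2] der2 0 N = der2 0 N ∘[1] b 0%N.
Proof.
move=> e0.
(* The summand of D^3 along W -> V i -> V j -> V N. Summing over i inside gives D ∘ D^2, over j
   inside D^2 ∘ D, and in each outer sum one term survives. *)
pose F i j := der b j N ∘[1] der b i j ∘[1] b i.
have F0 i j : (j < i)%N -> F i j = 0.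
  by move=> lt; rewrite /F (@der_lt _ i)// gcomp0r gcomp0l.
transitivity (\sum_(0 <= j < N.+1) \sum_(0 <= i < N.+1) F i j).
  transitivity (\sum_(0 <= j < N.+1) (der b j N ∘[2] der2 0 j)).
    rewrite big_nat_recr//= big_nat big1 ?add0r// => j lt_j.
    by rewrite e0 ?gcomp0r//; lia.
  apply: eq_big_nat => j /andP[_ lt_j].
  rewrite (@big_cat_nat _ _ _ j.+1 0 N.+1)//= [X in _ + X]big_nat.
  rewrite [X in _ + X]big1 ?addr0 => [|i lt_i]; last by apply: F0; lia.
  by rewrite /der2 gcomp_sumr; apply: eq_bigr => i _; rewrite comp11A.
rewrite exchange_big_nat /=.
transitivity (\sum_(0 <= i < N.+1) (der2 i N ∘[1] b i)).
  by apply: eq_bigr => i _; rewrite /der2 gcomp_suml.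
rewrite big_nat_recl// big_nat big1 ?addr0// => i lt_i.
by rewrite (der2_eq0 e0) ?gcomp0l//; lia.
Qed.

End Leibniz.
End Derivation.

#[global] Opaque der.

(** * Insertions and the pre-Lie product *)

Section Insertions.
Variables (k : comPzRingType) (A : abMonCat k) (W : complex A).
Local Notation V := (tpowS W).

Lemma hom_tcatS a b : homogeneous 0 (tcatS W a b).
Proof.
elim: a => [|a IH]; first by case: b => [|b]; [apply: hom_grho|apply: gid_homogeneous].
by apply: hom_comp00; apply: hom_tens00.
Qed.

Lemma hom_tcat a b : homogeneous 0 (tcat W a b).
Proof. by case: a => [|a]; [apply: hom_glam|apply: hom_tcatS]. Qed.

Lemma hom_tsplitS a b : homogeneous 0 (tsplitS W a b).
Proof.
elim: a => [|a IH]; first by case: b => [|b]; [apply: hom_grhoi|apply: gid_homogeneous].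
by apply: hom_comp00; apply: hom_gassoci.
Qed.

Lemma hom_tsplit a b : homogeneous 0 (tsplit W a b).
Proof. by case: a => [|a]; [apply: hom_glami|apply: hom_tsplitS]. Qed.

Ltac hom_atom ::= lazymatch goal with
  | |- homogeneous _ (tcast _ ?m ?n) => exact: (@hom_tcast _ _ _ m n)
  | |- homogeneous _ (cat _ ?a ?b ?n) => exact: (@hom_cat _ _ _ a b n)
  | |- homogeneous _ (tcat _ ?a ?b) => exact: (@hom_tcat a b)
  | |- homogeneous _ (tcatS _ ?a ?b) => exact: (@hom_tcatS a b)
  | |- homogeneous _ (tsplit _ ?a ?b) => exact: (@hom_tsplit a b)
  | |- homogeneous _ (tsplitS _ ?a ?b) => exact: (@hom_tsplitS a b)
  end.

Lemma tcast_tcatS a b n :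
  tcast W (a.+1 + b.+1) n.+1 ∘[0] tcatS W a b.+1 = cat W a b n.
Proof.
elim: a n => [|a IH] [|n].
- by rewrite tcast_neq// gcomp0l cat_0.
- by rewrite cat0S -tcastS; apply: gid_r.
- by rewrite tcast_neq// gcomp0l cat_0.
rewrite catSS -IH.
have -> : tcast W (a.+2 + b.+1) n.+2 = gid W ⊗[0] tcast W (a.+1 + b.+1) n.+1.
  exact: tcastS.
rewrite comp00A tens_comp00// ?gid_r//. exact: hom_tcatS.
Qed.

(** The right factor is the unit here, a case outside the range of [cat]; [grho_tens] carries the
    unit constraint through the associators. *)
Lemma tcast_tcatS0 a n :
  tcast W (a.+1 + 0) n.+1 ∘[0] tcatS W a 0 = tcast W a.+1 n.+1 ∘[0] grho (V a).
Proof.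
elim: a n => [|a IH] [|n] //.
  by rewrite !tcast_neq// !gcomp0l.
have -> : tcast W (a.+2 + 0) n.+2 = gid W ⊗[0] tcast W (a.+1 + 0) n.+1.
  exact: tcastS.
rewrite tcastS -grho_tens !comp00A !tens_comp00//; last exact: hom_tcatS.
by rewrite !gid_r IH.
Qed.

Section Insert.
Variables (c : nat) (phi : gmap W (tpow W c.+1)).
Hypothesis hphi : homogeneous 1 phi.

(** The insertion at the first factor, without the unit object that [insert 0 b] introduces on the
    left and removes again. *)
Definition insert_head b : gmap (tpow W (1 + b)) (tpow W (c.+1 + b)) :=
  tcat W c.+1 b ∘[1] ((phi ⊗[0] gid (tpow W b)) ∘[0] tsplit W 1 b).

Lemma hom_insert_head b : homogeneous 1 (insert_head b).
Proof. by apply: hom_comp01; apply: hom_tcat. Qed.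

Lemma insert_fold a b : insert a b phi =
  tcat W a (c.+1 + b) ∘[1] ((gid (tpow W a) ⊗[1] insert_head b)
    ∘[0] tsplit W a (1 + b)).
Proof.
rewrite /insert /insert_head; congr (_ ∘[1] _).
rewrite !comp10A; congr (_ ∘[0] _).
by rewrite tens_comp_l0// tens_comp_r0// !gid_r.
Qed.

Lemma hom_insert a b : homogeneous 1 (insert a b phi).
Proof. by rewrite /insert; apply: hom_comp01; apply: hom_tcat. Qed.

Lemma insert0 b : insert 0 b phi = insert_head b.
Proof.
have h := hom_insert_head b.
rewrite insert_fold comp10A (glam_nat (X := tpow W (1 + b)) (Y := tpow W (c.+1 + b)) h).
by rewrite -comp00A glamiK gid_r.
Qed.

Lemma insert1 b : insert 1 b phi = gid W ⊗[1] insert 0 b phi.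
Proof.
have h := hom_insert_head b.
rewrite insert0 insert_fold.
have -> : tsplit W 1 (1 + b) = gid (tensc W (tpow W (1 + b))) by [].
have -> : tcat W 1 (c.+1 + b) = gid (tensc W (tpow W (c.+1 + b))) by [].
rewrite gid_r gid_l//.
Qed.

Lemma insertSS a b : insert a.+2 b phi = gid W ⊗[1] insert a.+1 b phi.
Proof.
have h := hom_insert_head b.
rewrite !insert_fold.
have -> : tsplit W a.+2 (1 + b) = gassoci W (V a) (tpow W (1 + b)) ∘[0]
  (gid W ⊗[0] tsplit W a.+1 (1 + b)) by [].
have -> : tcat W a.+2 (c.+1 + b) = (gid W ⊗[0] tcat W a.+1 (c.+1 + b)) ∘[0]
   gassoc W (V a) (tpow W (c.+1 + b)) by [].
have -> : gid (tpow W a.+2) = gid W ⊗[0] gid (V a) by rewrite gtens_id.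
transitivity ((gid W ⊗[0] tcat W a.+1 (c.+1 + b)) ∘[1]
  ((gid W ⊗[1] (gid (V a) ⊗[1] insert_head b)) ∘[0]
   (gid W ⊗[0] tsplit W a.+1 (1 + b)))).
  rewrite -comp01A; congr (_ ∘[1] _).
  rewrite comp10A gassoc_nat_r// -comp00A; congr (_ ∘[0] _).
  by rewrite comp00A gassocK gid_l.
by rewrite tens_comp_r0// tens_comp_l0// !gid_r.
Qed.

(* The insertion as a map between the powers m + 1 and n + 1 of W; it is 0
   unless the sizes agree. *)
Definition ins a b m n : gmap (V m) (V n) :=
  tcast W (a + (c.+1 + b)) n.+1 ∘[1]
  (insert a b phi ∘[0] tcast W m.+1 (a + (1 + b))).

Lemma insS a b m n : (m = a + b)%N -> ins a.+1 b m.+1 n.+1 = gid W ⊗[1] ins a b m n.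
Proof.
move=> _; case: a => [|a]; rewrite /ins.
- rewrite insert1.
  have -> : tcast W m.+2 (1 + (1 + b)) = gid W ⊗[0] tcast W m.+1 (0 + (1 + b)).
    exact: tcastS.
  have -> : tcast W (1 + (c.+1 + b)) n.+2 =
      gid W ⊗[0] tcast W (0 + (c.+1 + b)) n.+1 by exact: tcastS.
  have h := hom_insert 0 b.
  by rewrite tens_comp_r0// tens_comp_l0// !gid_r.
- rewrite insertSS.
  have -> : tcast W m.+2 (a.+2 + (1 + b)) = gid W ⊗[0] tcast W m.+1 (a.+1 + (1 + b)).
    exact: tcastS.
  have -> : tcast W (a.+2 + (c.+1 + b)) n.+2 =
      gid W ⊗[0] tcast W (a.+1 + (c.+1 + b)) n.+1 by exact: tcastS.
  have h := hom_insert a.+1 b.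
  by rewrite tens_comp_r0// tens_comp_l0// !gid_r.
Qed.

Lemma ins_target0 a b m : ins a.+1 b m 0 = 0.
Proof. by rewrite /ins tcast_neq ?gcomp0l//; apply/eqP; lia. Qed.

Lemma ins00 n : ins 0 0 0 n = tcast W c.+1 n.+1 ∘[1] phi.
Proof.
rewrite /ins insert0 /insert_head.
have -> : tcast W 1 (0 + (1 + 0)) = gid (tpow W 1) by rewrite -tcast_refl.
rewrite gid_r.
have -> : tcat W c.+1 0 = tcatS W c 0 by [].
have -> : tsplit W 1 0 = grhoi W by [].
rewrite comp01A tcast_tcatS0 -comp01A; congr (_ ∘[1] _).
by rewrite comp10A (grho_nat (Y := V c) hphi) -comp00A grhoiK gid_r.
Qed.

Lemma ins0S b n : ins 0 b.+1 b.+1 n = cat W c b n ∘[1] (phi ⊗[0] gid (V b)).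
Proof.
rewrite /ins insert0 /insert_head.
have -> : tcast W b.+2 (0 + (1 + b.+1)) = gid (tpow W b.+2) by rewrite -tcast_refl.
rewrite gid_r.
have -> : tcat W c.+1 b.+1 = tcatS W c b.+1 by [].
have -> : tsplit W 1 b.+1 = gid (tensc W (V b)) by [].
by rewrite comp01A tcast_tcatS gid_r.
Qed.

(** The family on the right is [phi] at index c and 0 elsewhere. Both sides split in the same way:
    the term a = 0 is [phi] on the first factor, and the others are insertions into the rest. *)
Lemma sum_ins m n : \sum_(0 <= a < m.+1) ins a (m - a) m n =
  der (fun n => tcast W c.+1 n.+1 ∘[1] phi) m n.
Proof.
elim: m n => [|m IH] n; first by rewrite big_nat1 der0 ins00.
rewrite big_nat_recl// subn0 ins0S.
case: n => [|n].
  by rewrite derS0 cat_0 gcomp0l big1 ?addr0// => a _; rewrite ins_target0.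
rewrite derSS; congr (_ + _).
  have [->|ne] := eqVneq n (c + m)%N.
    by rewrite addnK tcast_refl gid_l.
  rewrite cat_neq ?gcomp0l//.
  have [nm|ne'] := eqVneq (n - m)%N c; last first.
    by rewrite tcast_neq ?gcomp0l ?gtens0l ?gcomp0r// eqSS eq_sym.
  by rewrite cat_neq ?gcomp0l//; apply/eqP; move/eqP: ne; lia.
rewrite -IH gtens_sumr; apply: eq_big_nat => a /andP[_ lt_a].
by rewrite subSS insS//; lia.
Qed.

End Insert.

(** A derivation raises the power by what it does to a single factor, so one value of the family
    decides each component. Hence a new component leaves the terms built from earlier ones
    unchanged. *)
Lemma der_eq1 (b b' : forall n, gmap W (V n)) m n :
  b (n - m)%N = b' (n - m)%N -> der b m n = der b' m n.
Proof.
elim: m n => [|m IH] [|n]; rewrite ?der0 ?derS0 ?derSS// subSS => e.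
by rewrite e (IH n).
Qed.

Lemma der_diff (b : forall n, gmap W (V n)) n :
  b 0%N = diff W -> der b n n = diff (V n).
Proof.
move=> b0; elim: n => [|n IH]; first by rewrite der0.
rewrite derSS subnn b0 cat0S tcast_refl gtens_id gid_l ?IH//.
Qed.

End Insertions.

(** * The pre-Lie product as composition with a derivation *)

Section Bullet.
Variables (k : comPzRingType) (A : abMonCat k) (W : complex A).
Local Notation V := (tpowS W).
Variable xi : forall n, gmap W (tpow W n).
Hypothesis hxi : forall n, homogeneous 1 (xi n).
Hypothesis xi0 : xi 0%N = 0.

Lemma insert_0 a c b : insert a b (0 : gmap W (tpow W c)) = 0.
Proof.
by rewrite /insert gtens0l gtens0r gcomp0l !gcomp0r.
Qed.

(** For fixed c the sizes leave only the position a free, and the insertions of [xi c] at all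
    positions sum to a derivation; the final index j is n - c after c has been lowered by one. *)
Lemma bullet_der n : bullet xi xi n.+1 =
  \sum_(0 <= j < n.+1) (der (fun c => xi c.+1) j n ∘[1] xi j.+1).
Proof.
pose F a c b := tcast W (a + (c + b)) n.+1
     ∘[2] (insert a b (xi c) ∘[1] xi (a + (1 + b))%N).
transitivity (\sum_(a < n.+2) \sum_(c < n.+2)
    \sum_(b < n.+2 | (a + c + b == n.+1)%N) F a c b).
  apply: gmapP => i j; rewrite gmap_sum; apply: eq_bigr => a _.
  by rewrite gmap_sum; apply: eq_bigr => c _; rewrite gmap_sum.
rewrite exchange_big /= big_ord_recl /= [X in X + _]big1 ?add0r => [|a _]; last first.
  by rewrite big1// => b _; rewrite /F xi0 insert_0 gcomp0l gcomp0r.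
have FE a c b m : (m = a + b)%N -> F a c.+1 b = ins (xi c.+1) a b m n ∘[1] xi m.+1.
  move=> ->; rewrite /F /ins.
  have -> : xi (a + (1 + b))%N = tcast W (a + b).+1 (a + (1 + b)) ∘[1] xi (a + b).+1.
    by rewrite add1n addnS tcast_refl gid_l.
  by rewrite comp01A comp11A.
transitivity (\sum_(c < n.+1) \sum_(0 <= a < (n - c).+1)
    (ins (xi c.+1) a (n - c - a) (n - c) n ∘[1] xi (n - c).+1)).
  apply: eq_bigr => c _; have lt_c := ltn_ord c.
  change (\sum_(a < n.+2) \sum_(b < n.+2 | (a + c.+1 + b == n.+1)%N) F a c.+1 b =
    \sum_(0 <= a < (n - c).+1) (ins (xi c.+1) a (n - c - a) (n - c) n ∘[1] xi (n - c).+1)).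
  have le_n : ((n - c).+1 <= n.+2)%N by lia.
  rewrite big_mkord (big_ord_widen n.+2 (fun a =>
    ins (xi c.+1) a (n - c - a) (n - c) n ∘[1] xi (n - c).+1) le_n).
  rewrite [RHS]big_mkcond; apply: eq_bigr => a _.
  case: ltnP => [lt_a|le_a]; last first.
    by rewrite big1// => b /eqP; lia.
  have lt_b : (n - c - a < n.+2)%N by lia.
  rewrite (big_pred1 (Ordinal lt_b)) => [|b]; first by apply: FE => /=; lia.
  by rewrite /pred1 /= -val_eqE /=; apply/eqP/eqP; lia.
rewrite big_mkord (reindex_inj rev_ord_inj) /=; apply: eq_bigr => j _.
rewrite subSS; have -> : (n - (n - j) = j)%N by have := ltn_ord j; lia.
rewrite -gcomp_suml sum_ins//; congr (_ ∘[1] _).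
by apply: der_eq1; rewrite tcast_refl gid_l.
Qed.
End Bullet.

(** Dependent choice with an invariant: the step function is chosen on all pairs, with an arbitrary
    value where [R] fails, and induction shows that this case never arises. It serves both for
    homotopies, degree by degree, and for the components of D. *)
Lemma step_choice (T : Type) (R : nat -> T -> Prop) (S : nat -> T -> T -> Prop)
    (x0 : T) : R 0%N x0 ->
  (forall n x, R n x -> exists y, R n.+1 y /\ S n x y) ->
  exists f : nat -> T,
    f 0%N = x0 /\ forall n, R n (f n) /\ S n (f n) (f n.+1).
Proof.
move=> R0 step.
have [|g gP] := @choice (nat * T)%type T
    (fun u y => R u.1 u.2 -> R u.1.+1 y /\ S u.1 u.2 y).
  move=> [n x]; have [Rx|nRx] := pselect (R n x); last by exists x.
  by have [y yP] := step _ _ Rx; exists y.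
pose f := fix f n := if n is n'.+1 then g (n', f n') else x0.
exists f; split=> // n; have Rf m : R m (f m).
  by elim: m => [//|m IH]; case: (gP (m, f m) IH).
by split; [exact: Rf|case: (gP (n, f n) (Rf n))].
Qed.

(** * Differentials of Hom-complexes *)

Section HomComplex.
Variables (k : comPzRingType) (A : abMonCat k).
Implicit Types X Y : complex A.

Lemma diffK X : diff X ∘[1] diff X = 0.
Proof. by apply: gmapP => i j; apply: diff_diff. Qed.

Definition bracket X Y p (f : gmap X Y) : gmap X Y :=
  diff Y ∘[p] f - ksign k p *: (f ∘[1] diff X).

Lemma hom_diffE X Y p (f : gmap X Y) i j :
  hom_diff (diff X) (diff Y) p f i j = bracket p f i j.
Proof. by []. Qed.

Lemma bracketE X Y p (f : gmap X Y) i j : bracket p f i j =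
  diff Y (i + p) j ∘ f i (i + p) - ksign k p *: (f (i + 1) j ∘ diff X i (i + 1)).
Proof. by rewrite /bracket gmapD gmapN gmapZ !gcompE. Qed.

Lemma bracketD X Y p (f g : gmap X Y) :
  bracket p (f + g) = bracket p f + bracket p g.
Proof. by rewrite /bracket gcompDl gcompDr scalerDr opprD addrACA. Qed.

Lemma hom_bracket X Y p (f : gmap X Y) :
  homogeneous p f -> homogeneous (p + 1) (bracket p f).
Proof.
move=> fp; apply: homD; first by apply: hom_comp => //; apply: diff_homogeneous.
apply/homN/homZ/hom_comp; last exact: fp.
exact: addrC.
Qed.

(** This is d^2 = 0 in the Hom-complex, in the form in which closedness is assumed for lifting. *)
Lemma bracketK X Y p (f : gmap X Y) :
  diff Y ∘[p + 1] bracket p f = ksign k (p + 1) *: (bracket p f ∘[1] diff X).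
Proof.
rewrite /bracket gcompDl gcompDr gcompNl gcompNr gcompZl gcompZr.
rewrite -(gcompA (diff Y) (diff Y) f erefl) diffK gcomp0l add0r.
rewrite (gcompA f (diff X) (diff X) erefl) diffK gcomp0r scaler0 subr0.
rewrite (gcompA (diff Y) f (diff X) (addrC p 1)).
by rewrite ksignD ksign1 mulrN1 scaleNr.
Qed.

End HomComplex.

(** * Lifting along resolutions *)

Section Lifting.
Variables (k : comPzRingType) (A : abMonCat k).
Variables (X Y : complex A) (t p : int) (c : gmap X Y).
Hypothesis hc : homogeneous (p + 1) c.
Hypothesis c_closed : diff Y ∘[p + 1] c = ksign k (p + 1) *: (c ∘[1] diff X).
Hypothesis c_top : forall i j, t < i -> c i j = 0.
Hypothesis c_lift : exists v : Hom (X t) (Y (t + p)),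
  diff Y (t + p) (t + (p + 1)) ∘ v = c t (t + (p + 1)).
Hypothesis Y_exact : forall i (u : Hom (X i) (Y (i + (p + 1)))), i < t ->
  diff Y (i + (p + 1)) (i + (p + 1) + 1) ∘ u = 0 ->
  exists v : Hom (X i) (Y (i + p)), diff Y (i + p) (i + (p + 1)) ∘ v = u.

Lemma defect_closed h : homogeneous p h ->
  diff Y ∘[p + 1] (c - bracket p h) =
  ksign k (p + 1) *: ((c - bracket p h) ∘[1] diff X).
Proof.
move=> hp; rewrite gcompDl gcompDr gcompNl gcompNr c_closed bracketK.
by rewrite scalerDr scalerN.
Qed.

(** Below t, the defect vanishes in source degree i + 1, so closedness makes its component at i a
    cycle, and exactness gives the correction. At i = t it comes from [c_lift], which speaks of [c]
    itself; therefore [h] has to be 0 there. *)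
Lemma lift_step i h : homogeneous p h -> i <= t ->
  (forall j l, i < j -> (c - bracket p h) j l = 0) ->
  (i = t -> h = 0) ->
  exists g, [/\ homogeneous p g, forall j l, i < j -> g j l = h j l &
    forall j l, i <= j -> (c - bracket p g) j l = 0].
Proof.
move=> hp le_i defect0 h_top.
have [v vE] : exists v : Hom (X i) (Y (i + p)),
    diff Y (i + p) (i + (p + 1)) ∘ v = (c - bracket p h) i (i + (p + 1)).
  have [it|ne] := eqVneq i t.
    have [v vE] := c_lift; move: h_top; rewrite it => ->//; exists v.
    by rewrite vE gmapD gmapN /bracket gcomp0l gcomp0r scaler0 subr0 oppr0 addr0.
  apply: Y_exact; first by rewrite lt_neqAle ne.
  have := congr1 (fun f : gmap X Y => f i (i + (p + 1) + 1)) (defect_closed hp).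
  rewrite gmapZ !gcompE => ->; rewrite defect0 ?comp0l ?scaler0//.
  by rewrite ltrDl.
(* The correction lives in the single source degree i: its bracket is [diff Y ∘ v] there and 0 in
   all higher source degrees. *)
pose d : gmap X Y := fun j l => cid Y (i + p) l ∘ v ∘ cid X j i.
have d0 j l : i < j -> d j l = 0.
  by move=> lt; rewrite /d (@cid_neq _ _ _ _ j) ?comp0r// gt_eqF.
have hd : homogeneous p d.
  move=> j l ne; rewrite /d; have [ji|nj] := eqVneq j i; last first.
    by rewrite (@cid_neq _ _ _ _ j) ?comp0r.
  by rewrite (@cid_neq _ _ _ _ (i + p)) ?comp0l// eq_sym -ji.
exists (h + d); split.
- exact: homD.
- by move=> j l lt; rewrite gmapD d0// addr0.
move=> j l le_j; rewrite bracketD opprD addrA gmapD.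
have [jE|ne] := eqVneq j i; last first.
  have lt : i < j by rewrite lt_neqAle eq_sym ne.
  rewrite defect0// add0r gmapN bracketE d0//.
  by rewrite comp0r d0 ?comp0l ?scaler0 ?subr0 ?oppr0//; lia.
rewrite jE; have [->|nl] := eqVneq l (i + (p + 1)); last first.
  have hR : homogeneous (p + 1) (c - bracket p h).
    by apply: homD => //; apply/homN/hom_bracket.
  by rewrite hR// gmapN (hom_bracket hd)// oppr0 addr0.
rewrite -vE gmapN bracketE (d0 (i + 1)) ?ltrDl// comp0l scaler0 subr0.
by rewrite /d !cid_refl mcomp1m mcompm1 subrr.
Qed.

(* The bound t is on the support of c and not of X: this allows to correct below
   degree t a map which is prescribed above. *)
Lemma nullhomotopic : exists h : gmap X Y,
  [/\ homogeneous p h, forall i j, t < i -> h i j = 0 & bracket p h = c].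
Proof.
pose R n (h : gmap X Y) := [/\ homogeneous p h, n = 0%N -> h = 0 &
  forall j l, t - n%:Z < j -> (c - bracket p h) j l = 0].
pose S n (h g : gmap X Y) := forall j l, t - n%:Z < j -> g j l = h j l.
have [||f [f0 fP]] := @step_choice _ R S 0.
- split=> // j l lt; rewrite gmapD gmapN c_top ?bracketE; last by lia.
  by rewrite comp0r comp0l scaler0 subr0 oppr0 addr0.
- move=> n h [hp h0 hR].
  have le_t : t - n%:Z <= t by lia.
  have [|g [hg gh gR]] := lift_step hp le_t hR; first by move=> e; apply: h0; lia.
  exists g; split=> //; split=> // j l lt; apply: gR; lia.
have stable m n j l : (m <= n)%N -> t - m%:Z < j -> f n j l = f m j l.
  move=> le_mn lt; elim: n le_mn => [|n IH]; first by rewrite leqn0 => /eqP ->.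
  rewrite leq_eqVlt => /predU1P[->//|]; rewrite ltnS => le_mn.
  by rewrite -IH//; have [_] := fP n; apply; lia.
(* At stage [N i] the components out of degrees i and i + 1, which are those that the bracket at i
   involves, are final. *)
pose N i := `|t - i|.+1%N.
pose h : gmap X Y := fun i j => f (N i) i j.
have hE n i j : t - n%:Z < i -> h i j = f n i j.
  move=> lt; rewrite /h; have [le|ge] := leqP (N i) n.
    by rewrite -(stable _ _ _ _ le)// /N; lia.
  by apply: stable => //; apply: ltnW.
exists h; split.
- by move=> i j ne; have [[hp _ _] _] := fP (N i); apply: hp.
- by move=> i j lt; rewrite (hE 0%N) ?f0//; lia.
apply: gmapP => i j; have [[_ _ fR] _] := fP (N i).
have lt : t - (N i)%:Z < i by rewrite /N; lia.
have /eqP := fR i j lt; rewrite gmapD gmapN subr_eq0 => /eqP ->.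
by rewrite !bracketE !(hE (N i))//; lia.
Qed.

End Lifting.

Lemma exact_lift (k : comPzRingType) (A : abMonCat k) (p x y z : A)
    (f : Hom x y) (g : Hom y z) (u : Hom p y) :
  projective p -> exact f g -> g ∘ u = 0 -> exists v, f ∘ v = u.
Proof.
move=> pp [K [i [e [[_ ker] epi_e <-]]]] /ker [h [hE _]].
by have [v vE] := pp _ _ e h epi_e; exists v; rewrite -mcompA vE.
Qed.

(** * Desuspension *)

Section Desuspension.
Variables (k : comPzRingType) (A : abMonCat k) (P : complex A).
Local Notation W := (desusp P).
Local Notation V := (tpowS W).

Lemma hom_eta : homogeneous (-1) (eta P).
Proof. by move=> i j ne; rewrite /eta cid_neq// eq_sym. Qed.

Lemma hom_etai : homogeneous 1 (etai P).
Proof.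
by move=> i j ne; rewrite /etai cid_neq//; apply: contra ne => /eqP ->; rewrite subrK.
Qed.

Lemma etaK : eta P ∘[1] etai P = gid P.
Proof.
apply: gmapP => i j; rewrite gcompE /eta /etai /gid.
exact: (cid_cid _ _ (esym (addrK 1 i))).
Qed.

Lemma etaiK : etai P ∘[-1] eta P = gid W.
Proof.
apply: gmapP => i j; rewrite gcompE /eta /etai cid_refl mcompm1 /gid.
have [<-|ne] := eqVneq i j; first by rewrite !cid_refl.
by rewrite !cid_neq//; apply: contra ne => /eqP; lia.
Qed.

Lemma hom_shift (X : grob A) (f : gmap X X) i j l p : homogeneous p f ->
  l = i + p -> cid X l j ∘ f i l = f i j.
Proof.
move=> fp ->; have [<-|ne] := eqVneq (i + p) j; first by rewrite cid_refl mcomp1m.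
by rewrite (cid_neq _ ne) comp0l fp// eq_sym.
Qed.

Lemma diff_etai : diff W ∘[1] etai P = - (etai P ∘[1] diff P).
Proof.
apply: gmapP => i j; rewrite gmapN !gcompE /etai (hom_shift _ (diff_homogeneous P))//.
have dE l : l = i -> - diff P l (j - 1) ∘ cid P i l = - diff P i (j - 1).
  by move=> ->; rewrite cid_refl mcompm1.
exact: dE (addrK 1 i).
Qed.

Lemma diff_eta : diff P ∘[-1] eta P = - (eta P ∘[1] diff W).
Proof.
have hd : homogeneous 1 (diff P) := diff_homogeneous P.
rewrite -[LHS](gid_l (p := 0)); last by apply: (hom_comp (p := -1) (q := 1)).
rewrite -etaK (gcompA (r := 1))//.
rewrite -(gcompA (q := 1) (p := -1) (r := 0) (etai P) (diff P))//.
rewrite -[etai P ∘[1] diff P]opprK -diff_etai gcompNl gcompNr.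
by rewrite (gcompA (q := 1) (p := -1) (r := 0) (diff W))// etaiK gid_r.
Qed.

(* The identification of P^(n + 1) with W^(n + 1) has degree n + 1. *)
Fixpoint susp n : gmap (tpowS P n) (V n) :=
  if n is n'.+1 then etai P ⊗[n'.+1%:Z] susp n' else etai P.

(** The factor undoes the Koszul sign of moving [susp] past [eta], so that this is the inverse of
    [susp]. *)
Fixpoint desus n : gmap (V n) (tpowS P n) :=
  if n is n'.+1 then ksign k n'.+1%:Z *: (eta P ⊗[- n'.+1%:Z] desus n') else eta P.

Lemma suspS n : susp n.+1 = etai P ⊗[n.+1%:Z] susp n. Proof. by []. Qed.
Lemma desusS n :
  desus n.+1 = ksign k n.+1%:Z *: (eta P ⊗[- n.+1%:Z] desus n).
Proof. by []. Qed.

Lemma hom_susp n : homogeneous n.+1%:Z (susp n).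
Proof.
elim: n => [|n IH]; first exact: hom_etai.
by rewrite suspS; apply: (hom_tens (p := 1) (q := n.+1%:Z)) => //; apply: hom_etai.
Qed.

Lemma hom_desus n : homogeneous (- n.+1%:Z) (desus n).
Proof.
elim: n => [|n IH]; first exact: hom_eta.
have e : - n.+2%:Z = -1 + - n.+1%:Z by lia.
by rewrite desusS; apply/homZ/(hom_tens e) => //; apply: hom_eta.
Qed.

Lemma desusK n : susp n ∘[- n.+1%:Z] desus n = gid (V n).
Proof.
elim: n => [|n IH]; first exact: etaiK.
have e1 : - n.+2%:Z = -1 + - n.+1%:Z by lia.
have e2 : 0 = n.+1%:Z + - n.+1%:Z by lia.
rewrite suspS desusS gcompZr.
rewrite (tens_comp (etai P) (susp n) e1 e2 hom_eta (@hom_desus n)).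
by rewrite etaiK IH gtens_id mulrN1 ksignN scalerA ksignK scale1r.
Qed.

Lemma suspK n : desus n ∘[n.+1%:Z] susp n = gid (tpowS P n).
Proof.
elim: n => [|n IH]; first exact: etaK.
have e1 : n.+2%:Z = 1 + n.+1%:Z by lia.
have e2 : 0 = - n.+1%:Z + n.+1%:Z by lia.
rewrite suspS desusS gcompZl.
rewrite (tens_comp (eta P) (desus n) e1 e2 hom_etai (@hom_susp n)).
by rewrite etaK IH gtens_id mulr1 ksignN scalerA ksignK scale1r.
Qed.

(** Closedness of [susp n] as an element of degree n + 1; the case n = 0 is the sign in the
    differential of the desuspension. *)
Lemma diff_susp n : diff (V n) ∘[n.+1%:Z] susp n =
  ksign k n.+1%:Z *: (susp n ∘[1] diff (tpowS P n)).
Proof.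
have hd := diff_homogeneous P; have hi := hom_etai.
elim: n => [|n IH]; first by rewrite ksign1 scaleN1r; apply: diff_etai.
have hs := @hom_susp n; have hdn := diff_homogeneous (tpowS P n).
have -> : diff (V n.+1) = diff W ⊗[0] gid (V n) + gid W ⊗[1] diff (V n) by [].
have -> : diff (tpowS P n.+1) = diff P ⊗[0] gid (tpowS P n) + gid P ⊗[1] diff (tpowS P n) by [].
have e1 : n.+2%:Z = 1 + n.+1%:Z by lia.
have e2 : n.+1%:Z = 0 + n.+1%:Z by lia.
have e3 : n.+1%:Z = n.+1%:Z + 0 by lia.
have e4 : n.+1%:Z + 1 = 1 + n.+1%:Z by lia.
rewrite suspS gcompDl gcompDr.
rewrite (tens_comp (p' := 1) (s := n.+1%:Z) (diff W) (gid (V n)) e1 e2 hi hs).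
rewrite (tens_comp (p' := 1) (s := 1 + n.+1%:Z) (gid W) (diff (V n)) e1 erefl hi hs).
rewrite (tens_comp (p' := 1) (q' := 0) (q := n.+1%:Z) (r := 1) (s := n.+1%:Z)
  (etai P) (susp n) erefl e3 hd (gid_homogeneous _)).
rewrite (tens_comp (p' := 0) (q' := 1) (q := n.+1%:Z) (r := 1) (s := 1 + n.+1%:Z)
  (etai P) (susp n) erefl (esym e4) (gid_homogeneous _) hdn).
rewrite mul0r ksign0 scale1r mulr1 ksign1 mulr1 mulr0 ksign0 scale1r.
rewrite diff_etai IH !gid_r (gid_l hi) (gid_l hs) gtensNl gtensZr.
have sE : ksign k n.+2%:Z = - ksign k n.+1%:Z by rewrite e1 ksignD ksign1 mulN1r.
by rewrite sE scalerDr !scalerA mulN1r mulNr ksignK scaleN1r.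
Qed.

Lemma diff_desus n : diff (tpowS P n) ∘[- n.+1%:Z] desus n =
  ksign k n.+1%:Z *: (desus n ∘[1] diff (V n)).
Proof.
have hd := diff_homogeneous (tpowS P n); have hD := @hom_desus n.
have e0 : 0 = - n.+1%:Z + n.+1%:Z by lia.
have e1 : 1 - n.+1%:Z = - n.+1%:Z + 1 by lia.
have h : homogeneous (1 - n.+1%:Z) (diff (tpowS P n) ∘[- n.+1%:Z] desus n).
  exact: (@hom_comp _ _ (- n.+1%:Z) 1).
rewrite -[LHS](gid_l h).
rewrite -suspK.
rewrite (gcompA (r := 1) (q := n.+1%:Z)); last by lia.
rewrite -(gcompA (q := 1) (p := - n.+1%:Z) (susp n) (diff _) (desus n) e1).
have -> : susp n ∘[1] diff (tpowS P n) =
   ksign k n.+1%:Z *: (diff (V n) ∘[n.+1%:Z] susp n).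
  by rewrite diff_susp scalerA ksignK scale1r.
rewrite gcompZl gcompZr (gcompA (q := n.+1%:Z) (r := 0)) ?desusK ?gid_r//.
Qed.

(** Moves a lifting problem to the powers of P, for which the resolution hypothesis is stated. *)
Lemma susp_lift n (p : A) i j l (u : Hom p (V n i)) :
  i = j + 1 -> l = i - n.+1%:Z ->
  (exists v, diff (tpowS P n) (l - 1) l ∘ v = desus n i l ∘ u) ->
  exists v, diff (V n) j i ∘ v = u.
Proof.
move=> ij li [v vE].
have jE : l - 1 + n.+1%:Z = j by lia.
exists (ksign k n.+1%:Z *: (susp n (l - 1) j ∘ v)).
have := congr1 (fun f : gmap (tpowS P n) (V n) => f (l - 1) i) (diff_susp n).
rewrite gmapZ !gcompE subrK jE => dE.
rewrite compZr mcompA dE compZl scalerA ksignK scale1r -mcompA vE mcompA.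
have := congr1 (fun f : gmap (V n) (V n) => f i i) (desusK n).
by rewrite gcompE -li /gid cid_refl => ->; rewrite mcomp1m.
Qed.

End Desuspension.

(** * The diagonal *)

Section Diagonal.
Variables (k : comPzRingType) (A : abMonCat k).
Variables (P : complex A) (eps : gmap P (unit_cplx A)).
Hypothesis eps_resolution : is_projective_resolution eps.
Hypothesis eps_pow_resolution : forall n : nat,
  is_resolution (unit_iso A n ∘[0%R] gpow eps n).
Local Notation I := (unit_cplx A).

Lemma unit_target_eq (X : grob A) (f g : gmap X I) :
  homogeneous 0 f -> homogeneous 0 g -> f 0 0 = g 0 0 -> f = g.
Proof.
move=> hf hg e; apply: gmapP => i j.
have [->|ne] := eqVneq j i; last by rewrite hf ?hg// addr0.
have [->//|i0] := eqVneq i 0.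
by have [_ z] := unit_gr_neq0 A i0; rewrite (z _ (f i i)) (z _ (g i i)).
Qed.

Lemma closed_unit (X : complex A) (e : gmap X I) :
  closed (diff X) (diff I) 0 e -> e ∘[1] diff X = 0.
Proof.
move=> ce; apply: gmapP => i j; have := ce i j.
rewrite /hom_diff ksign0 scale1r gcompE comp0l sub0r => /eqP.
by rewrite oppr_eq0 => /eqP.
Qed.

Let projP i : projective (P i). Proof. by case: eps_resolution. Qed.

Lemma hom_eps : homogeneous 0 eps.
Proof. by case: eps_resolution => [[_ []]]. Qed.

Lemma eps_diff : eps ∘[1] diff P = 0.
Proof. by case: eps_resolution => [[_ [_ /closed_unit]]]. Qed.

Definition eps2 : gmap (tensc P P) I := glam I ∘[0] (eps ⊗[0] eps).
Definition eps3 : gmap (tensc P (tensc P P)) I := glam I ∘[0] (eps ⊗[0] eps2).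

Lemma eps2_resolution : is_resolution eps2.
Proof.
have := eps_pow_resolution 2; rewrite /unit_iso /gpow /=.
by rewrite gtens_id gid_r.
Qed.

Lemma eps3_resolution : is_resolution eps3.
Proof.
have he := hom_eps.
have := eps_pow_resolution 3; rewrite /unit_iso /gpow /=.
rewrite gtens_id gid_r /eps3 /eps2.
have -> : glam I ∘[0] (gid I ⊗[0] glam I) ∘[0] (eps ⊗[0] (eps ⊗[0] eps)) =
   glam I ∘[0] (eps ⊗[0] (glam I ∘[0] (eps ⊗[0] eps))).
  by rewrite -comp00A tens_comp00// gid_l.
by [].
Qed.

Lemma hom_eps2 : homogeneous 0 eps2.
Proof. exact: hom_comp00 (@hom_glam _ _ I). Qed.

Lemma diff_top (X : complex A) (e : gmap X I) i j l (f : Hom i (X j)) :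
  is_resolution e -> 0 <= j -> diff X j l ∘ f = 0.
Proof.
move=> [z _] le_j; have [->|ne] := eqVneq l (j + 1); last first.
  by rewrite (diff_homogeneous X)// comp0l.
have lt : 0 < j + 1 by lia.
by have [_ zl] := z _ lt; rewrite (zl _ (diff X j (j + 1) ∘ f)).
Qed.

Lemma diagonal_ex : exists D : gmap P (tensc P P),
  [/\ homogeneous 0 D, diff (tensc P P) ∘[0] D = D ∘[1] diff P &
      eps2 ∘[0] D = eps].
Proof.
set Y := tensc P P.
have res2 := eps2_resolution.
have [zP _] := eps_resolution.1.
have [zY [h2 c2 epi2 top2 low2]] := res2.
have [D0 D0E] := @projP 0 _ _ (eps2 0 0) (eps 0 0) epi2.
pose h : gmap P Y := fun i j => cid Y 0 j ∘ D0 ∘ cid P i 0.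
have hN0 i j : i != 0 -> h i j = 0 by move=> ne; rewrite /h (cid_neq _ ne) comp0r.
have h00 : h 0 0 = D0 by rewrite /h !cid_refl mcompm1 mcomp1m.
have hh : homogeneous 0 h.
  move=> i j; rewrite addr0 => ne; have [i0|] := eqVneq i 0; last exact: hN0.
  by rewrite /h (@cid_neq _ _ _ _ 0 j) ?comp0l// -i0 eq_sym.
have hb : homogeneous (0 + 1) (- bracket 0 h) by apply/homN/hom_bracket.
(* The correction [g] cancels the failure of [h] to be a chain map. The bound -1 keeps it out of
   degree 0, where [D0] already lifts the augmentation. *)
have [||||g [hg g0 gE]] := @nullhomotopic _ _ P Y (-1) 0 (- bracket 0 h) hb.
- by rewrite gcompNl gcompNr bracketK scalerN.
- move=> i j lt; rewrite gmapN bracketE; have [i0|ne] := eqVneq i 0.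
    rewrite (@diff_top Y eps2) ?i0// sub0r.
    have lt1 : 0 < i + 1 by lia.
    by have [zi _] := zP _ lt1; rewrite i0 in zi *; rewrite (zi _ (h _ _)) comp0l scaler0 !oppr0.
  rewrite hN0// comp0r hN0; last by apply/eqP; lia.
  by rewrite comp0l scaler0 subr0 oppr0.
(* In degree -1 the failure is [D0 ∘ d], and composing it with [eps2] gives [eps ∘ d = 0]; exactness
   at degree 0 then lifts it. *)
- suff e0 : eps2 0 0 ∘ (- bracket 0 h) (-1) 0 = 0.
    by have [v vE] := exact_lift (@projP (-1)) top2 e0; exists v.
  rewrite gmapN bracketE.
  change (eps2 0 0 ∘ - (diff Y (-1 + 0) 0 ∘ h (-1) (-1 + 0)
     - ksign k 0 *: (h 0 0 ∘ diff P (-1) 0)) = 0).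
  rewrite hN0// comp0r sub0r opprK ksign0 scale1r h00 mcompA D0E.
  have := congr1 (fun f : gmap P I => f (-1) 0) eps_diff.
  by rewrite gcompE.
- move=> i; rewrite addr0 add0r => u lt du.
  have lt0 : i + 1 < 0 by lia.
  have := low2 _ lt0; rewrite addrK => ex.
  exact: (exact_lift (@projP i) ex du).
exists (h + g); split.
- exact: homD.
- have : bracket 0 (h + g) = 0 by rewrite bracketD gE subrr.
  by rewrite /bracket ksign0 scale1r => /eqP; rewrite subr_eq0 => /eqP.
apply: unit_target_eq; [exact: hom_comp00|exact: hom_eps|].
by rewrite gcompE addr0 gmapD h00 g0// addr0.
Qed.

(** The uniqueness half of the comparison theorem: the condition on [eps] starts the homotopy in
    degree 0, and exactness continues it below. *)
Lemma augmented_nullhomotopic (f : gmap P P) : homogeneous 0 f ->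
  diff P ∘[0] f = f ∘[1] diff P -> eps ∘[0] f = 0 ->
  exists h : gmap P P, homogeneous (-1) h /\ bracket (-1) h = f.
Proof.
move=> hf df ef.
have [zP [_ _ _ top1 low1]] := eps_resolution.1.
have [||||h [hh _ hE]] := @nullhomotopic _ _ P P 0 (-1) f hf.
- by rewrite (_ : -1 + 1 = 0 :> int)// ksign0 scale1r.
- by move=> i j lt; have [zi _] := zP _ lt; apply: zi.
- have e0 : eps 0 0 ∘ f 0 0 = 0.
    by have := congr1 (fun g : gmap P I => g 0 0) ef; rewrite gcompE.
  by have [v vE] := exact_lift (@projP 0) top1 e0; exists v.
- move=> i; rewrite (_ : -1 + 1 = 0 :> int)// addr0 => u lt du.
  exact: (exact_lift (@projP i) (low1 _ lt) du).
by exists h.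
Qed.

Section Counit.
Variable D : gmap P (tensc P P).
Hypothesis hD : homogeneous 0 D.
Hypothesis D_chain : diff (tensc P P) ∘[0] D = D ∘[1] diff P.
Hypothesis D_lift : eps2 ∘[0] D = eps.

Let tens_diffE (X Y : complex A) :
  diff (tensc X Y) = diff X ⊗[0] gid Y + gid X ⊗[1] diff Y.
Proof. by []. Qed.

Lemma left_counit : exists h : gmap P P, homogeneous (-1) h /\
  bracket (-1) h = glam P ∘[0] ((eps ⊗[0] gid P) ∘[0] D) - gid P.
Proof.
have he := hom_eps; have hd := diff_homogeneous P.
apply: augmented_nullhomotopic; first by [].
- rewrite gcompDl gcompDr gcompNl gcompNr gid_r (gid_l hd); congr (_ - _).
  have e1 : (gid I ⊗[1] diff P) ∘[0] (eps ⊗[0] gid P) =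
      (eps ⊗[0] gid P) ∘[1] diff (tensc P P).
    rewrite tens_diffE gcompDr tens_comp_p// eps_diff gtens0l add0r.
    by rewrite tens_comp_r0// tens_comp_l0// gid_l// gid_r gid_r gid_l.
  rewrite comp00A -(glam_nat hd) -comp10A (comp00A (gid I ⊗[1] diff P)) e1.
  rewrite -comp10A D_chain -[RHS]comp01A; congr (_ ∘[1] _).
  by rewrite comp01A.
rewrite gcompDr gcompNr gid_r comp00A -(glam_nat he) -comp00A.
rewrite (comp00A _ (eps ⊗[0] gid P)) tens_comp00// gid_l// gid_r.
by rewrite comp00A -/eps2 D_lift subrr.
Qed.

(** Naturality turns the augmentation into [grho I] after [eps ⊗ eps] and D, whereas [eps2] is built
    with [glam I]; [grho_unit] closes the gap. *)
Lemma right_counit : exists h : gmap P P, homogeneous (-1) h /\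
  bracket (-1) h = grho P ∘[0] ((gid P ⊗[0] eps) ∘[0] D) - gid P.
Proof.
have he := hom_eps; have hd := diff_homogeneous P.
apply: augmented_nullhomotopic; first by [].
- rewrite gcompDl gcompDr gcompNl gcompNr gid_r (gid_l hd); congr (_ - _).
  have e1 : (diff P ⊗[0] gid I) ∘[0] (gid P ⊗[0] eps) =
      (gid P ⊗[0] eps) ∘[1] diff (tensc P P).
    rewrite tens_diffE gcompDr (tens_comp_l0 (q := 1))// eps_diff gtens0r addr0.
    by rewrite tens_comp_r0// tens_comp_p// gid_r gid_r gid_l// gid_l.
  rewrite comp00A -(grho_nat hd) -comp10A (comp00A (diff P ⊗[0] gid I)) e1.
  rewrite -comp10A D_chain -[RHS]comp01A; congr (_ ∘[1] _).
  by rewrite comp01A.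
rewrite gcompDr gcompNr gid_r comp00A -(grho_nat he) -comp00A.
rewrite (comp00A _ (gid P ⊗[0] eps)) tens_comp00// gid_l// gid_r grho_unit.
by rewrite comp00A -/eps2 D_lift subrr.
Qed.

Lemma diagonal_lifts : (eps ⊗[0] eps) ∘[0] D = glami I ∘[0] eps.
Proof.
have he := hom_eps.
by rewrite -[in RHS]D_lift /eps2 -comp00A comp00A glamK gid_l.
Qed.

(* Both iterates of the diagonal lift the augmentation of P. *)
Lemma coassociator_augmented :
  eps3 ∘[0] (gassoc P P P ∘[0] ((D ⊗[0] gid P) ∘[0] D) - (gid P ⊗[0] D) ∘[0] D) = 0.
Proof.
have he := hom_eps.
have he2 : homogeneous 0 eps2 by exact: hom_eps2.
have -> : eps3 = glam I ∘[0] (gid I ⊗[0] glam I) ∘[0] (eps ⊗[0] (eps ⊗[0] eps)).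
  by rewrite /eps3 /eps2 -comp00A tens_comp00// gid_l.
rewrite gcompDr gcompNr; apply/eqP; rewrite subr_eq0; apply/eqP.
transitivity eps.
  rewrite comp00A -(comp00A _ _ (gassoc P P P)) -gassoc_nat0//.
  rewrite -!comp00A (comp00A (gid I ⊗[0] glam I)) gtriangle grho_unit.
  rewrite (comp00A _ (D ⊗[0] gid P)) tens_comp00// (comp00A (glam I ⊗[0] gid I)).
  rewrite tens_comp00// gid_r gid_l// (comp00A (glam I) (eps ⊗[0] eps)) -/eps2.
  by rewrite D_lift comp00A -/eps2 D_lift.
rewrite -!comp00A (comp00A _ (gid P ⊗[0] D)) tens_comp00// gid_r.
rewrite (comp00A (gid I ⊗[0] glam I)) tens_comp00// gid_l//.
rewrite (comp00A (glam I) (eps ⊗[0] eps)) -/eps2 D_lift comp00A -/eps2.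
by rewrite D_lift.
Qed.

End Counit.
End Diagonal.

(** * The A-infinity equations as the square of a derivation *)

Section MaurerCartan.
Variables (k : comPzRingType) (A : abMonCat k) (W : complex A).
Local Notation V := (tpowS W).
Implicit Type b : forall n, gmap W (V n).

Lemma der2_eq b b' n : (forall j, (j <= n)%N -> b j = b' j) ->
  der2 b 0 n = der2 b' 0 n.
Proof.
move=> e; apply: eq_big_nat => j /andP[_ lt_j]; rewrite !der0 e//.
by rewrite (@der_eq1 _ _ _ b b')//; apply: e; lia.
Qed.

(** The newest component enters only the two extreme summands, where its partner is the
    differential. The equation therefore asks its bracket to cancel a sum in the earlier
    components. *)
Lemma der2_split b n : b 0%N = diff W -> der2 b 0 n.+1 =
  bracket 1 (b n.+1) + \sum_(1 <= j < n.+1) (der b j n.+1 ∘[1] b j).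
Proof.
move=> b0; rewrite /der2 big_nat_recr//= big_ltn// -addrA addrC -addrA.
rewrite [RHS]addrC; congr (_ + _).
by rewrite !der0 (der_diff _ b0) b0 /bracket ksign1 scaleN1r opprK.
Qed.

(* The components b_1 = d, b_2, b_3, ... of an A-infinity structure with xi_1 = 0,
   shifted by one. *)
Definition mc_family (xi : forall n, gmap W (tpow W n)) n : gmap W (V n) :=
  match n return gmap W (V n) with
  | 0%N => diff W
  | n'.+1 => xi n'.+2
  end.

(** [mc_family] puts d in the place of [xi 1 = 0]: the extreme summands of D^2 become the
    differential of [xi n], the inner ones the pre-Lie product. *)
Lemma Ainf_der2 (xi : forall n, gmap W (tpow W n)) :
  (forall n, homogeneous 1 (xi n)) -> xi 0%N = 0 -> xi 1%N = 0 ->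
  (forall n, der2 (mc_family xi) 0 n = 0) ->
  forall n i j, hom_diff (diff W) (diff (tpow W n)) 1 (xi n) i j
    + bullet xi xi n i j = 0.
Proof.
move=> hxi xi0 xi1 mc n i j; rewrite hom_diffE -gmapD.
suff -> : bracket 1 (xi n) + bullet xi xi n = 0 by [].
case: n => [|[|n]].
- rewrite /bracket xi0 gcomp0l gcomp0r scaler0 subrr add0r.
  apply: gmapP => i' j'; rewrite /bullet big1// => a _; rewrite big1// => c _.
  rewrite big1// => d /eqP e; have -> : c = 0 :> nat by lia.
  by rewrite xi0 insert_0 gcomp0l gcomp0r.
- rewrite bullet_der// big_nat1 xi1 gcomp0r addr0.
  by rewrite /bracket gcomp0l gcomp0r scaler0 subrr.
rewrite bullet_der//.
rewrite -[RHS](mc n.+1) der2_split//; congr (_ + _).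
rewrite big_ltn// xi1 gcomp0r add0r big_nat_recr//=.
(* The last summand keeps the power, so it sees only [xi 1] and vanishes. *)
rewrite (@der_eq1 _ _ _ _ (fun _ => 0)); last by rewrite subnn xi1.
rewrite (_ : der _ _ _ = 0) ?gcomp0l ?addr0; last first.
  elim: (n.+1) => [|m IH]; first by rewrite der0.
  by rewrite derSS IH gtens0l gtens0r gcomp0r addr0.
apply: eq_big_nat => m lt_m.
rewrite (@der_eq1 _ _ _ _ (mc_family xi)); first by case: m lt_m.
by have -> : (n.+1 - m = (n - m).+1)%N by lia.
Qed.

End MaurerCartan.

(** * Obstruction theory *)

Section Obstruction.
Variables (k : comPzRingType) (A : abMonCat k).
Variables (P : complex A) (eps : gmap P (unit_cplx A)).
Hypothesis eps_resolution : is_projective_resolution eps.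
Hypothesis eps_pow_resolution : forall n : nat,
  is_resolution (unit_iso A n ∘[0%R] gpow eps n).
Variable D : gmap P (tensc P P).
Hypothesis hD : homogeneous 0 D.
Hypothesis D_chain : diff (tensc P P) ∘[0] D = D ∘[1] diff P.
Hypothesis D_lift : eps2 eps ∘[0] D = eps.
Local Notation W := (desusp P).
Local Notation V := (tpowS W).
Implicit Type b : forall n, gmap W (V n).

Definition xi2 : gmap W (V 1) := (etai P ⊗[1] etai P) ∘[-1] (D ∘[-1] eta P).

Lemma xi2E : xi2 = susp P 1 ∘[-1] (D ∘[-1] eta P). Proof. by []. Qed.

Lemma hom_xi2 : homogeneous 1 xi2.
Proof. exact: (@hom_comp _ _ (-1) 2 1 _ _ _ _ _ erefl (@hom_susp _ _ P 1)). Qed.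

Lemma xi2_bracket : bracket 1 xi2 = 0.
Proof.
have hd : homogeneous 1 (diff P) := diff_homogeneous P.
rewrite /bracket ksign1 scaleN1r opprK xi2E.
rewrite -(gcompA (q := 2) (p := -1) (r := 1) (diff (V 1)))//.
rewrite (diff_susp P 1) (_ : ksign k 2%:Z = 1); last by rewrite /ksign sqrrN expr1n.
rewrite scale1r (gcompA (q := 1) (p := -1) (r := 0))//.
rewrite -(gcompA (q := 0) (p := -1) (r := -1) (diff (tensc P P)))// D_chain.
rewrite (gcompA (q := 1) (p := -1) (r := 0))// diff_eta gcompNr gcompNr.
rewrite (gcompA (q := -1) (p := 1) (r := 0) (susp P 1))//.
rewrite (gcompA (q := -1) (p := 1) (r := 0) D)//.
by rewrite addNr.
Qed.

(** Degree i of V n is degree i - (n + 1) of the power of P; the bound on i makes this negative,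
    away from the augmentation. *)
Lemma tens_pow_exact n (p : A) (i j : int) (u : Hom p (V n i)) :
  projective p -> i = j + 1 -> i < n.+1%:Z -> diff (V n) i (i + 1) ∘ u = 0 ->
  exists v, diff (V n) j i ∘ v = u.
Proof.
move=> pp ij lt du; apply: (@susp_lift _ _ P n p i j (i - n.+1%:Z)) => //.
have [_ [_ _ _ _ low]] := eps_pow_resolution n.+1.
have lt0 : i - n.+1%:Z < 0 by lia.
apply: (exact_lift pp (low _ lt0)).
have := congr1 (fun f : gmap (V n) (tpowS P n) => f i (i - n.+1%:Z + 1)) (diff_desus P n).
rewrite gmapZ !gcompE mcompA => ->.
by rewrite compZl -mcompA du comp0r scaler0.
Qed.

Definition coassociator : gmap P (tensc P (tensc P P)) :=
  gassoc P P P ∘[0] ((D ⊗[0] gid P) ∘[0] D) - (gid P ⊗[0] D) ∘[0] D.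

(** The Koszul sign in [e3] turns the sum of the two iterates of [xi2] into the difference of the
    two iterates of D. *)
Lemma obstruction3 b : b 0%N = diff W -> b 1%N = xi2 -> b 2%N = 0 ->
  der2 b 0 2 = susp P 2 ∘[-1] (coassociator ∘[-1] eta P).
Proof.
move=> b0 b1 b2; rewrite der2_split// big_nat1 b2 b1.
rewrite /bracket gcomp0l gcomp0r scaler0 subrr add0r derSS der0 b1.
change (1 - 0)%N with 1%N.
have -> : cat W 1 0 2 = gassoc W W W.
  rewrite catSS cat0S tcast_refl gtens_id gtens_id gid_l//.
have hi := @hom_etai _ _ P.
have e1 : xi2 ∘[1] etai P = susp P 1 ∘[0] D.
  rewrite xi2E (gcompA (q := -1) (p := 1) (r := 0))//.
  by rewrite (gcompA (q := -1) (p := 1) (r := 0) D)// etaK gid_r.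
have e2 : (xi2 ⊗[0] gid (V 0)) ∘[2] susp P 1 =
    (susp P 1 ⊗[1] etai P) ∘[0] (D ⊗[0] gid P).
  rewrite (@tens_comp _ _ 1 1 0 2 1)//.
  rewrite mul0r ksign0 scale1r e1 gid_l// tens_comp_r0// gid_r//.
have e3 : (gid W ⊗[1] xi2) ∘[2] susp P 1 =
    - (susp P 2 ∘[0] (gid P ⊗[0] D)).
  rewrite (@tens_comp _ _ 1 1 1 2 2)// mulr1 ksign1 scaleN1r e1 gid_l//.
  by rewrite [susp P 2]suspS tens_comp_r0// gid_r.
set X := D ∘[-1] eta P.
have e4 : gassoc W W W ∘[1] (xi2 ⊗[0] gid (V 0)) ∘[1] xi2 =
    susp P 2 ∘[-1] (gassoc P P P ∘[0] (D ⊗[0] gid P) ∘[-1] X).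
  rewrite (gcompA (q := 1) (p := 1) (r := 2))// {2}xi2E.
  rewrite -(gcompA (q := 2) (p := -1) (r := 1) (xi2 ⊗[0] gid (V 0)))// e2.
  rewrite -(gcompA (q := 3) (p := -1) (r := 2) (gassoc W W W))//.
  rewrite -(gcompA (q := 3) (p := 0) (r := 3) (gassoc W W W))//.
  rewrite (@gassoc_nat _ _ 1 1 1 3 P W P W P W _ _ _ erefl hi hi hi).
  rewrite (gcompA (q := 0) (p := 0) (r := 0))//.
  by rewrite (gcompA (q := 0) (p := -1) (r := -1))//.
have e5 : (gid W ⊗[1] xi2) ∘[1] xi2 = - (susp P 2 ∘[-1] ((gid P ⊗[0] D) ∘[-1] X)).
  rewrite {2}xi2E -(gcompA (q := 2) (p := -1) (r := 1) (gid W ⊗[1] xi2))// e3.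
  by rewrite gcompNl (gcompA (q := 0) (p := -1) (r := -1)).
rewrite gcompDl e4 e5 -gcompNr -gcompDr; congr (_ ∘[-1] _).
rewrite /coassociator gcompDl gcompNl /X; congr (_ - _).
  by rewrite !(gcompA (q := 0) (p := -1) (r := -1)).
by rewrite !(gcompA (q := 0) (p := -1) (r := -1)).
Qed.

(** The borderline case left open by [tens_pow_exact]: degree 3 of V 2 is degree 0 of the cube of P,
    where exactness involves the augmentation. *)
Lemma tens_cube_exact (p : A) (u : Hom p (V 2 3)) :
  projective p -> eps3 eps 0 0 ∘ (desus P 2 3 0 ∘ u) = 0 ->
  exists v, diff (V 2) 2 3 ∘ v = u.
Proof.
move=> pp eu; apply: (@susp_lift _ _ P 2 p 3 2 0) => //.
have [_ [_ _ _ top3 _]] := eps3_resolution eps_resolution eps_pow_resolution.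
exact: (exact_lift pp top3 eu).
Qed.

Lemma obstruction3_lift b : b 0%N = diff W -> b 1%N = xi2 -> b 2%N = 0 ->
  eps3 eps 0 0 ∘ (desus P 2 3 0 ∘ der2 b 0 2 1 3) = 0.
Proof.
move=> b0 b1 b2; rewrite (obstruction3 b0 b1 b2).
have e1 : desus P 2 ∘[2] (susp P 2 ∘[-1] (coassociator ∘[-1] eta P)) =
    coassociator ∘[-1] eta P.
  rewrite -(gcompA (q := 3) (p := -1) (r := 2))// suspK gid_l//.
  apply: (@hom_comp _ _ (-1) 0 (-1)) => //.
  by apply: homD; [|apply: homN].
have := congr1 (fun f : gmap W (tpowS P 2) => f 1 0) e1; rewrite !gcompE => e2.
transitivity (eps3 eps 0 0 ∘ (coassociator 0 0 ∘ eta P 1 0)).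
  by congr (_ ∘ _); exact: e2.
have := congr1 (fun f : gmap P (unit_cplx A) => f 0 0)
  (coassociator_augmented eps_resolution hD D_lift).
by rewrite gcompE mcompA => ->; rewrite comp0l.
Qed.

Definition partial_structure N b :=
  [/\ forall n, homogeneous 1 (b n), b 0%N = diff W, b 1%N = xi2 &
      forall j, (j < N)%N -> der2 b 0 j = 0].

Lemma partial_structure_extend N b : (1 < N)%N -> partial_structure N b ->
  exists b', partial_structure N.+1 b' /\ forall j, (j < N)%N -> b' j = b j.
Proof.
case: N => [|M] //; rewrite ltnS; set N := M.+1 => M_gt0 [hb b0 b1 mc].
(* With component N set to 0, the Nth component of D^2 involves only what is already built: this is
   the obstruction [O]. *)
pose c0 n := if (n < N)%N then b n else 0.
have c0E j : (j < N)%N -> c0 j = b j by rewrite /c0 => ->.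
have c0N : c0 N = 0 by rewrite /c0 ltnn.
have hc0 n : homogeneous 1 (c0 n) by rewrite /c0; case: ifP.
have c00 : c0 0%N = diff W by rewrite c0E.
have c01 : c0 1%N = xi2 by rewrite c0E.
have mc0 j : (j < N)%N -> der2 c0 0 j = 0.
  by move=> lt; rewrite -(mc _ lt); apply: der2_eq => l le; apply: c0E; lia.
set O := der2 c0 0 N.
have hO : homogeneous 2 O by apply: hom_der2.
have O_closed : diff (V N) ∘[2] O = O ∘[1] diff W.
  by have := der2_closed hc0 mc0; rewrite der_diff// c00.
have zW i : 1 < i -> is_zero (W i).
  by move=> lt; have [zP _] := eps_resolution.1; apply: zP; lia.
have projW i : projective (W i) by case: eps_resolution => _; apply.
have hcO : homogeneous (1 + 1) (- O) by apply: homN.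
have [||||h [hh _ hE]] := @nullhomotopic _ _ W (V N) 1 1 (- O) hcO.
- rewrite (_ : 1 + 1 = 2 :> int)// (_ : ksign k 2 = 1); last first.
    by rewrite /ksign sqrrN expr1n.
  by rewrite scale1r gcompNl gcompNr O_closed.
- by move=> i j lt; have [zi _] := zW _ lt; apply: zi.
(* [W 1] is [P 0], and [O] sends it to degree 2 - N of the power of P: degree 0 for N = 2, a
   negative degree otherwise. *)
- have [M1|M1] := eqVneq M 1%N.
    subst M; apply: (@tens_cube_exact _ ((- O) 1 3) (projW 1)).
    rewrite gmapN -scaleN1r !compZr.
    apply: (etrans (congr1 (fun f => -1 *: f) (obstruction3_lift c00 c01 c0N))).
    exact: scaler0.
  apply: (tens_pow_exact (projW 1)) => //; first by rewrite /N; lia.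
  have e : diff (V N) 3 4 ∘ O 1 3 = 0.
    have := congr1 (fun f : gmap W (V N) => f 1 4) O_closed; rewrite !gcompE => e.
    have [_ z2] := zW 2 isT.
    by apply: (etrans e); rewrite (z2 _ (diff W 1 (1 + 1))) comp0r.
  rewrite gmapN -scaleN1r compZr.
  by apply: (etrans (congr1 (fun f => -1 *: f) e)); apply: scaler0.
- move=> i u lt du; apply: (tens_pow_exact (projW i)) => //; first by lia.
  by rewrite /N; lia.
(* As [tcast] vanishes off the index N, this inserts [h] as component N and changes nothing else. *)
exists (fun n => c0 n + tcast W N.+1 n.+1 ∘[1] h).
have b'E j : (j < N)%N -> c0 j + tcast W N.+1 j.+1 ∘[1] h = b j.
  by move=> lt; rewrite c0E// tcast_neq ?gcomp0l ?addr0//; apply/eqP; lia.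
have b'N : c0 N + tcast W N.+1 N.+1 ∘[1] h = h.
  by rewrite c0N add0r tcast_refl gid_l.
split; last exact: b'E.
split; [|by rewrite b'E|by rewrite b'E|].
  by move=> n; apply: homD => //; apply: hom_comp01; apply: hom_tcast.
move=> j; rewrite ltnS leq_eqVlt => /predU1P[->|lt]; last first.
  by rewrite -(mc _ lt); apply: der2_eq => l le; apply: b'E; lia.
have OE := der2_split M c00; rewrite -/N -/O c0N in OE.
rewrite (@der2_split _ _ _ _ M) -/N; last by rewrite b'E.
rewrite b'N hE OE /bracket gcomp0l gcomp0r scaler0 subrr add0r.
rewrite addrC; apply/eqP; rewrite subr_eq0; apply/eqP.
apply: eq_big_nat => l /andP[l_gt0 lt_l]; rewrite b'E// c0E//; congr (_ ∘[1] _).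
by apply: der_eq1; rewrite b'E ?c0E//; lia.
Qed.

End Obstruction.

(** * Assembly of all components *)

Section Structure.
Variables (k : comPzRingType) (A : abMonCat k).
Variables (P : complex A) (eps : gmap P (unit_cplx A)).
Hypothesis eps_resolution : is_projective_resolution eps.
Hypothesis eps_pow_resolution : forall n : nat,
  is_resolution (unit_iso A n ∘[0%R] gpow eps n).
Variable D : gmap P (tensc P P).
Hypothesis hD : homogeneous 0 D.
Hypothesis D_chain : diff (tensc P P) ∘[0] D = D ∘[1] diff P.
Hypothesis D_lift : eps2 eps ∘[0] D = eps.
Local Notation W := (desusp P).
Local Notation V := (tpowS W).

Lemma full_structure : exists b : forall n, gmap W (V n),
  [/\ forall n, homogeneous 1 (b n), b 0%N = diff W, b 1%N = xi2 D &
      forall n, der2 b 0 n = 0].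
Proof.
pose base n : gmap W (V n) :=
  match n return gmap W (V n) with 0%N => diff W | 1%N => xi2 D | _ => 0 end.
have R0 : partial_structure D 2 base.
  split=> //.
    by case=> [|[|n]]; [apply: diff_homogeneous|apply: hom_xi2|apply: hom0].
  case=> [|[|//]] _; first by rewrite /der2 big_nat1 der0 diffK.
  by rewrite der2_split// big_geq// addr0; apply: xi2_bracket.
have [|f [f0 fP]] := @step_choice _ (fun n => partial_structure D n.+2)
  (fun n b b' => forall j, (j < n.+2)%N -> b' j = b j) base R0.
  by move=> n b; apply: (partial_structure_extend eps_resolution eps_pow_resolution hD D_lift).
(* Steps after stage j change only components of index at least j + 2, so the diagonal family agrees
   with [f n] up to index n, which is all that [der2 _ 0 n] depends on. *)
have stable j n : (j <= n)%N -> f n j = f j j.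
  elim: n => [|n IH]; first by rewrite leqn0 => /eqP ->.
  rewrite leq_eqVlt => /predU1P[->//|]; rewrite ltnS => le_j.
  by rewrite -IH//; have [_] := fP n; apply; lia.
exists (fun j => f j j); split.
- by move=> n; have [[hf _ _ _] _] := fP n.
- by rewrite f0.
- by have [[_ _ f1 _] _] := fP 1%N.
move=> n; have [[_ _ _ mc] _] := fP n; rewrite -(mc n)//.
by apply: der2_eq => j le_j; rewrite (stable j n).
Qed.

End Structure.

Theorem proposition5p3 (k : comPzRingType) (A : abMonCat k)
    (A_enough : enough_projectives A)
    (P : complex A) (eps : gmap P (unit_cplx A))
    (eps_resolution : is_projective_resolution eps)
    (eps_pow_resolution : forall n : nat,
       is_resolution (unit_iso A n ∘[0%R] gpow eps n)) :
  exists (xi : forall n : nat, gmap (desusp P) (tpow (desusp P) n))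
         (Delta : gmap P (tensc P P)),
    [/\ Ainf_coalgebra xi,
        is_comult xi Delta,
        homotopy_counit xi Delta eps &
        lifts_unit Delta eps].
Proof.
have [D [hD D_chain D_lift]] := diagonal_ex eps_resolution eps_pow_resolution.
have [b [hb b_0 b_1 mc]] :=
  full_structure eps_resolution eps_pow_resolution hD D_chain D_lift.
(* [b n] has target the power n + 1, hence the shift; [b 0] is the differential, which the equations
   count separately, so [xi 1] is 0. *)
pose xi n : gmap (desusp P) (tpow (desusp P) n) :=
  match n return gmap (desusp P) (tpow (desusp P) n) with
  | n'.+2 => b n'.+1
  | _ => 0
  end.
have hxi n : homogeneous 1 (xi n) by case: n => [|[|n]] //; apply: hb.
(* The counit conditions refer to [b1]; since it is the differential of P, the homotopies found for
   P apply. The sign in [b1] cancels that of [diff_etai]. *)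
have b1E : b1 xi = diff P.
  rewrite /b1; have -> : gadd (diff (desusp P)) (xi 1%N) = diff (desusp P).
    exact: addr0.
  rewrite diff_etai.
  have -> : eta P ∘[2] (- (etai P ∘[1] diff P)) = - diff P.
    by rewrite gcompNr comp11A etaK gid_l.
  exact: opprK.
exists xi, D; split.
- split=> //; apply: Ainf_der2 => // n; rewrite -(mc n); apply: der2_eq.
  by case=> [|j] _; rewrite ?b_0.
- split=> // i j; rewrite -[xi 2%N]/(b 1%N) b_1.
  by [].
- have [[_ [he ce _ _ _]] _] := eps_resolution.
  have [h1 [hh1 h1E]] := left_counit eps_resolution D_chain D_lift.
  have [h2 [hh2 h2E]] := right_counit eps_resolution D_chain D_lift.
  split=> //; rewrite b1E => //.
  + by exists h1; split=> // i j; rewrite hom_diffE h1E.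
  + by exists h2; split=> // i j; rewrite hom_diffE h2E.
by move=> i j; rewrite (diagonal_lifts eps_resolution D_lift).
Qed.
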